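(* Let $\mathcal G$ be a finite directed graph (loops and multiple arcs allowed) and let $(X,\nu)$ be a probability space. Suppose that to each arc $e$ of $\mathcal G$ a measure-preserving transformation $T_e$ of $(X,\nu)$ is assigned. For a finite path $l=e_1\dots e_k$ in $\mathcal G$ put $T_l=T_{e_1}\cdots T_{e_k}$ (the identity for the empty path), acting on functions by $T_l\varphi=\varphi\circ T_l$. For a finite set $L$ of paths put $s(L)=\frac{1}{\#L}\sum_{l\in L}T_l$ if $L\neq\varnothing$ and $s(\varnothing)=0$. For vertices $u,v$ and $n\ge 0$ let $L_{u,v,n}$ be the set of paths of length $n$ from $u$ to $v$ (where $L_{u,u,0}$ consists of the empty path at $u$ and $L_{u,v,0}=\varnothing$ for $u\ne v$), and $L_{u,*,n}=\bigcup_{v}L_{u,v,n}$. Define $$c_{u,v,N}=\frac1N\sum_{n=0}^{N-1}s(L_{u,v,n}),\qquad c_{u,*,N}=\frac1N\sum_{n=0}^{N-1}s(L_{u,*,n}).$$ Then for all vertices $u,v,v_0$ of $\mathcal G$: (1a) for every $p\in[1,\infty)$ and $\varphi\in L^p(X,\nu)$ the sequence $c_{u,v,N}(\varphi)$ converges in $L^p(X,\nu)$; (1b) for every $\varphi\in L^\infty(X,\nu)$ the sequence $c_{u,v,N}(\varphi)$ converges $\nu$-almost everywhere; (2a) for every $p\in[1,\infty)$ and $\varphi\in L^p(X,\nu)$ the sequence $c_{v_0,*,N}(\varphi)$ converges in $L^p(X,\nu)$; (2b) for every $\varphi\in L^\infty(X,\nu)$ the sequence $c_{v_0,*,N}(\varphi)$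 converges $\nu$-almost everywhere.
   Context: A path $e_1\dots e_k$ is a sequence of arcs with the head of $e_{j-1}$ equal to the tail of $e_j$; its length is $k$; it goes from the tail of $e_1$ to the head of $e_k$. *)

(* Defs.v *)
From HB Require Import structures.
From mathcomp Require Import all_boot all_order all_algebra.
From mathcomp Require Import all_classical all_reals all_analysis.
Set Implicit Arguments. Unset Strict Implicit. Unset Printing Implicit Defensive.
Import Order.TTheory GRing.Theory Num.Theory.
Import numFieldNormedType.Exports.
Local Open Scope classical_set_scope.
Local Open Scope ring_scope.

(* A finite directed graph (loops, multiple arcs allowed): finite vertex type V,
   finite arc type E, tail map [src] and head map [tgt]. *)

Fixpoint is_path (V E : finType) (src tgt : E -> V) (u v : V) (l : seq E) : bool :=
  match l with
  | [::] => u == v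
  | e :: l' => (src e == u) && is_path src tgt (tgt e) v l'
  end.

Definition paths_uv (V E : finType) (src tgt : E -> V) (u v : V) (n : nat)
  : {set n.-tuple E} := [set l : n.-tuple E | is_path src tgt u v l].

Definition paths_u (V E : finType) (src tgt : E -> V) (u : V) (n : nat)
  : {set n.-tuple E} := \bigcup_(v : V) paths_uv src tgt u v n.

Definition Tpath (X E : Type) (T : E -> X -> X) (l : seq E) : X -> X :=
  foldr (fun e f => T e \o f) id l.

Definition savg (R : realType) (X : Type) (E : finType) (T : E -> X -> X) (n : nat)
  (L : {set n.-tuple E}) (phi : X -> R) : X -> R :=
  fun x => if #|L| == 0%N then 0
           else (#|L|%:R)^-1 * \sum_(l in L) phi (Tpath T l x).

Definition cesaro_avg (R : realType) (X : Type) (E : finType) (T : E -> X -> X)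
  (L : forall n : nat, {set n.-tuple E}) (N : nat) (phi : X -> R) : X -> R :=
  fun x => (N%:R)^-1 * \sum_(n < N) savg T (L n) phi x.

Definition measure_preserving d (X : measurableType d) (R : realType)
  (nu : {measure set X -> \bar R}) (f : X -> X) : Prop :=
  measurable_fun [set: X] f /\
  forall A : set X, measurable A -> nu (f @^-1` A) = nu A.

(* f is a (representative of an element) of L^p(X,nu), p in [1,+oo] *)
Definition in_Lp d (X : measurableType d) (R : realType)
  (nu : {measure set X -> \bar R}) (p : \bar R) (f : X -> R) : Prop :=
  measurable_fun [set: X] f /\ finite_norm nu p f.

Definition Lp_converges d (X : measurableType d) (R : realType)
  (nu : {measure set X -> \bar R}) (p : R) (u : nat -> X -> R) : Prop :=
  exists g : X -> R, in_Lp nu p%:E g /\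
    ((fun N => Lnorm nu p%:E (EFin \o (u N \- g))) @ \oo --> 0%E).

Definition ae_converges d (X : measurableType d) (R : realType)
  (nu : {measure set X -> \bar R}) (u : nat -> X -> R) : Prop :=
  {ae nu, forall x, cvg ((fun N => u N x) @ \oo)}.

(* Main.v *)
(* For [0 <= phi <= 1], the sums S_n(u) of phi o T_l over the paths l of length n
   from u to v solve a linear system with positive operator coefficients, and the
   numbers a_n(u) of such paths solve the scalar version of this system.
   Replacing the system by its q-th power, for a suitable q, removes all
   periodicities: every nontrivial strongly connected component becomes
   primitive.  On such a component, conjugation by the Perron eigenvector turns
   the operator matrix into a Markov kernel over (X, nu) with an invariant
   weight, to which a pointwise ergodic theorem, proved with Garsia's maximal
   inequality, applies.

   Going through the components one after the other, Duhamel's formula expresses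
   S_n as a convolution, and one shows by induction that a_n behaves like
   c l^n n^k and that the averages of l^-n S_n with the corresponding polynomial
   weights converge almost everywhere; the case of equal growth rates relies on
   Maker's version of the ergodic theorem, which needs bounded functions.
   Summation by parts turns this into the convergence of the averages of
   S_n / a_n, and the q residue classes are then put together.  Convergence in
   L^p follows by truncation, the averages being contractions of L^p. *)
Require Import Defs.
From HB Require Import structures.
From mathcomp Require Import all_boot all_order all_algebra.
From mathcomp Require Import all_classical all_reals all_analysis.
From mathcomp Require Import measurable_realfun ess_sup_inf ring lra.
Import Order.TTheory GRing.Theory Num.Theory.
Import numFieldNormedType.Exports.
Local Open Scope classical_set_scope.
Local Open Scope ring_scope.
Set Implicit Arguments.
Unset Strict Implicit.
Unset Printing Implicit Defensive.

(** * Polynomially weighted averages of real sequences *)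

(** The averages are ratios S_n / a_n, to which no ergodic theorem applies directly, and l^-n S_n
    itself need not converge; only its weighted averages do. Every inductive step therefore carries
    a pair: the order of growth of a_n, with a strictly positive constant, and the a.e. convergence
    of the weighted partial sums of l^-n S_n. Positive constants exclude cancellation between terms
    of equal rate, and 0 <= S_n <= a_n makes slower terms negligible. The T_e need not commute or be
    invertible. The operators enter only through positivity, linearity, their action on constants
    and on means, and preservation of null sets; [kop] packages these. Inserting constant functions
    recovers the scalar system, so one Duhamel formula serves both. The system is indexed by the end
    of the path: the last arc acts innermost in T_l, so appending an arc means applying one more
    operator from outside, as a linear recursion does. Binomial weights replace n^k because
    summation raises their degree exactly, without error terms. *)

Section RealSequences.
Context {R : realType}.
Implicit Types (u v x y z : nat -> R) (k m n : nat) (q c e : R).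

Lemma seq_cvgP u (l : R) : u @ \oo --> l <->
  forall e, 0 < e -> exists N, forall n, (N <= n)%N -> `|l - u n| <= e.
Proof.
split=> [/cvgrPdist_le ul e e0|ul].
  by have [N _ NP] := ul e e0; exists N => n /NP.
by apply/cvgrPdist_le => e /ul [N NP]; exists N.
Qed.

Lemma cvg_scale c u (l : R) : u @ \oo --> l -> (fun n => c * u n) @ \oo --> c * l.
Proof. exact: cvgMl_tmp. Qed.

(** The upper end is inclusive, so that averages divide by [n.+1] and never by 0. On generating
    functions this is multiplication by (1 - t)^-1. *)
Definition psum u n : R := \sum_(j < n.+1) u j.

Lemma psumS u n : psum u n.+1 = psum u n + u n.+1.
Proof. by rewrite /psum big_ord_recr. Qed.

Lemma psum0 u : psum u 0 = u 0%N.
Proof. by rewrite /psum big_ord1. Qed.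

Lemma ler_psum u v n : (forall j, (j <= n)%N -> u j <= v j) ->
  psum u n <= psum v n.
Proof. by move=> uv; apply: ler_sum => j _; apply: uv; rewrite -ltnS. Qed.

Lemma psum_nondecreasing u m n : (forall j, 0 <= u j) -> (m <= n)%N ->
  psum u m <= psum u n.
Proof.
move=> u0 /subnK <-; elim: (n - m)%N => // d IH.
by rewrite addSn psumS (le_trans IH)// lerDl.
Qed.

(* [bw k] is the coefficient sequence of (1 - t)^-(k+1); summing it gives [bw k.+1]. *)
Definition bw k n : R := 'C(n + k, k)%:R.

Lemma bw_gt0 k n : 0 < bw k n.
Proof. by rewrite ltr0n bin_gt0 leq_addl. Qed.

Lemma bw_ge0 k n : 0 <= bw k n.
Proof. exact/ltW/bw_gt0. Qed.

Lemma bw_neq0 k n : bw k n != 0.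
Proof. by rewrite gt_eqF ?bw_gt0. Qed.

Lemma bw0 n : bw 0 n = 1.
Proof. by rewrite /bw bin0. Qed.

Lemma bwS0 k : bw k 0 = 1.
Proof. by rewrite /bw add0n binn. Qed.

Lemma bwSS k n : bw k.+1 n.+1 = bw k.+1 n + bw k n.+1.
Proof. by rewrite /bw addSn binS addnS addSn -natrD addnC. Qed.

Lemma psum_bw k n : psum (bw k) n = bw k.+1 n.
Proof.
by elim: n => [|n IH]; rewrite ?psum0 ?bwS0// psumS IH bwSS.
Qed.

Lemma bw_ratioS k n : bw k n.+1 = bw k n * ((n.+1 + k)%:R / n.+1%:R).
Proof.
apply: (mulIf (_ : n.+1%:R != 0 :> R)); first by rewrite pnatr_eq0.
rewrite mulrA mulfVK ?pnatr_eq0// /bw -!natrM; congr (_%:R).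
have := mul_bin_down (n.+1 + k) k; rewrite addSn /= => H.
by rewrite mulnC [RHS]mulnC H -addSn addnK.
Qed.

Lemma bw_ratio k n : bw k.+1 n = bw k n * ((n.+1 + k)%:R / k.+1%:R).
Proof.
apply: (mulIf (_ : k.+1%:R != 0 :> R)); first by rewrite pnatr_eq0.
rewrite mulrA mulfVK ?pnatr_eq0// /bw -!natrM; congr (_%:R).
have := mul_bin_diag (n + k).+1 k; rewrite /= => H.
by rewrite addnS addSn mulnC -H mulnC.
Qed.

Lemma bw_ge1 k n : 1 <= bw k n.
Proof. by rewrite ler1n bin_gt0 leq_addl. Qed.

Lemma bw_nondecreasing k m n : (m <= n)%N -> bw k m <= bw k n.
Proof.
move=> /subnK <-; elim: (n - m)%N => // d IH; rewrite addSn (le_trans IH)//.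
by rewrite bw_ratioS ler_peMr ?bw_ge0// ler_pdivlMr ?ltr0n// mul1r ler_nat leq_addr.
Qed.

Lemma bwS_ge k n : n%:R <= bw k.+1 n.
Proof.
rewrite -psum_bw (le_trans _ (ler_psum (u := cst 1) (n := n) _))//; last by move=> j _; exact: bw_ge1.
by rewrite /psum sumr_const card_ord ler_nat.
Qed.

Lemma cvg_bwV k : (fun n => (bw k.+1 n)^-1) @ \oo --> (0 : R).
Proof.
apply/seq_cvgP => e e0; exists (Num.truncn e^-1).+1 => n nN.
rewrite sub0r normrN ger0_norm ?invr_ge0 ?bw_ge0//.
rewrite -[leRHS]invrK lef_pV2 ?posrE ?invr_gt0 ?bw_gt0//.
rewrite (le_trans _ (bwS_ge _ _))// (le_trans (ltW (truncnS_gt _)))//.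
by rewrite ler_nat.
Qed.

Lemma cvg_bw_ratio k : (fun n => bw k n / bw k.+1 n) @ \oo --> (0 : R).
Proof.
have -> : (fun n => bw k n / bw k.+1 n) = (fun n => k.+1%:R / (n.+1 + k)%:R :> R).
  by apply/funext => n; rewrite bw_ratio invfM mulrA divff ?bw_neq0// mul1r invf_div.
apply/seq_cvgP => e e0; exists (Num.truncn (k.+1%:R / e)).+1 => n nN.
rewrite sub0r normrN ger0_norm ?divr_ge0// ler_pdivrMr ?ltr0n// mulrC -ler_pdivrMr//.
rewrite (le_trans (ltW (truncnS_gt _)))// ler_nat (leq_trans nN)//.
by rewrite addSn -addnS leq_addr.
Qed.

Lemma cvg_bw_shift k : (fun n => bw k n / bw k n.+1) @ \oo --> (1 : R).
Proof.
case: k => [|k].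
  have -> : (fun n => bw 0 n / bw 0 n.+1) = cst 1.
    by apply/funext => n; rewrite !bw0 divr1.
  exact: cvg_cst.
have -> : (fun n => bw k.+1 n / bw k.+1 n.+1) = (fun n => 1 - bw k n.+1 / bw k.+1 n.+1).
  apply/funext => n; rewrite bwSS; field.
  by rewrite -bwSS bw_neq0.
rewrite -[X in _ --> X](subr0 (1 : R)); apply: cvgB; first exact: cvg_cst.
by have := cvg_bw_ratio k; rewrite -cvg_shiftS.
Qed.

Lemma cvg_bw_shiftn k m : (fun n => bw k (n - m) / bw k n) @ \oo --> (1 : R).
Proof.
have H : (fun n => bw k n / bw k (n + m)) @ \oo --> (1 : R).
  elim: m => [|m IH].
    have -> : (fun n => bw k n / bw k (n + 0)) = (fun=> 1).
      by apply/funext => n; rewrite addn0 divff ?bw_neq0.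
    exact: cvg_cst.
  have -> : (fun n => bw k n / bw k (n + m.+1)) =
      (fun n => (bw k n / bw k (n + m)) * (bw k (n + m) / bw k (n + m).+1)).
    by apply/funext => n; rewrite addnS mulrA mulfVK ?bw_neq0.
  rewrite -[X in _ --> X]mulr1; apply: cvgM; first exact: IH.
  by have := cvg_bw_shift k; rewrite -(cvg_shiftn m).
rewrite -(cvg_shiftn m); have -> // : [sequence bw k (n + m - m) / bw k (n + m)]_n =
  (fun n => bw k n / bw k (n + m)).
by apply/funext => n /=; rewrite addnK.
Qed.

Lemma psum_tail u v m n : (m <= n)%N ->
  (forall j, (m < j <= n)%N -> `|u j| <= v j) ->
  `|psum u n - psum u m| <= psum v n - psum v m.
Proof.
move=> /subnK <-; elim: (n - m)%N => [|d IH] uv; first by rewrite !subrr normr0.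
rewrite addSn !psumS [leLHS](_ : _ = `|(psum u (d + m) - psum u m) + u (d + m).+1|); last first.
  by congr `|_|; ring.
rewrite (le_trans (ler_normD _ _))// addrAC lerD//; last by apply: uv; rewrite ltnS leq_addl addSn/=.
apply: IH => j /andP[mj jd]; apply: uv; rewrite mj/= addSn.
exact: leq_trans jd (leqnSn _).
Qed.

Lemma psum_bounded_tail u C : (forall j, 0 <= u j) -> (forall n, psum u n <= C) ->
  forall e, 0 < e -> exists m, forall n, (m <= n)%N -> psum u n - psum u m <= e.
Proof.
move=> u0 uC e e0.
have : cvgn (psum u).
  apply: nondecreasing_is_cvgn; first by move=> m n mn; exact: psum_nondecreasing.
  by exists C => _ [n _ <-].
move=> /cvg_ex[l] /seq_cvgP /(_ _ (divr_gt0 e0 (ltr0n R 2)))[m mP].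
exists m => n mn; have := mP n mn; have := mP m (leqnn m).
by rewrite !ler_norml => /andP[h1 h2] /andP[h3 h4]; lra.
Qed.

Lemma psum_bounded_cvg u v C : (forall j, `|u j| <= v j) -> (forall n, psum v n <= C) ->
  cvgn (psum u).
Proof.
move=> uv vC.
have v0 j : 0 <= v j := le_trans (normr_ge0 _) (uv j).
have : cvgn (series u).
  apply: normed_cvg; apply: (@series_le_cvg _ _ v) => //; first by move=> n; exact: normr_ge0.
  apply: nondecreasing_is_cvgn.
    move=> m n mn; rewrite -subr_ge0 sub_series_geq//.
    by apply: sumr_ge0 => i _.
  exists C => _ [[|n] _ <-]; rewrite seriesEord/= ?big_ord0; last exact: vC.
  by rewrite (le_trans (v0 0%N))// -psum0.
move=> /cvg_ex[l ul]; apply/cvg_ex; exists l.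
have -> : psum u = [sequence series u n.+1]_n by apply/funext => n; rewrite /= seriesEord.
by rewrite cvg_shiftS.
Qed.

(** Beyond a fixed J both sums have tails at most that of the summable majorant [M], and the
    finitely many terms up to J converge one by one. The upper end of the sum may thus grow together
    with n. *)
Lemma tannery (t : nat -> nat -> R) (l M : nat -> R) C :
  (forall n, psum M n <= C) -> (forall n m, (m <= n)%N -> `|t n m| <= M m) ->
  (forall m, (fun n => t n m) @ \oo --> l m) ->
  cvgn (psum l) /\ (fun n => psum (t n) n) @ \oo --> limn (psum l).
Proof.
move=> MC tM tl.
have lM m : `|l m| <= M m.
  have /ler_cvg_to : (fun n => `|t n m|) @ \oo --> `|l m| by apply: cvg_norm; exact: tl.
  by apply; [exact: cvg_cst|exists m => // n; exact: tM].
have M0 j : 0 <= M j := le_trans (normr_ge0 _) (lM j).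
have cl : cvgn (psum l) by apply: psum_bounded_cvg lM MC.
split => //.
suff H : (fun n => psum (t n) n - psum l n) @ \oo --> (0 : R).
  have -> : (fun n => psum (t n) n) = (fun n => (psum (t n) n - psum l n) + psum l n).
    by apply/funext => n; rewrite subrK.
  by rewrite -[X in _ --> X]add0r; apply: cvgD.
apply/seq_cvgP => e e0.
have e3 : 0 < e / 3 by rewrite divr_gt0.
have [J JP] := psum_bounded_tail M0 MC e3.
have : (fun n => \sum_(m < J.+1) (t n m - l m)) @ \oo --> \sum_(m < J.+1) (0 : R).
  apply: cvg_big => [|i _]; first exact: add_continuous.
  by rewrite -(subrr (l i)); apply: cvgB; [exact: tl|exact: cvg_cst].
rewrite big1// => /seq_cvgP /(_ _ e3)[N NP].
exists (maxn J N) => n; rewrite geq_max => /andP[Jn Nn].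
have := NP n Nn; rewrite sumrB sub0r normrN => H1.
have H2 := psum_tail Jn (fun j (h : (J < j <= n)%N) => tM n j (proj2 (andP h))).
have H3 := psum_tail Jn (fun j (h : (J < j <= n)%N) => lM j).
have H4 := JP n Jn.
rewrite -[X in `|X - _|]/(psum (t n) J) -/(psum l J) in H1.
rewrite sub0r normrN.
have -> : psum (t n) n - psum l n = (psum (t n) J - psum l J) + (psum (t n) n - psum (t n) J)
  - (psum l n - psum l J) by ring.
rewrite (le_trans (ler_normB _ _))// (le_trans (lerD (ler_normD _ _) (lexx _)))//.
lra.
Qed.

(** Subtracting [c * bw k], whose partial sums are exactly [c * bw k.+1], reduces to limit 0. There
    the first J terms are killed by the divergence of [bw k.+1], and the others are at most e / 2
    times the weights. *)
Lemma cvg_psum_bw x k (c : R) : (fun n => x n / bw k n) @ \oo --> c ->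
  (fun n => psum x n / bw k.+1 n) @ \oo --> c.
Proof.
move=> xc.
pose z n := x n - c * bw k n.
have zc : (fun n => z n / bw k n) @ \oo --> (0 : R).
  have -> : (fun n => z n / bw k n) = (fun n => x n / bw k n - c).
    by apply/funext => n; rewrite /z mulrBl mulfK// bw_neq0.
  by rewrite -(subrr c); apply: cvgB => //; exact: cvg_cst.
suff H : (fun n => psum z n / bw k.+1 n) @ \oo --> (0 : R).
  have -> : (fun n => psum x n / bw k.+1 n) = (fun n => psum z n / bw k.+1 n + c).
    apply/funext => n; rewrite /psum sumrB -mulr_sumr -/(psum (bw k) n) psum_bw.
    by field; exact: bw_neq0.
  by rewrite -[X in _ --> X]add0r; apply: cvgD => //; exact: cvg_cst.
apply/seq_cvgP => e e0.
have e2 : 0 < e / 2 by rewrite divr_gt0.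
have /seq_cvgP /(_ _ e2)[J JP] := zc.
have : (fun n => `|psum z J| * (bw k.+1 n)^-1) @ \oo --> (0 : R).
  by rewrite -(mulr0 `|psum z J|); apply: cvg_scale; exact: cvg_bwV.
move=> /seq_cvgP /(_ _ e2)[N NP].
exists (maxn J N) => n; rewrite geq_max => /andP[Jn Nn].
have := NP n Nn; rewrite !sub0r !normrN normrM normr_id => H1.
rewrite normrM (ger0_norm (_ : 0 <= (bw k.+1 n)^-1)) ?invr_ge0 ?bw_ge0//.
rewrite (ger0_norm (_ : 0 <= (bw k.+1 n)^-1)) ?invr_ge0 ?bw_ge0// in H1.
have zb j : (J < j <= n)%N -> `|z j| <= e / 2 * bw k j.
  move=> /andP[Jj _]; have := JP j (ltnW Jj).
  by rewrite sub0r normrN normrM normfV (ger0_norm (bw_ge0 _ _)) ler_pdivrMr// bw_gt0.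
have := psum_tail Jn zb.
rewrite /psum -!mulr_sumr -!/(psum _ _) !psum_bw -mulrBr => H2.
rewrite ler_pdivrMr ?bw_gt0//; rewrite ler_pdivrMr ?bw_gt0// in H1.
have := bw_ge0 k.+1 J; set bJ := bw k.+1 J in H2 *; set bn := bw k.+1 n in H1 H2 *.
move=> bJ0.
have H3 : e / 2 * (bn - bJ) <= e / 2 * bn by rewrite ler_pM2l// gerBl.
have := ler_normD (psum z n - psum z J) (psum z J); rewrite subrK => H4.
lra.
Qed.

Lemma cvg_cesaro u (l : R) : u @ \oo --> l -> (fun n => psum u n / n.+1%:R) @ \oo --> l.
Proof.
move=> ul.
have -> : (fun n => psum u n / n.+1%:R) = (fun n => psum u n / bw 1 n).
  by apply/funext => n; rewrite bw_ratio bw0 mul1r divr1 addn0.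
apply: cvg_psum_bw.
by have -> : (fun n => u n / bw 0 n) = u by apply/funext => n; rewrite bw0 divr1.
Qed.

(* Summation by parts: since [bw k] is a polynomial weight, weighted Cesaro
   averages control the unweighted ones. *)
Lemma psum_unweight z k n : psum (fun j => z j / bw k j) n =
  psum z n / bw k.+1 n * ((n.+1 + k)%:R / k.+1%:R) +
  k%:R / k.+1%:R * (psum (fun j => psum z j / bw k.+1 j) n - psum z n / bw k.+1 n).
Proof.
elim: n => [|n IH].
  by rewrite !psum0 !bwS0 !divr1 subrr mulr0 addr0 add1n divff ?mulr1// pnatr_eq0.
have k1 : k.+1%:R != 0 :> R by rewrite pnatr_eq0.
have n1 : n.+1%:R != 0 :> R by rewrite pnatr_eq0.
have n2 : n.+2%:R != 0 :> R by rewrite pnatr_eq0.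
have nk : (n.+1 + k)%:R != 0 :> R by rewrite pnatr_eq0.
have nk2 : (n.+2 + k)%:R != 0 :> R by rewrite pnatr_eq0.
rewrite psumS IH (psumS (fun j => _ / _)) (psumS z).
rewrite (bw_ratio k n.+1) (bw_ratioS k n) (bw_ratio k n).
set Z := psum z n; set S := psum _ n; set b := bw k n.
have b0 : b != 0 by exact: bw_neq0.
move: k1 n1 n2 nk nk2; rewrite !natrD -!(natr1 n.+1) -!(natr1 n) -!(natr1 k).
by move=> *; field; do ?[apply/andP; split].
Qed.

(** With e the convergent quotient, [psum_unweight] divided by [n.+1] collapses to e_n / (k + 1)
    plus k / (k + 1) times the Cesaro mean of e; the two coefficients add up to 1. *)
Lemma cvg_unweight z k (g : R) : (fun n => psum z n / bw k.+1 n) @ \oo --> g ->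
  (fun n => psum (fun j => z j / bw k j) n / n.+1%:R) @ \oo --> g.
Proof.
move=> zg; set e := (fun n => psum z n / bw k.+1 n) in zg.
have -> : (fun n => psum (fun j => z j / bw k j) n / n.+1%:R) =
   (fun n => k.+1%:R^-1 * e n + k%:R / k.+1%:R * (psum e n / n.+1%:R)).
  apply/funext => n; rewrite psum_unweight -/(e n) -/e natrD.
  have n1 : n.+1%:R != 0 :> R by rewrite pnatr_eq0.
  have k1 : k.+1%:R != 0 :> R by rewrite pnatr_eq0.
  move: n1 k1; rewrite -(natr1 k); move: (n.+1%:R) => a a0 k1.
  by field; rewrite a0.
rewrite [X in _ --> X](_ : g = k.+1%:R^-1 * g + k%:R / k.+1%:R * g); last first.
  by have := pnatr_eq0 R k.+1; rewrite -(natr1 k) => /= k1; field; rewrite k1.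
by apply: cvgD; apply: cvg_scale => //; exact: cvg_cesaro.
Qed.

(** The bound is the full sum of the binomial series of (1 - q)^-(k+1). [H] is the finite form of
    multiplying that series by 1 - q, which lowers the degree by one. *)
Lemma geo_bw_summable q k : 0 <= q < 1 ->
  forall n, psum (fun j => q ^+ j * bw k j) n <= (1 - q)^-1 ^+ k.+1.
Proof.
move=> /andP[q0 q1]; have q1' : 0 < 1 - q by rewrite subr_gt0.
elim: k => [|k IH] n.
  have -> : psum (fun j => q ^+ j * bw 0 j) n = (1 - q ^+ n.+1) / (1 - q).
    elim: n => [|n IH]; first by rewrite psum0 bw0 mulr1 expr0 expr1 divff// gt_eqF.
    by rewrite psumS IH bw0 !exprS; field; rewrite gt_eqF.
  by rewrite expr1 ler_piMl ?invr_ge0 ?(ltW q1')// gerBl exprn_ge0.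
have H : psum (fun j => q ^+ j * bw k.+1 j) n * (1 - q) =
    psum (fun j => q ^+ j * bw k j) n - q ^+ n.+1 * bw k.+1 n.
  elim: n => [|n IHn]; first by rewrite !psum0 !bwS0; ring.
  by rewrite !psumS mulrDl IHn bwSS !exprS; ring.
rewrite exprSr ler_pdivlMr// H (le_trans _ (IH n))// gerBl.
by rewrite mulr_ge0 ?exprn_ge0 ?bw_ge0.
Qed.

Lemma cvg_geo_bw q k : 0 <= q < 1 -> (fun j => q ^+ j * bw k j) @ \oo --> (0 : R).
Proof.
move=> q01; have /andP[q0 _] := q01.
have H j : 0 <= q ^+ j * bw k j by rewrite mulr_ge0 ?exprn_ge0 ?bw_ge0.
set u := fun j => q ^+ j * bw k j.
have : cvgn (psum u).
  apply: psum_bounded_cvg (geo_bw_summable k q01) => j.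
  by rewrite ger0_norm ?H.
move=> /cvg_ex[/= l cl].
have cl' : (fun n => psum u n.+1) @ \oo --> l by rewrite (cvg_shiftS (psum u)).
have : (fun n => psum u n.+1 - psum u n) @ \oo --> l - l by exact: cvgB.
rewrite subrr.
have -> : (fun n => psum u n.+1 - psum u n) = [sequence u n.+1]_n.
  by apply/funext => n /=; rewrite psumS addrAC subrr add0r.
by rewrite cvg_shiftS.
Qed.

Lemma cvgn_bounded u (l : R) : u @ \oo --> l -> exists2 C, 0 < C & forall n, `|u n| <= C.
Proof.
move=> ul; have : bounded_fun u by apply: cvg_seq_bounded; apply/cvg_ex; exists l.
move=> [C [_ CP]].
exists (Num.max 1 (C + 1)) => [|n]; first by rewrite lt_max ltr01.
by apply: (CP (Num.max 1 (C + 1))) => //; rewrite lt_max ltrDl ltr01 orbT.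
Qed.

Lemma sum_residues u (q : nat) m :
  \sum_(n < q * m) u n = \sum_(r < q) \sum_(j < m) u (q * j + r)%N.
Proof.
elim: m => [|m IH].
  by rewrite muln0 big_ord0 big1// => r _; rewrite big_ord0.
rewrite mulnSr -(big_mkord xpredT u) (@big_cat_nat _ _ _ (q * m))//= ?leq_addr//.
rewrite big_mkord IH -{1}[(q * m)%N]add0n big_addn addKn big_mkord -big_split/=.
by apply: eq_bigr => r _; rewrite big_ord_recr/= addnC.
Qed.

Lemma cesaro_residues u (q : nat) : (0 < q)%N -> (forall n, `|u n| <= 1) ->
  (forall r, (r < q)%N ->
    cvgn (fun m => psum (fun j => u (q * j + r)%N) m / m.+1%:R)) ->
  cvgn (fun N => N%:R^-1 * \sum_(n < N) u n).
Proof.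
move=> q0 u1 ur.
have {}ur r : exists l, (r < q)%N ->
    (fun m => psum (fun j => u (q * j + r)%N) m / m.+1%:R) @ \oo --> (l : R).
  have [rq|rq] := ltnP r q; last by exists 0.
  by have /cvg_ex[l ul] := ur r rq; exists l.
have {ur} [l lP] := choice ur.
pose L := (\sum_(r < q) l r) / q%:R.
have qR : 0 < q%:R :> R by rewrite ltr0n.
have H : (fun m => \sum_(n < q * m.+1) u n / m.+1%:R) @ \oo --> \sum_(r < q) l r.
  have -> : (fun m => \sum_(n < q * m.+1) u n / m.+1%:R) =
     (fun m => \sum_(r < q) (psum (fun j => u (q * j + r)%N) m / m.+1%:R)).
    by apply/funext => m; rewrite -!mulr_suml sum_residues.
  apply: cvg_big => [|r _]; first exact: add_continuous.
  by apply: lP.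
apply/cvg_ex; exists L; rewrite -cvg_shiftS; apply/seq_cvgP => e e0 /=.
have /seq_cvgP /(_ _ (divr_gt0 (mulr_gt0 e0 qR) (ltr0n R 2)))[M MP] := H.
(* Pays for the incomplete last block of fewer than q terms: it adds at most q to the sum and shifts
   the comparison value L n by at most q |L|. Taking n beyond 2 K / e makes this at most half of the
   allowed error. *)
set K := q%:R * (1 + `|L|).
have K0 : 0 <= K by rewrite mulr_ge0// addr_ge0.
exists (maxn (q * M.+1) (Num.truncn (2 * K / e))) => n.
rewrite geq_max => /andP[nM nK].
rewrite -(ler_pM2r (ltr0Sn R n)) -[X in `|_| * X](@ger0_norm R n.+1%:R)// -normrM mulrBl [X in _ - X]mulrAC.
rewrite mulVf ?pnatr_eq0// mul1r.
set m := (n.+1 %/ q)%N; set s := (n.+1 %% q)%N.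
have En : n.+1 = (q * m + s)%N by rewrite {1}(divn_eq n.+1 q) mulnC.
have mM : (M.+1 <= m)%N by rewrite leq_divRL// mulnC (leq_trans nM).
case: m mM En => // m; rewrite ltnS => Mm En.
have := MP m Mm; rewrite -[X in _ -> X <= _]/(`|L * n.+1%:R - \sum_(i < n.+1) u i|) => H1.
have H2 : `|\sum_(n < q * m.+1) u n - L * (q * m.+1)%:R| <= e / 2 * (q * m.+1)%:R.
  have m1 : 0 < m.+1%:R :> R by [].
  rewrite -(ler_pM2r m1) -[X in `|_| * X](@ger0_norm R m.+1%:R)// -normrM mulrBl in H1.
  rewrite -mulr_suml mulfVK ?pnatr_eq0// distrC in H1.
  rewrite [L * _](_ : _ = (\sum_(r < q) l r) * m.+1%:R); last first.
    by rewrite /L natrM mulrA mulfVK// gt_eqF.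
  by rewrite (le_trans H1)// natrM le_eqVlt; apply/orP; left; apply/eqP; ring.
have H3 : `|\sum_(i < n.+1) u i - \sum_(n < q * m.+1) u n| <= q%:R.
  rewrite -!(big_mkord xpredT u) En (@big_cat_nat _ _ _ (q * m.+1) _ (q * m.+1 + s))//= ?leq_addr//.
  rewrite addrAC subrr add0r -{1}[(q * m.+1)%N]add0n big_addn addKn big_mkord.
  rewrite (le_trans (ler_norm_sum _ _ _))// (le_trans (ler_sum _ (fun i _ => u1 _)))//.
  by rewrite sumr_const card_ord ler_nat ltnW// ltn_mod.
have H4 : `|L * (q * m.+1)%:R - L * n.+1%:R| <= `|L| * q%:R.
  rewrite -mulrBr normrM ler_wpM2l// En natrD opprD addrA subrr add0r normrN ger0_norm//.
  by rewrite ler_nat ltnW// ltn_mod.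
have H5 : (q * m.+1)%:R <= n.+1%:R :> R by rewrite En ler_nat leq_addr.
have H6 : 2 * K <= e * n.+1%:R.
  rewrite [leRHS]mulrC -ler_pdivrMr// (le_trans (ltW (Num.Theory.truncnS_gt _)))//.
  by rewrite ler_nat.
rewrite distrC.
set A := \sum_(i < n.+1) u i in H3 *; set B := \sum_(n < q * m.+1) u n in H2 H3.
have := ler_normD (A - B) (B - L * n.+1%:R).
have := ler_normD (B - L * (q * m.+1)%:R) (L * (q * m.+1)%:R - L * n.+1%:R).
rewrite !addrA !subrK => H7 H8.
have H9 : e / 2 * (q * m.+1)%:R <= e / 2 * n.+1%:R by rewrite ler_pM2l// divr_gt0.
rewrite /K in H6 K0; lra.
Qed.

End RealSequences.

(** * Upper limits of bounded real sequences *)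

Section Limsup.
Context {R : realType}.
Implicit Types (u : nat -> R) (M e l : R).

Lemma bounded_has_ubound u M : (forall n, `|u n| <= M) -> has_ubound (range u).
Proof. by move=> uM; exists M => _ [n _ <-]; rewrite (le_trans (ler_norm _)). Qed.

Lemma bounded_has_lbound u M : (forall n, `|u n| <= M) -> has_lbound (range u).
Proof. by move=> uM; exists (- M) => _ [n _ <-]; rewrite lerNl (le_trans _ (uM n))// -normrN ler_norm. Qed.

Lemma sups_ge u M N n : (forall n, `|u n| <= M) -> (N <= n)%N -> u n <= sups u N.
Proof.
move=> uM Nn; apply: ub_le_sup; last by exists n.
exact/has_ubound_sdrop/(bounded_has_ubound uM).
Qed.

Lemma sups_le u l N : (forall n, (N <= n)%N -> u n <= l) -> sups u N <= l.
Proof.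
move=> ul; apply: ge_sup; first by exists (u N); exists N => /=.
by move=> _ [n /= Nn <-]; exact: ul.
Qed.

Lemma limn_supEinf u M : (forall n, `|u n| <= M) -> limn_sup u = inf (range (sups u)).
Proof.
move=> uM; apply: limn_supE.
by exists M; split; [exact: num_real|move=> x Mx n _; exact: le_trans (uM n) (ltW Mx)].
Qed.

Lemma sups_lbound u M : (forall n, `|u n| <= M) -> has_lbound (range (sups u)).
Proof.
move=> uM; exists (- M) => _ [n _ <-]; rewrite (le_trans _ (sups_ge uM (leqnn n)))//.
by rewrite lerNl (le_trans _ (uM n))// -normrN ler_norm.
Qed.

Lemma limn_sup_le_sups u M N : (forall n, `|u n| <= M) -> limn_sup u <= sups u N.
Proof.
move=> uM; rewrite (limn_supEinf uM); apply: ge_inf; last by exists N.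
exact: sups_lbound uM.
Qed.

Lemma limn_sup_le u M l N : (forall n, `|u n| <= M) ->
  (forall n, (N <= n)%N -> u n <= l) -> limn_sup u <= l.
Proof. by move=> uM ul; rewrite (le_trans (limn_sup_le_sups N uM))// sups_le. Qed.

Lemma limn_sup_freq u M e N : (forall n, `|u n| <= M) -> 0 < e ->
  exists2 n, (N <= n)%N & limn_sup u - e < u n.
Proof.
move=> uM e0; apply: contrapT => H.
have : limn_sup u <= limn_sup u - e.
  apply: (limn_sup_le (N := N) uM) => n Nn.
  by rewrite leNgt; apply/negP => un; apply: H; exists n.
by rewrite lerBrDr gerDl leNgt e0.
Qed.

Lemma limn_sup_eventually u M e : (forall n, `|u n| <= M) -> 0 < e ->
  exists N, forall n, (N <= n)%N -> u n <= limn_sup u + e.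
Proof.
move=> uM e0.
have hi : has_inf (range (sups u)) by split; [exists (sups u 0%N), 0%N|exact: sups_lbound uM].
have [_ [N _ <-]] := inf_adherent e0 hi; rewrite -(limn_supEinf uM) => H.
by exists N => n Nn; rewrite (le_trans (sups_ge uM Nn))// ltW.
Qed.

Lemma limn_sup_bound u M : (forall n, `|u n| <= M) -> `|limn_sup u| <= M.
Proof.
move=> uM; rewrite ler_norml; apply/andP; split; last first.
  by apply: (limn_sup_le (N := 0%N) uM) => n _; rewrite (le_trans (ler_norm _)).
rewrite (limn_supEinf uM); apply: lb_le_inf; first by exists (sups u 0%N), 0%N.
move=> _ [n _ <-]; rewrite (le_trans _ (sups_ge uM (leqnn n)))//.
by rewrite lerNl (le_trans _ (uM n))// -normrN ler_norm.
Qed.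

Lemma limn_sup_cvg u l : u @ \oo --> l -> limn_sup u = l.
Proof. by move=> ul; have [] := @cvg_limn_inf_sup _ u l ul. Qed.

(** The upper limit of - u is minus the lower limit of u, so the hypothesis says that the upper
    limit does not exceed the lower one. *)
Lemma cvg_limn_supN u M : (forall n, `|u n| <= M) ->
  limn_sup u + limn_sup (fun n => - u n) <= 0 -> u @ \oo --> limn_sup u.
Proof.
move=> uM H; have nuM n : `|- u n| <= M by rewrite normrN.
apply/seq_cvgP => e e0.
have [N NP] := limn_sup_eventually uM e0.
have [N' NP'] := limn_sup_eventually nuM e0.
exists (maxn N N') => n; rewrite geq_max => /andP[/NP h1 /NP' h2].
by rewrite ler_norml; lra.
Qed.

End Limsup.

(** * Bounded measurable functions and their means *)

Section BoundedMeasurable.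
Context {d : measure_display} {X : measurableType d} {R : realType}.
Implicit Types (f g h : X -> R) (c : R).

(** Boundedness holds everywhere, not just almost everywhere: [sups] and [limn_sup] of uniformly
    bounded families are then meaningful real numbers at every point, and measurable. *)
Definition bmeas f := measurable_fun [set: X] f /\ exists M : R, forall x, `|f x| <= M.

Lemma bmeas_cst c : bmeas (fun=> c).
Proof. by split; [exact: measurable_cst|exists `|c|]. Qed.

Lemma bmeasD f g : bmeas f -> bmeas g -> bmeas (fun x => f x + g x).
Proof.
move=> [mf [M fM]] [mg [N gN]]; split; first exact: measurable_funD.
by exists (M + N) => x; rewrite (le_trans (ler_normD _ _))// lerD.
Qed.

Lemma bmeasZ c f : bmeas f -> bmeas (fun x => c * f x).
Proof.
move=> [mf [M fM]]; split; first by apply: measurable_funM => //; exact: measurable_cst.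
by exists (`|c| * M) => x; rewrite normrM ler_wpM2l.
Qed.

Lemma bmeas_sum (I : Type) (s : seq I) (F : I -> X -> R) :
  (forall i, bmeas (F i)) -> bmeas (fun x => \sum_(i <- s) F i x).
Proof.
move=> bF; elim: s => [|i s IH].
  by under eq_fun do rewrite big_nil; exact: bmeas_cst.
by under eq_fun do rewrite big_cons; exact: bmeasD.
Qed.

Lemma bmeas_max f g : bmeas f -> bmeas g -> bmeas (fun x => Num.max (f x) (g x)).
Proof.
move=> [mf [M fM]] [mg [N gN]]; split; first exact: measurable_maxr.
exists (Num.max M N) => x; rewrite le_max; have [fg|gf] := leP (f x) (g x).
  by rewrite gN orbT.
by rewrite fM.
Qed.

Lemma bmeas_limn_sup (F : nat -> X -> R) M : (forall n, measurable_fun setT (F n)) ->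
  (forall n x, `|F n x| <= M) -> bmeas (fun x => limn_sup (F ^~ x)).
Proof.
move=> mF FM; split; last first.
  by exists M => x; apply: limn_sup_bound.
apply: measurable_fun_limn_sup => // x _.
  by apply: bounded_has_ubound => n; exact: FM.
by apply: bounded_has_lbound => n; exact: FM.
Qed.

Lemma bmeas_sups (F : nat -> X -> R) M N : (forall n, measurable_fun setT (F n)) ->
  (forall n x, `|F n x| <= M) -> bmeas (fun x => sups (F ^~ x) N).
Proof.
move=> mF FM; split; last first.
  exists M => x; rewrite ler_norml; apply/andP; split.
    rewrite (le_trans _ (sups_ge (fun n => FM n x) (leqnn N)))//.
    by rewrite lerNl (le_trans _ (FM N x))// -normrN ler_norm.
  by apply: sups_le => n _; rewrite (le_trans (ler_norm _)).
apply: measurable_fun_sups => // x _.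
by apply: bounded_has_ubound => n; exact: FM.
Qed.

End BoundedMeasurable.

Section Integral.
Context {d : measure_display} {X : measurableType d} {R : realType}.
Variable nu : probability X R.
Implicit Types (f g h : X -> R) (c : R).

Lemma bmeas_integrable f : bmeas f -> nu.-integrable setT (EFin \o f).
Proof.
move=> [mf [M fM]]; apply: measurable_bounded_integrable => //.
  by rewrite -ge0_fin_numE// fin_num_measure.
by exists M; split; [exact: num_real|move=> x Mx y _; exact: le_trans (fM y) (ltW Mx)].
Qed.

Definition mean f : R := \int[nu]_x f x.

Lemma mean_cst c : mean (fun=> c) = c.
Proof.
rewrite /mean Rintegral_cst//; have H : (nu : {measure set X -> \bar R}) setT = 1%E := probability_setT nu.
by rewrite H mulr1.
Qed.

Lemma meanD f g : bmeas f -> bmeas g -> mean (fun x => f x + g x) = mean f + mean g.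
Proof. by move=> /bmeas_integrable bf /bmeas_integrable bg; exact: RintegralD. Qed.

Lemma meanZ c f : bmeas f -> mean (fun x => c * f x) = c * mean f.
Proof. by move=> /bmeas_integrable bf; exact: RintegralZl. Qed.

Lemma mean_le f g : bmeas f -> bmeas g -> (forall x, f x <= g x) -> mean f <= mean g.
Proof. by move=> /bmeas_integrable bf /bmeas_integrable bg fg; exact: le_Rintegral. Qed.

Lemma mean_sum (I : Type) (s : seq I) (F : I -> X -> R) : (forall i, bmeas (F i)) ->
  mean (fun x => \sum_(i <- s) F i x) = \sum_(i <- s) mean (F i).
Proof.
move=> bF; elim: s => [|i s IH].
  by under eq_fun do rewrite big_nil; rewrite mean_cst big_nil.
under eq_fun do rewrite big_cons.
by rewrite meanD ?IH ?big_cons//; exact: bmeas_sum.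
Qed.

Lemma mean_eq0 f : bmeas f -> (forall x, 0 <= f x) -> mean f = 0 ->
  {ae nu, forall x, f x = 0}.
Proof.
move=> bf f0 mf.
have /integrableP[mfE _] := bmeas_integrable bf.
have fin : (\int[nu]_x (f x)%:E)%E \is a fin_num.
  by apply: (integrable_fin_num measurableT); exact: bmeas_integrable.
have : (\int[nu]_x `|(EFin \o f) x|)%E = 0%E.
  have -> : (fun x => `|(EFin \o f) x|%E) = (fun x => (f x)%:E).
    by apply/funext => x /=; rewrite ger0_norm.
  by rewrite -(fineK fin); congr EFin.
move/(ae_eq_integral_abs nu measurableT mfE) => H.
by apply: filterS H => x /(_ I) [].
Qed.

Lemma mean_ge0_le0 f : bmeas f -> (forall x, 0 <= f x) -> mean f <= 0 ->
  {ae nu, forall x, f x = 0}.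
Proof.
move=> bf f0 mf; apply: mean_eq0 => //; apply/eqP; rewrite eq_le mf/=.
by rewrite -[leLHS](mean_cst 0); apply: mean_le => //; exact: bmeas_cst.
Qed.

Lemma mean_dominated (F : nat -> X -> R) f M : (forall n, measurable_fun setT (F n)) ->
  (forall n x, `|F n x| <= M) -> bmeas f ->
  {ae nu, forall x, (F ^~ x) @ \oo --> f x} -> (fun n => mean (F n)) @ \oo --> mean f.
Proof.
move=> mF FM bf cF.
have bF n : bmeas (F n) by split => //; exists M.
have := @dominated_convergence _ _ _ nu setT measurableT (fun n => EFin \o F n) (EFin \o f) (cst M%:E).
case.
- by move=> n; apply/measurable_EFinP.
- by apply/measurable_EFinP; case: bf.
- by apply: filterS cF => x cFx _; apply: cvg_EFin => //; exact: nearW.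
- exact: (bmeas_integrable (bmeas_cst M)).
- by apply: nearW => x n _; rewrite lee_fin.
- move=> _ _ H; apply: fine_cvg; rewrite fineK; first exact: H.
  by apply: integrable_fin_num => //; exact: bmeas_integrable.
Qed.

Lemma mean_comp T f : measure_preserving nu T -> bmeas f -> mean (f \o T) = mean f.
Proof.
move=> [mT pT] bf; rewrite /mean /Rintegral; congr fine.
have bfT : bmeas (f \o T).
  case: bf => mf [M fM]; split; [exact: measurableT_comp|by exists M => x; apply: fM].
rewrite -[LHS](@integral_pushforward _ _ _ _ _ T mT nu setT (EFin \o f))//; last first.
- exact: bmeas_integrable.
- by apply/measurable_EFinP; case: bf.
apply: eq_measure_integral => A mA _; exact: pT.
Qed.

End Integral.

(** * Positive operators and the pointwise ergodic theorem *)

Section PositiveOperators.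
Context {d : measure_display} {X : measurableType d} {R : realType}.
Variable nu : probability X R.
Implicit Types (f g : X -> R) (a b c : R) (K L : (X -> R) -> X -> R).

(* [kop a K]: K is a finite positive combination of compositions with
   measure-preserving maps, of total weight a. *)
Inductive kop : R -> ((X -> R) -> X -> R) -> Prop :=
| kop_zero : kop 0 (fun _ _ => 0)
| kop_map T : measure_preserving nu T -> kop 1 (fun f x => f (T x))
| kop_add a b K L : kop a K -> kop b L -> kop (a + b) (fun f x => K f x + L f x)
| kop_scale c a K : 0 <= c -> kop a K -> kop (c * a) (fun f x => c * K f x)
| kop_comp a b K L : kop a K -> kop b L -> kop (a * b) (fun f => K (L f)).

Lemma kop_id : kop 1 id.
Proof. by apply: (@kop_map id); split. Qed.

Lemma kop_sum (I : Type) (s : seq I) (a : I -> R) (K : I -> (X -> R) -> X -> R) :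
  (forall i, kop (a i) (K i)) ->
  kop (\sum_(i <- s) a i) (fun f x => \sum_(i <- s) K i f x).
Proof.
move=> kK; elim: s => [|i s IH].
  have -> : (fun f x => \sum_(i <- [::]) K i f x) = (fun _ _ => 0).
    by apply/funext => f; apply/funext => x; rewrite big_nil.
  by rewrite big_nil; exact: kop_zero.
have -> : (fun f x => \sum_(j <- i :: s) K j f x) =
    (fun f x => K i f x + \sum_(j <- s) K j f x).
  by apply/funext => f; apply/funext => x; rewrite big_cons.
by rewrite big_cons; exact: kop_add.
Qed.

Lemma kop_ge0 a K : kop a K -> 0 <= a.
Proof. by elim=> //= *; rewrite ?addr_ge0 ?mulr_ge0. Qed.

Lemma kop_lin a K : kop a K -> forall (b c : R) f g,
  K (fun x => b * f x + c * g x) = (fun x => b * K f x + c * K g x).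
Proof.
elim=> [|T _|{}a a' {}K L _ IK _ IL|a' {}a {}K _ _ IK|{}a a' {}K L _ IK _ IL] b c f g.
- by apply/funext => x; rewrite !mulr0 addr0.
- by [].
- by rewrite IK IL; apply/funext => x; ring.
- by rewrite IK; apply/funext => x; ring.
- by rewrite IL IK.
Qed.

Lemma kopD a K : kop a K -> forall f g,
  K (fun x => f x + g x) = (fun x => K f x + K g x).
Proof.
move=> kK f g; have := kop_lin kK 1 1 f g.
under eq_fun do rewrite !mul1r.
by under [RHS]eq_fun do rewrite !mul1r.
Qed.

Lemma kopB a K : kop a K -> forall f g,
  K (fun x => f x - g x) = (fun x => K f x - K g x).
Proof.
move=> kK f g; have := kop_lin kK 1 (-1) f g.
under eq_fun do rewrite mul1r mulN1r.
by under [RHS]eq_fun do rewrite mul1r mulN1r.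
Qed.

Lemma kopZ a K : kop a K -> forall (c : R) f,
  K (fun x => c * f x) = (fun x => c * K f x).
Proof.
move=> kK c f; have := kop_lin kK c 0 f f.
under eq_fun do rewrite mul0r addr0.
by under [RHS]eq_fun do rewrite mul0r addr0.
Qed.

(** The total weight is read off from constants. This is how scalar path counts come out of operator
    identities. *)
Lemma kop_cst a K : kop a K -> forall c x, K (fun=> c) x = a * c.
Proof.
elim=> [|T _|{}a a' {}K L _ IK _ IL|a' {}a {}K _ _ IK|{}a a' {}K L _ IK _ IL] c x.
- by rewrite mul0r.
- by rewrite mul1r.
- by rewrite IK IL mulrDl.
- by rewrite IK mulrA.
- by rewrite (_ : L (fun=> c) = fun=> a' * c) ?IK ?mulrA//; apply/funext.
Qed.

Lemma kop_cst0 a K : kop a K -> K (fun=> 0) = (fun=> 0).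
Proof. by move=> kK; apply/funext => x; rewrite (kop_cst kK) mulr0. Qed.

Lemma kop_sumr a K (I : Type) (s : seq I) (F : I -> X -> R) : kop a K ->
  K (fun x => \sum_(i <- s) F i x) = (fun x => \sum_(i <- s) K (F i) x).
Proof.
move=> kK; elim: s => [|i s IH].
  under eq_fun do rewrite big_nil.
  by under [RHS]eq_fun do rewrite big_nil; rewrite (kop_cst0 kK).
under eq_fun do rewrite big_cons.
by rewrite (kopD kK) IH; apply/funext => x; rewrite big_cons.
Qed.

Lemma kop_le a K : kop a K -> forall f g, (forall x, f x <= g x) ->
  forall x, K f x <= K g x.
Proof.
elim=> [|T _|{}a a' {}K L _ IK _ IL|a' {}a {}K a0 _ IK|{}a a' {}K L _ IK _ IL] f g fg x //.
- by rewrite lerD ?IK ?IL.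
- by rewrite ler_wpM2l// IK.
- by apply: IK => y; exact: IL.
Qed.

Lemma kop_pos a K : kop a K -> forall f, (forall x, 0 <= f x) -> forall x, 0 <= K f x.
Proof. by move=> kK f f0 x; rewrite -(mulr0 a) -(kop_cst kK 0 x); exact: (kop_le kK). Qed.

Lemma kop_bound a K : kop a K -> forall f M, (forall x, `|f x| <= M) ->
  forall x, `|K f x| <= a * M.
Proof.
move=> kK f M fM x; rewrite ler_norml -mulrN -!(kop_cst kK _ x).
by apply/andP; split; apply: (kop_le kK) => y; have := fM y; rewrite ler_norml => /andP[].
Qed.

Lemma kop_norm a K : kop a K -> forall f x, `|K f x| <= K (fun y => `|f y|) x.
Proof.
move=> kK f x; rewrite ler_norml; apply/andP; split; last first.
  by apply: (kop_le kK) => y; exact: ler_norm.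
have -> : - K (fun y => `|f y|) x = K (fun y => -1 * `|f y|) x.
  by rewrite (kopZ kK) mulN1r.
by apply: (kop_le kK) => y; rewrite mulN1r lerNl -normrN ler_norm.
Qed.

Lemma kop_meas a K : kop a K -> forall f, measurable_fun setT f -> measurable_fun setT (K f).
Proof.
elim=> [|T [mT _]|{}a a' {}K L _ IK _ IL|a' {}a {}K a0 _ IK|{}a a' {}K L _ IK _ IL] f mf.
- exact: measurable_cst.
- exact: (measurableT_comp mf mT).
- by apply: measurable_funD; [exact: IK|exact: IL].
- by apply: measurable_funM; [exact: measurable_cst|exact: IK].
- exact/IK/IL.
Qed.

Lemma kop_bmeas a K : kop a K -> forall f, bmeas f -> bmeas (K f).
Proof.
move=> kK f [mf [M fM]]; split; first exact: (kop_meas kK).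
by exists (a * M); exact: (kop_bound kK).
Qed.

Lemma kop_mean a K : kop a K -> forall f, bmeas f -> mean nu (K f) = a * mean nu f.
Proof.
elim=> [|T mT|{}a a' {}K L kK IK kL IL|a' {}a {}K a0 kK IK|{}a a' {}K L kK IK kL IL] f bf.
- by rewrite mean_cst mul0r.
- by rewrite mul1r; exact: mean_comp.
- rewrite meanD; [|exact: (kop_bmeas kK)|exact: (kop_bmeas kL)].
  by rewrite IK// IL// mulrDl.
- by rewrite meanZ ?IK ?mulrA//; exact: (kop_bmeas kK).
- by rewrite IK ?IL ?mulrA//; exact: (kop_bmeas kL).
Qed.

Lemma kop_cvg a K : kop a K -> forall (F : nat -> X -> R) f,
  (forall x, (F ^~ x) @ \oo --> f x) -> forall x, (fun n => K (F n) x) @ \oo --> K f x.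
Proof.
elim=> [|T _|{}a a' {}K L _ IK _ IL|a' {}a {}K _ _ IK|{}a a' {}K L _ IK _ IL] F f Ff x.
- exact: cvg_cst.
- exact: Ff.
- by apply: cvgD; [exact: IK|exact: IL].
- by apply: cvg_scale; exact: IK.
- by apply: (IK (fun n => L (F n))) => y; exact: IL.
Qed.

Lemma ae_comp T (Q : X -> Prop) : measure_preserving nu T ->
  {ae nu, forall x, Q x} -> {ae nu, forall x, Q (T x)}.
Proof.
move=> [mT pT] [A [mA A0 QA]]; exists (T @^-1` A); split.
- by rewrite -[X in measurable X]setTI; exact: mT.
- by rewrite pT.
- by move=> x /= nQ; exact: QA.
Qed.

(** The exceptional set is only pulled back along measure-preserving maps ([ae_comp]) or united with
    another one, so it stays null. *)
Lemma kop_ae_cvg a K : kop a K -> forall (F : nat -> X -> R) f,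
  {ae nu, forall x, (F ^~ x) @ \oo --> f x} ->
  {ae nu, forall x, (fun n => K (F n) x) @ \oo --> K f x}.
Proof.
elim=> [|T mT|{}a a' {}K L _ IK _ IL|a' {}a {}K _ _ IK|{}a a' {}K L _ IK _ IL] F f Ff.
- by apply: aeW => x; exact: cvg_cst.
- exact: (ae_comp mT Ff).
- by apply: filterS2 (IK _ _ Ff) (IL _ _ Ff) => x; exact: cvgD.
- by apply: filterS (IK _ _ Ff) => x; exact: cvg_scale.
- exact/(IK (fun n => L (F n)))/IL.
Qed.

End PositiveOperators.

(** * The pointwise ergodic theorem for a Markov operator on W times X *)

Section ErgodicTheorem.
Context {d : measure_display} {X : measurableType d} {R : realType}.
Variable nu : probability X R.
Variables (W : finType) (p : W -> W -> R) (P : W -> W -> (X -> R) -> X -> R) (w0 : W -> R).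
Hypothesis kP : forall v w, kop nu (p v w) (P v w).
Hypothesis p1 : forall v, \sum_w p v w = 1.
Hypothesis w0_gt0 : forall v, 0 < w0 v.
Hypothesis w0p : forall w, \sum_v w0 v * p v w = w0 w.
Implicit Types (F G : W -> X -> R) (M e : R).

(** The Markov operator of a chain on W times X. By [w0p] and [kop_mean] it preserves the product of
    [w0] and [nu]; [mmean] is integration against this finite measure, whose total mass is the sum
    of [w0]. *)
Definition mstep F : W -> X -> R := fun v x => \sum_w P v w (F w) x.

Definition mmean F : R := \sum_v w0 v * mean nu (F v).

Lemma mstep_lin (b c : R) F G : mstep (fun v x => b * F v x + c * G v x) =
  (fun v x => b * mstep F v x + c * mstep G v x).
Proof.
apply/funext => v; apply/funext => x; rewrite /mstep !mulr_sumr -big_split/=.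
by apply: eq_bigr => w _; rewrite (kop_lin (kP v w)).
Qed.

Lemma iter_mstep_lin n (b c : R) F G :
  iter n mstep (fun v x => b * F v x + c * G v x) =
  (fun v x => b * iter n mstep F v x + c * iter n mstep G v x).
Proof. by elim: n => //= n ->; rewrite mstep_lin. Qed.

Lemma mstep_cst c : mstep (fun _ _ => c) = (fun _ _ => c).
Proof.
apply/funext => v; apply/funext => x; rewrite /mstep.
under eq_bigr do rewrite (kop_cst (kP _ _)).
by rewrite -mulr_suml p1 mul1r.
Qed.

Lemma iter_mstep_cst n c : iter n mstep (fun _ _ => c) = (fun _ _ => c).
Proof. by elim: n => //= n ->; rewrite mstep_cst. Qed.

Lemma mstep_le F G : (forall v x, F v x <= G v x) -> forall v x, mstep F v x <= mstep G v x.
Proof. by move=> FG v x; apply: ler_sum => w _; apply: (kop_le (kP v w)). Qed.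

Lemma iter_mstep_le n F G : (forall v x, F v x <= G v x) ->
  forall v x, iter n mstep F v x <= iter n mstep G v x.
Proof. by move=> FG; elim: n => //= n IH; exact: mstep_le. Qed.

Lemma iter_mstep_bound n F M : (forall v x, `|F v x| <= M) ->
  forall v x, `|iter n mstep F v x| <= M.
Proof.
move=> FM v x; rewrite ler_norml.
have HM : forall v x, - M <= F v x <= M by move=> v' x'; rewrite -ler_norml.
have /iter_mstep_le H1 : forall v x, (fun _ _ => - M) v x <= F v x.
  by move=> v' x'; have /andP[] := HM v' x'.
have /iter_mstep_le H2 : forall v x, F v x <= (fun _ _ => M) v x.
  by move=> v' x'; have /andP[] := HM v' x'.
by have := H1 n v x; have := H2 n v x; rewrite !iter_mstep_cst => -> ->.
Qed.

Lemma mstep_bmeas F : (forall v, bmeas (F v)) -> forall v, bmeas (mstep F v).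
Proof. by move=> bF v; apply: bmeas_sum => w; exact: (kop_bmeas (kP v w)). Qed.

Lemma iter_mstep_bmeas n F : (forall v, bmeas (F v)) -> forall v, bmeas (iter n mstep F v).
Proof. by move=> bF; elim: n => //= n IH; exact: mstep_bmeas. Qed.

Lemma mmean_mstep F : (forall v, bmeas (F v)) -> mmean (mstep F) = mmean F.
Proof.
move=> bF; rewrite /mmean.
under eq_bigr => v _.
  rewrite /mstep mean_sum; last by move=> w; exact: (kop_bmeas (kP v w)).
  under eq_bigr do rewrite (kop_mean (kP _ _))//.
  rewrite mulr_sumr.
  over.
rewrite exchange_big/=; apply: eq_bigr => w _.
by under eq_bigr do rewrite mulrA; rewrite -mulr_suml w0p.
Qed.

Lemma mmean_iter n F : (forall v, bmeas (F v)) -> mmean (iter n mstep F) = mmean F.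
Proof. by move=> bF; elim: n => //= n IH; rewrite mmean_mstep//; exact: iter_mstep_bmeas. Qed.

Lemma mmean_lin (b c : R) F G : (forall v, bmeas (F v)) -> (forall v, bmeas (G v)) ->
  mmean (fun v x => b * F v x + c * G v x) = b * mmean F + c * mmean G.
Proof.
move=> bF bG; rewrite /mmean !mulr_sumr -big_split/=; apply: eq_bigr => v _.
rewrite meanD; [|exact: bmeasZ|exact: bmeasZ]; rewrite !meanZ//; ring.
Qed.

Lemma mmean_le F G : (forall v, bmeas (F v)) -> (forall v, bmeas (G v)) ->
  (forall v x, F v x <= G v x) -> mmean F <= mmean G.
Proof.
move=> bF bG FG; apply: ler_sum => v _; rewrite ler_wpM2l ?(ltW (w0_gt0 v))//.
exact: mean_le.
Qed.

Lemma mmean_le0 F : (forall v, bmeas (F v)) -> (forall v x, 0 <= F v x) -> mmean F <= 0 ->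
  {ae nu, forall x, forall v, F v x = 0}.
Proof.
move=> bF F0 mF.
have mF0 v : 0 <= mean nu (F v).
  by rewrite -[leLHS](mean_cst nu 0); apply: mean_le => //; exact: bmeas_cst.
apply: filter_forall => v.
apply: mean_ge0_le0 => //.
rewrite -(pmulr_rle0 _ (w0_gt0 v)) (le_trans _ mF)// /mmean (bigD1 v)//= lerDl.
by apply: sumr_ge0 => w _; rewrite mulr_ge0// ltW.
Qed.

(** The value of optimal stopping within n steps. For a single transformation it is the maximum of 0
    and the first n partial sums; since the maximum is taken inside the operator at each step, for a
    Markov operator it dominates them and still satisfies the recursion on which Garsia's argument
    rests. *)
Fixpoint maxsum (g : W -> X -> R) n : W -> X -> R :=
  if n is m.+1 then fun v x => Num.max 0 (g v x + mstep (maxsum g m) v x)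
  else fun _ _ => 0.

Lemma maxsum_ge0 g n v x : 0 <= maxsum g n v x.
Proof. by case: n => //= n; rewrite le_max lexx. Qed.

Lemma maxsum_bmeas g n : (forall v, bmeas (g v)) -> forall v, bmeas (maxsum g n v).
Proof.
move=> bg; elim: n => [|n IH] v /=; first exact: bmeas_cst.
by apply: bmeas_max; [exact: bmeas_cst|apply: bmeasD => //; exact: mstep_bmeas].
Qed.

Lemma maxsum_leS g n : forall v x, maxsum g n v x <= maxsum g n.+1 v x.
Proof.
elim: n => [|n IH] v x; first exact: maxsum_ge0.
rewrite -[leLHS]/(Num.max 0 (g v x + mstep (maxsum g n) v x)).
rewrite -[leRHS]/(Num.max 0 (g v x + mstep (maxsum g n.+1) v x)).
by rewrite ge_max !le_max lexx/= lerD2l mstep_le ?orbT.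
Qed.

Lemma maxsum_le m n g v x : (m <= n)%N -> maxsum g m v x <= maxsum g n v x.
Proof.
by move=> /subnK <-; elim: (n - m)%N => // k IH; rewrite (le_trans IH)// maxsum_leS.
Qed.

Lemma psum_iter_mstep g n v x : psum (fun j => iter j mstep g v x) n.+1 =
  g v x + mstep (fun w y => psum (fun j => iter j mstep g w y) n) v x.
Proof.
rewrite /psum big_ord_recl/=; congr (_ + _).
rewrite /mstep; under [RHS]eq_bigr do rewrite (kop_sumr _ _ (kP _ _)).
by rewrite exchange_big.
Qed.

Lemma psum_le_maxsum g n : forall v x,
  psum (fun j => iter j mstep g v x) n <= maxsum g n.+1 v x.
Proof.
elim: n => [|n IH] v x.
  rewrite psum0 /= le_max; apply/orP; right.
  by rewrite mstep_cst addr0.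
rewrite psum_iter_mstep [leRHS]/= le_max; apply/orP; right.
by rewrite lerD2l; exact: mstep_le.
Qed.

(* Hopf's maximal ergodic lemma, by Garsia's argument. *)
Lemma maximal_ergodic g : (forall v, bmeas (g v)) ->
  {ae nu, forall x, forall v, exists n, 0 < maxsum g n v x} -> 0 <= mmean g.
Proof.
move=> bg gpos.
pose D n v := maxsum g n v @^-1` `]0, +oo[%classic.
have DE n v x : \1_(D n v) x = (0 < maxsum g n v x)%R%:R :> R.
  rewrite indicE; congr (nat_of_bool _)%:R; apply/idP/idP; rewrite inE /D /= in_itv/= andbT//.
have mD n v : measurable (D n v).
  have [mm _] := maxsum_bmeas n bg v.
  by rewrite -[D n v]setTI; apply: mm => //; exact: measurable_itv.
pose gD n v x := g v x * \1_(D n v) x.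
have bgD n v : bmeas (gD n v).
  have [mg [M gM]] := bg v; split.
    by apply: measurable_funM => //; exact: measurable_indic.
  exists M => x; rewrite /gD DE normrM; case: ltP => _.
    by rewrite normr1 mulr1.
  by rewrite normr0 mulr0 (le_trans _ (gM x)).
(* Where [maxsum g n.+1] is positive, g equals it minus [mstep (maxsum g n)]; elsewhere that
   difference is at most 0. So the mean of the cut-off g is at least the mean of the difference,
   which is nonnegative by invariance of [mmean] and monotonicity in n. *)
have mgD n : 0 <= mmean (gD n.+1).
  have bm n' := maxsum_bmeas n' bg.
  have : 0 <= mmean (maxsum g n.+1) - mmean (maxsum g n).
    by rewrite subr_ge0 mmean_le// => v x; exact: maxsum_leS.
  rewrite -(mmean_mstep (bm n)) -[X in 0 <= X - _]mul1r -mulN1r -mmean_lin//; last exact: mstep_bmeas.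
  move=> /le_trans; apply; apply: mmean_le => //.
    move=> v; apply: bmeasD; apply: bmeasZ => //; exact: mstep_bmeas.
  move=> v x; rewrite mul1r mulN1r /gD DE.
  have m0 : 0 <= mstep (maxsum g n) v x.
    have -> : 0 = mstep (fun _ _ => 0) v x by rewrite mstep_cst.
    by apply: mstep_le => *; exact: maxsum_ge0.
  rewrite /=; case: (ltP 0 (g v x + mstep (maxsum g n) v x)) => h.
    by rewrite h mulr1 addrK.
  by rewrite ltxx mulr0 sub0r oppr_le0.
(* The sets [D n v] increase with n to a set of full measure, by [gpos]; dominated convergence
   removes the cut-off. *)
have cgD v : (fun n => mean nu (gD n.+1 v)) @ \oo --> mean nu (g v).
  have [mg [M gM]] := bg v.
  apply: (@mean_dominated _ _ _ nu (fun n => gD n.+1 v) (g v) M) => //.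
  - by move=> n; have [] := bgD n.+1 v.
  - move=> n x; rewrite /gD DE normrM; case: ltP => _.
      by rewrite normr1 mulr1.
    by rewrite normr0 mulr0 (le_trans _ (gM x)).
  apply: filterS gpos => x /(_ v)[N N0]; apply/seq_cvgP => e e0; exists N => n Nn.
  have -> : gD n.+1 v x = g v x.
    by rewrite /gD DE (lt_le_trans N0) ?mulr1// maxsum_le// leqW.
  by rewrite subrr normr0 ltW.
have : (fun n => mmean (gD n.+1)) @ \oo --> mmean g.
  apply: cvg_big => [|v _]; first exact: add_continuous.
  exact: cvg_scale.
by move=> /(ler_cvg_to (cvg_cst 0)); apply; exact: nearW.
Qed.

Definition mavg F n : W -> X -> R :=
  fun v x => psum (fun j => iter j mstep F v x) n / n.+1%:R.

Lemma psum_norm_le (u : nat -> R) M n : (forall j, `|u j| <= M) ->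
  `|psum u n / n.+1%:R| <= M.
Proof.
move=> uM; rewrite normrM normfV (ger0_norm (_ : 0 <= n.+1%:R))// ler_pdivrMr//.
rewrite (le_trans (ler_norm_sum _ _ _))//.
have /le_trans : \sum_(i < n.+1) `|u i| <= \sum_(i < n.+1) M by apply: ler_sum.
by apply; rewrite sumr_const card_ord mulr_natr.
Qed.

Lemma bmeas_finW F : (forall v, bmeas (F v)) -> exists2 M : R, 0 <= M & forall v x, `|F v x| <= M.
Proof.
move=> bF; have /choice[M MP] : forall v, exists M : R, 0 <= M /\ forall x, `|F v x| <= M.
  move=> v; have [_ [M FM]] := bF v; exists `|M|; split => // x.
  by rewrite (le_trans (FM x))// ler_norm.
exists (\sum_v M v); first by apply: sumr_ge0 => v _; have [] := MP v.
move=> v x; have [_ /(_ x)/le_trans] := MP v; apply.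
by rewrite (bigD1 v)//= lerDl sumr_ge0// => w _; have [] := MP w.
Qed.

Lemma mstep_mavg F n v x : mstep (mavg F n) v x =
  mavg F n v x + (iter n.+1 mstep F v x - F v x) / n.+1%:R.
Proof.
have -> : mavg F n = (fun v x => n.+1%:R^-1 * psum (fun j => iter j mstep F v x) n + 0 * F v x).
  by apply/funext => w; apply/funext => y; rewrite /mavg mul0r addr0 mulrC.
rewrite mstep_lin !mul0r !addr0 mulrC [in RHS](mulrC _^-1) -mulrDl; congr (_ * _).
apply: (addrI (F v x)); rewrite -psum_iter_mstep psumS; ring.
Qed.

Section Limsup.
Variable F : W -> X -> R.
Hypothesis bF : forall v, bmeas (F v).

Let Fs v x := limn_sup (fun n => mavg F n v x).

Lemma mavg_bound M : (forall v x, `|F v x| <= M) -> forall n v x, `|mavg F n v x| <= M.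
Proof. by move=> FM n v x; apply: psum_norm_le => j; exact: iter_mstep_bound. Qed.

Lemma mavg_meas n v : measurable_fun setT (mavg F n v).
Proof.
apply: measurable_funM; last exact: measurable_cst.
rewrite /psum; apply: (@bmeas_sum _ _ _ _ _ (fun (j : 'I_n.+1) x => iter j mstep F v x) _).1 => j.
exact: iter_mstep_bmeas.
Qed.

Lemma limsup_mavg_bmeas v : bmeas (Fs v).
Proof.
have [M M0 FM] := bmeas_finW bF.
apply: (@bmeas_limn_sup _ _ _ (fun n => mavg F n v) M) => [n|n x].
  exact: mavg_meas.
exact: mavg_bound.
Qed.

(** [mstep] changes an average only by a telescoped boundary term of order 1 / n. The averages are
    bounded by the tail suprema [H N], and as N grows [kop_cvg] carries the limit through the
    operator. *)
Lemma limsup_mavg_le_mstep v x : Fs v x <= mstep Fs v x.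
Proof.
have [M M0 FM] := bmeas_finW bF.
have AM v' x' n := mavg_bound FM n v' x'.
pose H N : W -> X -> R := fun v x => sups (fun n => mavg F n v x) N.
have cH : (fun N => mstep (H N) v x) @ \oo --> mstep Fs v x.
  apply: cvg_big => [|w _]; first exact: add_continuous.
  apply: (kop_cvg (kP v w) (F := fun N => H N w)) => y.
  rewrite /Fs (limn_supEinf (AM w y)).
  apply: cvg_sups_inf; [exact: bounded_has_ubound (AM w y)|exact: bounded_has_lbound (AM w y)].
suff h N : Fs v x <= mstep (H N) v x.
  by apply: (ler_cvg_to (cvg_cst (Fs v x)) cH); exact: nearW.
apply/ler_addgt0Pr => e e0.
apply: (limn_sup_le (N := maxn N (Num.truncn (2 * M / e)).+1) (AM v x)) => n.
rewrite geq_max => /andP[Nn Mn].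
have : mstep (mavg F n) v x <= mstep (H N) v x.
  by apply: mstep_le => w y; exact: (sups_ge (AM w y)).
rewrite mstep_mavg => h1.
have h2 : `|(iter n.+1 mstep F v x - F v x) / n.+1%:R| <= e.
  rewrite normrM normfV (ger0_norm (_ : 0 <= n.+1%:R))// ler_pdivrMr//.
  rewrite (le_trans (ler_normB _ _))// (le_trans (lerD (iter_mstep_bound n.+1 FM v x) (FM v x)))//.
  have : 2 * M / e <= n.+1%:R.
    by rewrite (le_trans (ltW (Num.Theory.truncnS_gt _)))// ler_nat ltnW.
  by rewrite ler_pdivrMr// => h; lra.
move: h2; rewrite ler_norml => /andP[h2 h3].
rewrite -lerBlDr (le_trans _ h1)// lerD2l //.
Qed.

(** The defect [mstep Fs - Fs] is nonnegative of mean 0, hence vanishes a.e., and so do all its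
    iterates. One null set serves every n because the maximal lemma will sum over iterates of
    [Fs]. *)
Lemma limsup_mavg_invariant : {ae nu, forall x, forall n v, iter n mstep Fs v x = Fs v x}.
Proof.
have bFs := limsup_mavg_bmeas.
pose D v x := 1 * mstep Fs v x + (-1) * Fs v x.
have bD v : bmeas (D v) by apply: bmeasD; apply: bmeasZ => //; exact: mstep_bmeas.
have D0 v x : 0 <= D v x.
  by rewrite /D mul1r mulN1r subr_ge0; exact: limsup_mavg_le_mstep.
have JD : mmean D = 0.
  by rewrite mmean_lin ?mmean_mstep//; [rewrite mul1r mulN1r subrr|exact: mstep_bmeas].
have H : {ae nu, forall x, forall n v, iter n mstep D v x = 0}.
  apply: ae_foralln => n; apply: mmean_le0.
  - exact: iter_mstep_bmeas.
  - move=> v x; have -> : 0 = iter n mstep (fun _ _ => 0) v x by rewrite iter_mstep_cst.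
    exact: iter_mstep_le.
  - by rewrite mmean_iter// JD.
apply: filterS H => x Dx; elim=> // n IH v.
have := Dx n v; rewrite iter_mstep_lin -iterSr IH mul1r mulN1r => /eqP.
by rewrite subr_eq0 => /eqP.
Qed.

(** The maximal lemma is applied to F - Fs + e'. As Fs is invariant, the partial sums of this
    function are n + 1 times (average of F) - Fs + e', and by definition of the upper limit one of
    them is positive at almost every point. *)
Lemma mmean_limsup_mavg : mmean Fs <= mmean F.
Proof.
have bFs := limsup_mavg_bmeas.
have [M M0 FM] := bmeas_finW bF.
have w1 : 0 < \sum_v w0 v + 1.
  by rewrite ltr_wpDl// sumr_ge0// => v _; exact/ltW.
apply/ler_addgt0Pr => e e0.
(* Chosen so that e' times the total mass is at most e; the added 1 keeps the denominator
   positive. *)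
pose e' := e / (\sum_v w0 v + 1).
have e'0 : 0 < e' by rewrite divr_gt0.
pose g0 v x := 1 * F v x + (-1) * Fs v x.
pose g v x := 1 * g0 v x + e' * 1.
have bg0 v : bmeas (g0 v) by apply: bmeasD; exact: bmeasZ.
have bg v : bmeas (g v) by apply: bmeasD; apply: bmeasZ => //; exact: bmeas_cst.
have : 0 <= mmean g.
  apply: maximal_ergodic => //.
  apply: filterS limsup_mavg_invariant => x inv v.
  have [n _ nP] := limn_sup_freq (e := e') 0 (mavg_bound FM ^~ v ^~ x) e'0.
  exists n.+1; apply: lt_le_trans (psum_le_maxsum _ _ _ _).
  have -> : psum (fun j => iter j mstep g v x) n =
     psum (fun j => iter j mstep F v x) n - n.+1%:R * Fs v x + n.+1%:R * e'.
    transitivity (psum (fun j => iter j mstep F v x + (e' - Fs v x)) n).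
      apply: eq_bigr => j _.
      by rewrite iter_mstep_lin iter_mstep_lin iter_mstep_cst inv; ring.
    by rewrite /psum big_split/= sumr_const card_ord -mulr_natl; ring.
  have : Fs v x - e' < psum (fun j => iter j mstep F v x) n / n.+1%:R by exact: nP.
  by rewrite ltr_pdivlMr// => h; lra.
rewrite mmean_lin//; last by move=> v; exact: bmeas_cst.
rewrite mmean_lin// => h.
have h1 : mmean (fun _ _ => 1) = \sum_v w0 v.
  by apply: eq_bigr => v _; rewrite mean_cst mulr1.
have h2 : e' * \sum_v w0 v <= e.
  by rewrite /e' mulrAC ler_pdivrMr// ler_wpM2l// ?lerDl// ltW.
by rewrite h1 in h; lra.
Qed.

End Limsup.

(** The upper limits belonging to F and to - F add up to a nonnegative function whose mean is at
    most [mmean F + mmean G], which is 0. It vanishes a.e., so upper and lower limits agree. *)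
Theorem pointwise_ergodic F : (forall v, bmeas (F v)) ->
  {ae nu, forall x, forall v,
    (fun n => mavg F n v x) @ \oo --> limn_sup (fun n => mavg F n v x)}.
Proof.
move=> bF; have [M M0 FM] := bmeas_finW bF.
pose G v x := (-1) * F v x + 0 * F v x.
have bG v : bmeas (G v) by apply: bmeasD; exact: bmeasZ.
have avgG n v x : mavg G n v x = - mavg F n v x.
  rewrite /mavg -mulNr; congr (_ / _); rewrite /psum -sumrN; apply: eq_bigr => j _.
  by rewrite iter_mstep_lin mul0r addr0 mulN1r.
pose Fs v x := limn_sup (fun n => mavg F n v x).
pose Gs v x := limn_sup (fun n => mavg G n v x).
have bFs : forall v, bmeas (Fs v) by exact: limsup_mavg_bmeas.
have bGs : forall v, bmeas (Gs v) by exact: limsup_mavg_bmeas.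
pose S v x := 1 * Fs v x + 1 * Gs v x.
have AM v x n := mavg_bound FM n v x.
have GsE v x : Gs v x = limn_sup (fun n => - mavg F n v x).
  by congr limn_sup; apply/funext => n; exact: avgG.
have S0 v x : 0 <= S v x.
  rewrite /S !mul1r GsE; apply/ler_addgt0Pr => e e0.
  have e2 : 0 < e / 2 by rewrite divr_gt0.
  have [N NP] := limn_sup_eventually (AM v x) e2.
  have AN n : `|- mavg F n v x| <= M by rewrite normrN.
  have [N' NP'] := limn_sup_eventually AN e2.
  have := NP (maxn N N') (leq_maxl _ _); have := NP' (maxn N N') (leq_maxr _ _).
  by rewrite /Fs; lra.
have GF : mmean F + mmean G = 0.
  by rewrite /G (mmean_lin (-1) 0 bF bF) mul0r addr0 mulN1r subrr.
have mul1D (a b : R) : 1 * a + 1 * b = a + b by rewrite !mul1r.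
have : mmean S <= 0.
  rewrite -GF [leLHS](_ : _ = mmean Fs + mmean Gs).
    exact: (lerD (mmean_limsup_mavg bF) (mmean_limsup_mavg bG)).
  exact: (etrans (mmean_lin 1 1 bFs bGs) (mul1D _ _)).
move=> /(mmean_le0 (fun v => bmeasD (bmeasZ 1 (bFs v)) (bmeasZ 1 (bGs v))) S0).
apply: filterS => x Sx v; apply: (cvg_limn_supN (AM v x)).
by have := Sx v; rewrite /S !mul1r GsE => ->.
Qed.

End ErgodicTheorem.

(** * Maker's theorem for convolutions *)

Section Convolution.
Context {R : realType}.
Implicit Types (u : nat -> R) (c e : R).

Lemma psum_rev u n : psum (fun m => u (n - m)%N) n = psum u n.
Proof.
rewrite /psum [RHS](reindex_inj rev_ord_inj)/=.
by apply: eq_bigr => i _; rewrite subSS.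
Qed.

(** The (k+1)-fold iterated partial sum of u, in closed form. *)
Definition bwconv k u n : R := psum (fun m => bw k (n - m) * u m) n.

Lemma psum_bwconv k u n : psum (bwconv k u) n = bwconv k.+1 u n.
Proof.
elim: n => [|n IH]; first by rewrite psum0 /bwconv !psum0 !bwS0.
rewrite psumS IH /bwconv !psumS subnn !bwS0 addrA; congr (_ + _).
rewrite /psum -big_split/=; apply: eq_bigr => i _.
by rewrite subSn ?bwSS ?mulrDl// -ltnS.
Qed.

Lemma cvg_bwconv k u (l : R) : (fun n => psum u n / n.+1%:R) @ \oo --> l ->
  (fun n => bwconv k u n / bw k.+1 n) @ \oo --> l.
Proof.
move=> ul; elim: k => [|k IH].
  have -> : (fun n => bwconv 0 u n / bw 1 n) = (fun n => psum u n / n.+1%:R) => //.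
  apply/funext => n; rewrite bw_ratio bw0 mul1r divr1 addn0 /bwconv; congr (_ / _).
  by apply: eq_bigr => i _; rewrite bw0 mul1r.
have -> : bwconv k.+1 u = psum (bwconv k u) by apply/funext => n; rewrite psum_bwconv.
exact: cvg_psum_bw.
Qed.

(** Counts the indices m with n - m below J, where the tail bound [h J] of Maker's argument says
    nothing. *)
Lemma psum_indic (J n : nat) : psum (fun m => (n - m < J)%N%:R) n <= J%:R :> R.
Proof.
rewrite (psum_rev (fun j => (j < J)%N%:R)); elim: n => [|n IH].
  by rewrite psum0; case: J => // J; rewrite ler1n.
rewrite psumS; case: (ltnP n.+1 J) => nJ; last by rewrite addr0.
have -> : psum (fun j => (j < J)%N%:R) n = n.+1%:R :> R.
  transitivity (psum (fun=> 1 : R) n).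
    by apply: eq_bigr => i _; rewrite (leq_trans (ltn_ord i))// ltnW.
  by rewrite /psum sumr_const card_ord.
by rewrite natr1 ler_nat.
Qed.

End Convolution.

(** * Limits of convolutions with a sequence of positive operators *)

Section OperatorConvolution.
Context {d : measure_display} {X : measurableType d} {R : realType}.
Variable nu : probability X R.
Variables (D : nat -> (X -> R) -> X -> R) (dm : nat -> R) (delta : R).
Hypothesis kD : forall n, kop nu (dm n) (D n).
Hypothesis dm_cvg : dm @ \oo --> delta.
Hypothesis D_ergodic : forall f, bmeas f ->
  {ae nu, forall x, cvgn (fun n => psum (fun m => D m f x) n / n.+1%:R)}.

Definition davg f n : X -> R := fun x => psum (fun m => D m f x) n / n.+1%:R.

(** An everywhere defined, measurable version of the limit that [D_ergodic] provides only outside a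
    null set. *)
Definition dlim f : X -> R := fun x => limn_sup (fun n => davg f n x).

Lemma dm_ge0 n : 0 <= dm n.
Proof. exact: kop_ge0 (kD n). Qed.

Lemma davg_bound (C : R) : (forall n, `|dm n| <= C) -> forall f M, (forall x, `|f x| <= M) ->
  forall n x, `|davg f n x| <= C * M.
Proof.
move=> dC f M fM n x; rewrite /davg; apply: psum_norm_le => j.
rewrite (le_trans (kop_bound (kD j) fM x))// ler_wpM2r//; last by rewrite (le_trans (ler_norm _)).
exact: le_trans (normr_ge0 _) (fM x).
Qed.

Lemma davg_bmeas f n : bmeas f -> bmeas (davg f n).
Proof.
move=> bf; have -> : davg f n = (fun x => n.+1%:R^-1 * psum (fun m => D m f x) n).
  by apply/funext => x; rewrite mulrC.
apply: bmeasZ; apply: (@bmeas_sum _ _ _ _ _ (fun (j : 'I_n.+1) => D j f)) => j.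
exact: kop_bmeas.
Qed.

Lemma dlim_bmeas f : bmeas f -> bmeas (dlim f).
Proof.
move=> bf; have [C C0 dC] := cvgn_bounded dm_cvg; have [mf [M fM]] := bf.
apply: (@bmeas_limn_sup _ _ _ _ (C * M)) => [n|n x]; first by case: (davg_bmeas n bf).
exact: davg_bound.
Qed.

Lemma dlim_cvg f : bmeas f -> {ae nu, forall x, (fun n => davg f n x) @ \oo --> dlim f x}.
Proof.
move=> bf; apply: filterS (D_ergodic bf) => x /cvg_ex[l cl].
by rewrite /dlim (limn_sup_cvg cl).
Qed.

Lemma mean_dlim f : bmeas f -> mean nu (dlim f) = delta * mean nu f.
Proof.
move=> bf; have [C C0 dC] := cvgn_bounded dm_cvg; have [mf [M fM]] := bf.
have /cvg_lim <- // : (fun n => mean nu (davg f n)) @ \oo --> mean nu (dlim f).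
  apply: (@mean_dominated _ _ _ _ _ _ (C * M)).
  - by move=> n; case: (davg_bmeas n bf).
  - exact: davg_bound.
  - exact: dlim_bmeas.
  - exact: dlim_cvg.
apply/cvg_lim => //.
have -> : (fun n => mean nu (davg f n)) = (fun n => mean nu f * (psum dm n / n.+1%:R)).
  apply/funext => n.
  have -> : davg f n = (fun x => n.+1%:R^-1 * psum (fun m => D m f x) n).
    by apply/funext => x; rewrite mulrC.
  rewrite meanZ; last first.
    apply: (@bmeas_sum _ _ _ _ _ (fun (j : 'I_n.+1) => D j f)) => j; exact: kop_bmeas.
  rewrite (@mean_sum _ _ _ _ _ _ (fun (j : 'I_n.+1) => D j f)); last first.
    by move=> j; exact: kop_bmeas.
  rewrite [X in _ * X](_ : _ = psum dm n * mean nu f); first by ring.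
  by rewrite /psum mulr_suml; apply: eq_bigr => j _; exact: kop_mean.
by rewrite mulrC; apply: cvg_scale; exact: cvg_cesaro.
Qed.

Lemma dlim_le f g : bmeas f -> bmeas g -> (forall x, f x <= g x) ->
  forall x, dlim f x <= dlim g x.
Proof.
move=> [_ [M fM]] [_ [N gN]] fg x; have [C C0 dC] := cvgn_bounded dm_cvg.
apply/ler_addgt0Pr => e e0.
have [K KP] := limn_sup_eventually (fun n => davg_bound dC gN n x) e0.
apply: (limn_sup_le (N := K) (fun n => davg_bound dC fM n x)) => n Kn.
rewrite (le_trans _ (KP n Kn))// /davg ler_wpM2r ?invr_ge0//.
by apply: ler_psum => j _; exact: (kop_le (kD j)).
Qed.

(* Maker's trick: the a.e. limit of [y n / bw k n] may be taken inside the
   ergodic averages, the error being dominated by averages of the decreasing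
   tails [h J], whose limits have mean tending to 0. *)
Lemma operator_convolution k (y : nat -> X -> R) (K : R) (g : X -> R) :
  (forall n, measurable_fun setT (y n)) -> (forall n x, `|y n x| <= K * bw k n) ->
  bmeas g -> {ae nu, forall x, (fun n => y n x / bw k n) @ \oo --> g x} ->
  {ae nu, forall x, (fun n => psum (fun m => D m (y (n - m)%N) x) n / bw k.+1 n) @ \oo
     --> dlim g x}.
Proof.
move=> my yK bg yg; have [C C0 dC] := cvgn_bounded dm_cvg.
have [mg [G gG]] := bg.
pose eps n x : R := `|y n x / bw k n - g x|.
have meps n : measurable_fun setT (eps n).
  apply: measurableT_comp => //; apply: measurable_funB => //.
  by apply: measurable_funM => //; exact: measurable_cst.
have epsB n x : `|eps n x| <= K + G.
  rewrite normr_id (le_trans (ler_normB _ _))// lerD// normrM normfV.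
  by rewrite (ger0_norm (bw_ge0 _ _)) ler_pdivrMr ?bw_gt0.
pose h J x := sups (eps ^~ x) J.
have bh J : bmeas (h J) by apply: (@bmeas_sups _ _ _ eps (K + G)).
have hge J j x : (J <= j)%N -> eps j x <= h J x.
  by move=> Jj; apply: (sups_ge (u := eps ^~ x)) Jj => n; exact: epsB.
have h0 J x : 0 <= h J x by rewrite (le_trans _ (hge J J x (leqnn _)))// normr_ge0.
have hB J x : `|h J x| <= K + G.
  rewrite ger0_norm//; apply: sups_le => n _.
  by rewrite (le_trans (ler_norm _)).
have ch : (fun J => mean nu (h J)) @ \oo --> (0 : R).
  rewrite -(mean_cst nu 0); apply: (@mean_dominated _ _ _ _ _ _ (K + G)) => //.
  - by move=> n; case: (bh n).
  - exact: bmeas_cst.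
  apply: filterS yg => x /seq_cvgP yx; apply/seq_cvgP => e e0.
  have [N NP] := yx e e0; exists N => n Nn.
  rewrite sub0r normrN ger0_norm//; apply: sups_le => m nm.
  by rewrite /eps distrC; apply: NP; exact: leq_trans nm.
have hle J J' x : (J <= J')%N -> h J' x <= h J x.
  by move=> JJ; apply: sups_le => n Jn; apply: hge; exact: leq_trans Jn.
pose L x := limn_sup (fun J => dlim (h J) x).
have dhB J x : `|dlim (h J) x| <= C * (K + G).
  by apply: limn_sup_bound => n; apply: davg_bound => //; exact: hB.
have bL : bmeas L.
  apply: (@bmeas_limn_sup _ _ _ _ (C * (K + G))) => // n.
  by case: (dlim_bmeas (bh n)).
have dh0 J x : 0 <= dlim (h J) x.
  rewrite (_ : 0 = dlim (fun=> 0) x); first by apply: dlim_le => //; exact: bmeas_cst.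
  apply/esym; apply: limn_sup_cvg.
  have -> : (fun n => davg (fun=> 0) n x) = fun=> 0; last exact: cvg_cst.
  apply/funext => n; rewrite /davg /psum big1 ?mul0r// => j _.
  by rewrite (kop_cst (kD j)) mulr0.
have L0 x : 0 <= L x.
  apply/ler_addgt0Pr => e e0.
  have [N NP] := limn_sup_eventually (dhB ^~ x) e0.
  exact: le_trans (dh0 N x) (NP N (leqnn _)).
(* With J fixed, the limit in n gives [dlim (h J)]. These decrease in J, so the mean of L is at most
   delta times the mean of [h J], which tends to 0 by [ch]. *)
have {}L0 : {ae nu, forall x, L x = 0}.
  apply: mean_ge0_le0 => //.
  have : (fun J => delta * mean nu (h J)) @ \oo --> delta * 0 by exact: cvg_scale.
  rewrite mulr0 => /(ler_cvg_to (cvg_cst (mean nu L))); apply.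
  apply: nearW => J; rewrite -mean_dlim//.
  apply: mean_le => //; first exact: dlim_bmeas.
  move=> x; rewrite (le_trans (limn_sup_le_sups J (dhB ^~ x)))//.
  by apply: sups_le => n Jn; apply: dlim_le => // z; exact: hle.
have Hh : {ae nu, forall x, forall J, (fun n => davg (h J) n x) @ \oo --> dlim (h J) x}.
  by apply: ae_foralln => J; exact: dlim_cvg.
apply: filterS3 (dlim_cvg bg) Hh L0 => x gx hx Lx.
have main : (fun n => bwconv k (fun m => D m g x) n / bw k.+1 n) @ \oo --> dlim g x.
  exact: cvg_bwconv.
suff err : (fun n => psum (fun m => D m (y (n - m)%N) x) n / bw k.+1 n -
     bwconv k (fun m => D m g x) n / bw k.+1 n) @ \oo --> (0 : R).
  have := cvgD err main; rewrite add0r => H.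
  have -> : (fun n => psum (fun m => D m (y (n - m)%N) x) n / bw k.+1 n) =
     (fun n => psum (fun m => D m (y (n - m)%N) x) n / bw k.+1 n -
     bwconv k (fun m => D m g x) n / bw k.+1 n + bwconv k (fun m => D m g x) n / bw k.+1 n).
    by apply/funext => n; rewrite subrK.
  exact: H.
(* The factor [k.+1] comes from bw k n / bw k.+1 n <= (k + 1) / (n + 1). The second summand pays for
   the at most J indices with n - m < J, each costing at most C (K + G). *)
have errb J n : `|psum (fun m => D m (y (n - m)%N) x) n / bw k.+1 n -
     bwconv k (fun m => D m g x) n / bw k.+1 n| <=
     k.+1%:R * (davg (h J) n x + J%:R * (C * (K + G)) / n.+1%:R).
  have KG : 0 <= K + G := le_trans (normr_ge0 _) (epsB 0%N x).
  have S1 : `|psum (fun m => D m (y (n - m)%N) x) n - bwconv k (fun m => D m g x) n| <=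
      bw k n * (psum (fun m => D m (h J) x) n + J%:R * (C * (K + G))).
    rewrite /bwconv /psum -sumrB (le_trans (ler_norm_sum _ _ _))//.
    have /le_trans : \sum_(i < n.+1) `|D i (y (n - i)%N) x - bw k (n - i) * D i g x| <=
      \sum_(i < n.+1) bw k n * (D i (h J) x + (n - i < J)%N%:R * (C * (K + G))).
      apply: ler_sum => i _; have ki := kD i.
      have -> : bw k (n - i) * D i g x = D i (fun z => bw k (n - i) * g z) x.
        by rewrite (kopZ ki).
      have -> : D i (y (n - i)%N) x - D i (fun z => bw k (n - i) * g z) x =
          D i (fun z => bw k (n - i) * (y (n - i)%N z / bw k (n - i) - g z)) x.
        transitivity (D i (fun z => y (n - i)%N z - bw k (n - i) * g z) x).
          by rewrite (kopB ki).
        congr (D i _ x); apply/funext => z; rewrite mulrBr; congr (_ - _).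
        by rewrite mulrCA divff ?mulr1 ?bw_neq0.
      rewrite (kopZ ki) normrM (ger0_norm (bw_ge0 _ _)).
      apply: ler_pM => //.
        by apply: bw_nondecreasing; exact: leq_subr.
      have b2 : `|D i (fun z => y (n - i)%N z / bw k (n - i) - g z) x| <= D i (eps (n - i)%N) x.
        exact: (kop_norm ki).
      rewrite (le_trans b2)//; case: ltnP => nJ /=.
        rewrite mul1r -[leLHS]add0r lerD//; first by apply: (kop_pos ki) => z.
        rewrite (le_trans (ler_norm _))// (le_trans (kop_bound ki (epsB _) x))//.
        by rewrite ler_wpM2r// (le_trans (ler_norm _)).
      by rewrite mul0r addr0; apply: (kop_le ki) => z; exact: hge.
    apply; rewrite -mulr_sumr ler_wpM2l ?bw_ge0// big_split/= lerD2l -mulr_suml.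
    by rewrite ler_wpM2r// ?psum_indic// mulr_ge0// ltW.
  rewrite -mulrBl normrM normfV (ger0_norm (bw_ge0 k.+1 n)) ler_pdivrMr ?bw_gt0//.
  rewrite (le_trans S1)// /davg -mulrDl.
  set S := psum _ n + _.
  have S0 : 0 <= S.
    rewrite addr_ge0// ?mulr_ge0 ?(ltW C0)// sumr_ge0// => j _.
    by apply: (kop_pos (kD j)).
  rewrite bw_ratio.
  have -> : k.+1%:R * (S / n.+1%:R) * (bw k n * ((n.+1 + k)%:R / k.+1%:R)) =
    bw k n * (S * ((n.+1 + k)%:R / n.+1%:R)).
    have k1 : k.+1%:R != 0 :> R by rewrite pnatr_eq0.
    have n1 : n.+1%:R != 0 :> R by rewrite pnatr_eq0.
    move: k1 n1; move: (k.+1%:R) (n.+1%:R) ((n.+1 + k)%:R) => a b c a0 b0.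
    by field; rewrite a0 b0.
  rewrite ler_wpM2l ?bw_ge0// ler_peMr// ler_pdivlMr ?ltr0n// mul1r ler_nat.
  exact: leq_addr.
apply/seq_cvgP => e e0.
have k10 : 0 < k.+1%:R :> R by [].
pose e' := e / k.+1%:R / 2.
have e'0 : 0 < e' by rewrite !divr_gt0.
have [J JP] := limn_sup_eventually (dhB ^~ x) e'0.
have {JP} := JP J (leqnn _); rewrite -/(L x) Lx add0r => dJ.
have : (fun n => davg (h J) n x + J%:R * (C * (K + G)) / n.+1%:R) @ \oo --> dlim (h J) x + 0.
  apply: cvgD; first exact: hx.
  rewrite -(mulr0 (J%:R * (C * (K + G)))); apply: cvg_scale; exact: cvg_harmonic.
rewrite addr0 => /seq_cvgP /(_ _ e'0)[N NP].
exists N => n Nn; rewrite sub0r normrN (le_trans (errb J n))//.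
have := NP n Nn; rewrite ler_norml => /andP[n1 n2].
rewrite mulrC -ler_pdivlMr//; have -> : e / k.+1%:R = e' + e' by rewrite /e'; field.
by move: n1; rewrite lerNl opprB lerBlDr => /le_trans; apply; rewrite lerD2l.
Qed.

(* A geometric weight needs no maximal inequality: dominated convergence suffices. *)
Lemma operator_convolution_lt k (y : nat -> X -> R) (K q : R) (g : X -> R) : 0 <= q < 1 ->
  (forall n x, `|y n x| <= K * bw k n) ->
  {ae nu, forall x, (fun n => y n x / bw k n) @ \oo --> g x} ->
  {ae nu, forall x, (fun n => psum (fun m => q ^+ m * D m (y (n - m)%N) x) n / bw k n) @ \oo
     --> limn (psum (fun m => q ^+ m * D m g x))}.
Proof.
move=> /andP[q0 q1] yK yg; have [C C0 dC] := cvgn_bounded dm_cvg.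
have H : {ae nu, forall x, forall m, (fun n => D m (fun z => y n z / bw k n) x) @ \oo --> D m g x}.
  by apply: ae_foralln => m; apply: (kop_ae_cvg (kD m) yg).
apply: filterS H => x Hx.
have K0 : 0 <= K.
  by have := le_trans (normr_ge0 _) (yK 0%N x); rewrite bwS0 mulr1.
(* The majorant is C K q^m, because bw k (n - m) <= bw k n; the factor [bw 0 m] is 1 and gives it
   the shape of [geo_bw_summable]. *)
have := @tannery R (fun n m => q ^+ m * D m (y (n - m)%N) x / bw k n)
  (fun m => q ^+ m * D m g x) (fun m => (C * K) * (q ^+ m * bw 0 m)) ((C * K) * (1 - q)^-1 ^+ 1).
case.
- move=> n; rewrite /psum -mulr_sumr ler_wpM2l ?mulr_ge0 ?(ltW C0)//.
  by apply: geo_bw_summable; rewrite q0.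
- move=> n m mn; rewrite !normrM normfV (ger0_norm (bw_ge0 _ _)) ler_pdivrMr ?bw_gt0//.
  rewrite (ger0_norm (exprn_ge0 _ q0)) bw0 mulr1 mulrAC mulrC ler_wpM2r ?exprn_ge0//.
  rewrite (le_trans (kop_bound (kD m) (yK (n - m)%N) x))// -!mulrA.
  apply: ler_pM => //; first exact: dm_ge0.
  - by rewrite mulr_ge0 ?bw_ge0.
  - by rewrite (le_trans (ler_norm _)).
  - by rewrite ler_wpM2l// bw_nondecreasing// leq_subr.
- move=> m.
  have -> : (fun n => q ^+ m * D m (y (n - m)%N) x / bw k n) =
     (fun n => q ^+ m * (D m (fun z => y (n - m)%N z / bw k (n - m)) x * (bw k (n - m) / bw k n))).
    apply/funext => n; rewrite -mulrA; congr (_ * _).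
    have -> : D m (fun z => y (n - m)%N z / bw k (n - m)) x = D m (y (n - m)%N) x / bw k (n - m).
      transitivity (D m (fun z => (bw k (n - m))^-1 * y (n - m)%N z) x).
        by congr (D m _ x); apply/funext => z; rewrite mulrC.
      by rewrite (kopZ (kD m)) mulrC.
    by rewrite mulrA mulfVK ?bw_neq0.
  apply: cvg_scale; rewrite -[X in _ --> X]mulr1; apply: cvgM.
    have := Hx m; rewrite -(cvg_centern m).
    exact.
  exact: cvg_bw_shiftn.
move=> _.
have -> // : (fun n => psum (fun m => q ^+ m * D m (y (n - m)%N) x / bw k n) n) =
  (fun n => psum (fun m => q ^+ m * D m (y (n - m)%N) x) n / bw k n).
by apply/funext => n; rewrite /psum mulr_suml.
Qed.

End OperatorConvolution.

Section RealComparison.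
Context {R : realType}.
Implicit Types (u v : nat -> R).

Lemma cvg0_squeeze u v : (forall n, `|u n| <= v n) -> v @ \oo --> (0 : R) ->
  u @ \oo --> (0 : R).
Proof.
move=> uv /seq_cvgP v0; apply/seq_cvgP => e /v0[N NP]; exists N => n /NP.
rewrite !sub0r !normrN => h; rewrite (le_trans (uv n))// (le_trans _ h)// ler_norm//.
Qed.

Lemma cvg0_mul_bounded u v (C : R) : (forall n, `|v n| <= C) -> u @ \oo --> (0 : R) ->
  (fun n => u n * v n) @ \oo --> (0 : R).
Proof.
move=> vC u0; apply: (@cvg0_squeeze _ (fun n => C * `|u n|)) => [n|].
  by rewrite normrM mulrC ler_wpM2r.
rewrite -(mulr0 C) -(@normr0 _ R); apply: cvg_scale; exact: cvg_norm.
Qed.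

Lemma bw_leS k n : bw k n <= bw k.+1 n :> R.
Proof.
rewrite bw_ratio ler_peMr ?bw_ge0// ler_pdivlMr ?ltr0n// mul1r ler_nat.
by rewrite addSn ltnS leq_addl.
Qed.

Lemma bw_le k l n : (k <= l)%N -> bw k n <= bw l n :> R.
Proof. by move=> /subnK <-; elim: (l - k)%N => // j IH; rewrite (le_trans IH)// bw_leS. Qed.

Lemma cvg_bw_lt k l : (k < l)%N -> (fun n => bw k n / bw l n) @ \oo --> (0 : R).
Proof.
move=> kl; apply: cvg0_squeeze (cvg_bw_ratio k) => n.
rewrite ger0_norm ?divr_ge0 ?bw_ge0// ler_wpM2l ?bw_ge0// lef_pV2 ?posrE ?bw_gt0//.
exact: bw_le.
Qed.

End RealComparison.

(** * Tame sequences *)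

Section Tame.
Context {d : measure_display} {X : measurableType d} {R : realType}.
Variable nu : probability X R.
Implicit Types (a : nat -> R) (s : nat -> X -> R) (l c : R).

(** Scalar limits will be obtained by evaluating an a.e. statement about constant functions at some
    point; total mass 1 supplies such a point. *)
Lemma ae_inhabited (Q : X -> Prop) : {ae nu, forall x, Q x} -> exists x, Q x.
Proof.
have nu0 : ((nu : {measure set X -> \bar R}) setT > 0)%E.
  by have -> : (nu : {measure set X -> \bar R}) setT = 1%E := probability_setT nu.
have H := ae_properfilter_algebraOfSetsType nu0.
by move=> /filter_ex[x Qx]; exists x.
Qed.

Definition dominated a s := forall n, measurable_fun setT (s n) /\
  forall x, 0 <= s n x <= a n.

(* For [c != 0], [a n] is asymptotic to [c * l ^ n * n ^ k / k!]. *)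
Definition grows l k c a s :=
  (fun n => l ^- n * a n / bw k n) @ \oo --> c /\
  {ae nu, forall x, cvgn (fun n => psum (fun j => l ^- j * s j x) n / bw k.+1 n)}.

Definition vanishes a := exists N, forall n, (N <= n)%N -> a n = 0.

(** The strict sign of c matters twice: it allows division by a, and constants of equal rates cannot
    cancel. The alternative [vanishes] covers ends that no long path reaches, where there is no rate
    at all. *)
Definition tame a s := dominated a s /\
  (vanishes a \/ exists l k c, [/\ 0 < l, 0 < c & grows l k c a s]).

Lemma dominated_ge0 a s n : dominated a s -> 0 <= a n.
Proof.
move=> /(_ n)[_ H]; have [x _] : exists x : X, True by apply: ae_inhabited; exact: aeW.
by have /andP[h1 h2] := H x; exact: le_trans h2.
Qed.

(** Since 0 <= s <= a, the weighted averages of s are squeezed by those of a, which tend to 0 by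
    [cvg_psum_bw]. *)
Lemma grows0 l k a s : 0 < l -> dominated a s ->
  (fun n => l ^- n * a n / bw k n) @ \oo --> (0 : R) -> grows l k 0 a s.
Proof.
move=> l0 ds a0; split => //; apply: aeW => x; apply/cvg_ex; exists 0.
have l0' n : 0 <= l ^- n by rewrite invr_ge0 exprn_ge0// ltW.
apply: cvg0_squeeze (cvg_psum_bw a0) => n.
rewrite normrM normfV (ger0_norm (bw_ge0 _ _)) ler_wpM2r ?invr_ge0 ?bw_ge0//.
rewrite ger0_norm ?ler_psum// => [j _|].
  by rewrite ler_wpM2l//; have [_ /(_ x)/andP[]] := ds j.
by apply: sumr_ge0 => j _; rewrite mulr_ge0//; have [_ /(_ x)/andP[]] := ds j.
Qed.

Lemma vanishes_grows0 l k a s : 0 < l -> dominated a s -> vanishes a -> grows l k 0 a s.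
Proof.
move=> l0 ds [N NP]; apply: grows0 => //; apply/seq_cvgP => e e0; exists N => n /NP ->.
by rewrite mulr0 mul0r subrr normr0 ltW.
Qed.

Lemma grows_lt l k l' k' c a s : 0 < l -> dominated a s -> 0 < l' -> grows l' k' c a s ->
  l' < l \/ l' = l /\ (k' < k)%N -> grows l k 0 a s.
Proof.
move=> l0 ds l'0 [ac _] H; apply: grows0 => //.
have [C C0 aC] := cvgn_bounded ac.
case: H => [ll|[ll kk]].
  have q01 : 0 <= l' / l < 1.
    by rewrite divr_ge0 ?(ltW l0) ?(ltW l'0)//= ltr_pdivrMr// mul1r.
  have -> : (fun n => l ^- n * a n / bw k n) =
     (fun n => ((l' / l) ^+ n * bw k' n) * ((l' ^- n * a n / bw k' n) * (bw k n)^-1)).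
    apply/funext => n; rewrite expr_div_n.
    have := bw_neq0 (R := R) k n; have := bw_neq0 (R := R) k' n.
    have : l ^+ n != 0 by rewrite expf_neq0// gt_eqF.
    have : l' ^+ n != 0 by rewrite expf_neq0// gt_eqF.
    by move=> *; field; do ?[apply/andP; split].
  apply: (@cvg0_mul_bounded _ _ _ C) (cvg_geo_bw k' q01) => n.
  rewrite normrM normfV (ger0_norm (bw_ge0 _ _)) (le_trans _ (aC n))//.
  by rewrite ler_piMr// invf_le1 ?bw_gt0 ?bw_ge1.
subst l'.
have -> : (fun n => l ^- n * a n / bw k n) =
     (fun n => (bw k' n / bw k n) * (l ^- n * a n / bw k' n)).
  apply/funext => n.
  by rewrite [RHS]mulrC mulrA mulfVK ?bw_neq0.
exact: (@cvg0_mul_bounded _ _ _ C) aC (cvg_bw_lt kk).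
Qed.

Lemma dominatedD a s a' s' : dominated a s -> dominated a' s' ->
  dominated (fun n => a n + a' n) (fun n x => s n x + s' n x).
Proof.
move=> ds ds' n; have [ms sa] := ds n; have [ms' sa'] := ds' n; split.
  exact: measurable_funD.
by move=> x; have /andP[h1 h2] := sa x; have /andP[h3 h4] := sa' x; rewrite addr_ge0//= lerD.
Qed.

Lemma growsD l k c c' a s a' s' : grows l k c a s -> grows l k c' a' s' ->
  grows l k (c + c') (fun n => a n + a' n) (fun n x => s n x + s' n x).
Proof.
move=> [ac sc] [ac' sc']; split.
  have -> : (fun n => l ^- n * (a n + a' n) / bw k n) =
    (fun n => l ^- n * a n / bw k n + l ^- n * a' n / bw k n).
    by apply/funext => n; ring.
  exact: cvgD.
apply: filterS2 sc sc' => x /cvg_ex[g gx] /cvg_ex[g' gx']; apply/cvg_ex; exists (g + g').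
have -> : (fun n => psum (fun j => l ^- j * (s j x + s' j x)) n / bw k.+1 n) =
  (fun n => psum (fun j => l ^- j * s j x) n / bw k.+1 n +
            psum (fun j => l ^- j * s' j x) n / bw k.+1 n).
  apply/funext => n; rewrite -mulrDl -big_split/=; congr (_ / _).
  by apply: eq_bigr => j _; rewrite mulrDr.
exact: cvgD.
Qed.

Lemma tame0 a s : dominated a s -> vanishes a -> tame a s.
Proof. by move=> ds va; split => //; left. Qed.

(** Rates (l, k) are compared lexicographically: the slower summand enters at the faster rate with
    constant 0, and equal rates add their constants. *)
Lemma tameD a s a' s' : tame a s -> tame a' s' ->
  tame (fun n => a n + a' n) (fun n x => s n x + s' n x).
Proof.
move=> [ds Hs] [ds' Hs']; split; first exact: dominatedD.
have grow_l l k c : 0 < l -> 0 < c -> grows l k c a s -> grows l k 0 a' s' ->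
    exists l k c, [/\ 0 < l, 0 < c & grows l k c (fun n => a n + a' n) (fun n x => s n x + s' n x)].
  move=> l0 c0 g g'; exists l, k, c; split => //.
  by rewrite -[c]addr0; exact: growsD.
have grow_r l k c : 0 < l -> 0 < c -> grows l k 0 a s -> grows l k c a' s' ->
    exists l k c, [/\ 0 < l, 0 < c & grows l k c (fun n => a n + a' n) (fun n x => s n x + s' n x)].
  move=> l0 c0 g g'; exists l, k, c; split => //.
  by rewrite -[c]add0r; exact: growsD.
case: Hs => [va|[l [k [c [l0 c0 g]]]]]; case: Hs' => [va'|[l' [k' [c' [l'0 c'0 g']]]]].
- left; case: va => [N NP]; case: va' => [N' NP'].
  exists (maxn N N') => n; rewrite geq_max => /andP[/NP -> /NP' ->].
  by rewrite addr0.
- by right; apply: (grow_r _ _ _ l'0 c'0) g'; exact: vanishes_grows0.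
- by right; apply: (grow_l _ _ _ l0 c0) g _; exact: vanishes_grows0.
- right; case: (ltgtP l l') => ll.
  + by apply: (grow_r _ _ _ l'0 c'0) g'; apply: (grows_lt _ _ _ g) => //; left.
  + by apply: (grow_l _ _ _ l0 c0 g); apply: (grows_lt _ _ _ g') => //; left.
  + subst l'; case: (ltngtP k k') => kk.
    * by apply: (grow_r _ _ _ l'0 c'0) g'; apply: (grows_lt _ _ _ g) => //; right.
    * by apply: (grow_l _ _ _ l0 c0 g); apply: (grows_lt _ _ _ g') => //; right.
    * by subst k'; exists l, k, (c + c'); split => //; [rewrite addr_gt0|exact: growsD].
Qed.

Lemma tame_sum (I : Type) (r : seq I) (a : I -> nat -> R) (s : I -> nat -> X -> R) :
  (forall i, tame (a i) (s i)) ->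
  tame (fun n => \sum_(i <- r) a i n) (fun n x => \sum_(i <- r) s i n x).
Proof.
move=> ts; elim: r => [|i r IH].
  apply: tame0; last by exists 0%N => n _; rewrite big_nil.
  move=> n; split; last by move=> x; rewrite !big_nil lexx.
  by under eq_fun do rewrite big_nil; exact: measurable_cst.
have -> : (fun n => \sum_(j <- i :: r) a j n) = (fun n => a i n + \sum_(j <- r) a j n).
  by apply/funext => n; rewrite big_cons.
have -> : (fun n x => \sum_(j <- i :: r) s j n x) =
    (fun n x => s i n x + \sum_(j <- r) s j n x).
  by apply/funext => n; apply/funext => x; rewrite big_cons.
exact: tameD.
Qed.

Lemma kop_dominated c K a s : kop nu c K -> dominated a s ->
  dominated (fun n => c * a n) (fun n => K (s n)).
Proof.
move=> kK ds n; have [ms sa] := ds n; split; first exact: (kop_meas kK).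
move=> x; rewrite -(kop_cst kK (a n) x); apply/andP; split.
  by apply: (kop_pos kK) => y; have /andP[] := sa y.
by apply: (kop_le kK) => y; have /andP[] := sa y.
Qed.

Lemma kop_psum c K (F : nat -> X -> R) n x : kop nu c K ->
  K (fun y => psum (F ^~ y) n) x = psum (fun j => K (F j) x) n.
Proof.
move=> kK; rewrite /psum.
by have := kop_sumr (index_enum 'I_n.+1) (fun (i : 'I_n.+1) => F i) kK => /(congr1 (@^~ x)).
Qed.

Lemma tame_kop c K a s : kop nu c K -> tame a s ->
  tame (fun n => c * a n) (fun n => K (s n)).
Proof.
move=> kK [ds Hs]; split; first exact: kop_dominated.
have [->|c0] := eqVneq c 0; first by left; exists 0%N => n _; rewrite mul0r.
have {}c0 : 0 < c by rewrite lt_neqAle eq_sym c0 (kop_ge0 kK).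
case: Hs => [[N NP]|[l [k [c' [l0 c'0 [ac sc]]]]]].
  by left; exists N => n /NP ->; rewrite mulr0.
right; exists l, k, (c * c'); split => //; first exact: mulr_gt0.
split.
  have -> : (fun n => l ^- n * (c * a n) / bw k n) = (fun n => c * (l ^- n * a n / bw k n)).
    by apply/funext => n; ring.
  exact: cvg_scale.
pose g x := limn (fun n => psum (fun j => l ^- j * s j x) n / bw k.+1 n).
have := @kop_ae_cvg _ _ _ nu c K kK (fun n x => psum (fun j => l ^- j * s j x) n / bw k.+1 n) g sc.
apply: filterS => x Kx; apply/cvg_ex; exists (K g x).
have -> // : (fun n => psum (fun j => l ^- j * K (s j) x) n / bw k.+1 n) =
  (fun n => K (fun x => psum (fun j => l ^- j * s j x) n / bw k.+1 n) x).
apply/funext => n.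
have -> : (fun x => psum (fun j => l ^- j * s j x) n / bw k.+1 n) =
   (fun x => (bw k.+1 n)^-1 * psum (fun j => l ^- j * s j x) n).
  by apply/funext => y; rewrite mulrC.
rewrite (kopZ kK) (kop_psum (fun j y => l ^- j * s j y) n x kK) mulrC; congr (_ * _).
by apply: eq_bigr => j _; rewrite (kopZ kK).
Qed.

(** Shape of the source terms in Duhamel's formula: the initial value at time 0, then at time n + 1
    the input computed from time n. *)
Definition prepend (T : Type) (t : T) (s : nat -> T) n : T := if n is m.+1 then s m else t.

Lemma tame_prepend a s (b : R) (t : X -> R) : tame a s -> measurable_fun setT t ->
  (forall x, 0 <= t x <= b) -> tame (prepend b a) (prepend t s).
Proof.
move=> [ds Hs] mt tb; split; first by case=> [|n] //=; exact: ds.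
case: Hs => [[N NP]|[l [k [c [l0 c0 [ac sc]]]]]].
  by left; exists N.+1; case.
right; exists l, k, (l^-1 * c); split; rewrite ?mulr_gt0 ?invr_gt0//.
have ln0 n : l ^+ n != 0 by rewrite expf_neq0// gt_eqF.
have l0' : l != 0 by rewrite gt_eqF.
split.
  have H : (fun n => (l^-1 * (l ^- n * a n / bw k n)) * (bw k n / bw k n.+1)) @ \oo
      --> l^-1 * c * 1.
    by apply: cvgM; [exact: cvg_scale|exact: cvg_bw_shift].
  rewrite mulr1 in H; rewrite -cvg_shiftS.
  have -> // : [sequence l ^- n.+1 * prepend b a n.+1 / bw k n.+1]_n =
     (fun n => (l^-1 * (l ^- n * a n / bw k n)) * (bw k n / bw k n.+1)).
  apply/funext => n /=; rewrite exprS invfM -!mulrA; congr (_ * (_ * (_ * _))).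
  by rewrite mulKf ?bw_neq0.
apply: filterS sc => x /cvg_ex[/= g gx]; apply/cvg_ex; exists (l^-1 * g).
have H : (fun n => t x * (bw k.+1 n.+1)^-1 +
     (l^-1 * (psum (fun j => l ^- j * s j x) n / bw k.+1 n)) * (bw k.+1 n / bw k.+1 n.+1))
   @ \oo --> t x * 0 + l^-1 * g * 1.
  apply: cvgD; last by apply: cvgM; [exact: cvg_scale|exact: cvg_bw_shift].
  by apply: cvg_scale; have := @cvg_bwV R k; rewrite -cvg_shiftS.
rewrite mulr0 add0r mulr1 in H; rewrite -cvg_shiftS.
have -> // : [sequence psum (fun j => l ^- j * prepend t s j x) n.+1 / bw k.+1 n.+1]_n =
   (fun n => t x * (bw k.+1 n.+1)^-1 +
     (l^-1 * (psum (fun j => l ^- j * s j x) n / bw k.+1 n)) * (bw k.+1 n / bw k.+1 n.+1)).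
apply/funext => n /=.
have -> : psum (fun j => l ^- j * prepend t s j x) n.+1 =
   t x + l^-1 * psum (fun j => l ^- j * s j x) n.
  rewrite /psum big_ord_recl/= expr0 invr1 mul1r mulr_sumr; congr (_ + _).
  by apply: eq_bigr => j _; rewrite /= /bump/= add1n exprS invfM mulrA.
rewrite mulrDl -!mulrA; congr (_ + _ * (_ * _)).
by rewrite mulKf ?bw_neq0.
Qed.

(** With r = s / a and [al] the scaled a, r = (1 - al / c) r + c^-1 (l^-j s / bw k). The first part
    tends to 0 because |r| <= 1, and [cvg_unweight] treats the second. Where a = 0 also s = 0, and
    the inverse is 0, matching the convention for the empty set of paths. *)
Lemma tame_cesaro a s : tame a s ->
  {ae nu, forall x, cvgn (fun n => psum (fun j => (a j)^-1 * s j x) n / n.+1%:R)}.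
Proof.
move=> [ds Hs].
have q1 n x : `|(a n)^-1 * s n x| <= 1.
  have [_ /(_ x)/andP[s0 sa]] := ds n; have a0 := dominated_ge0 n ds.
  rewrite ger0_norm ?mulr_ge0 ?invr_ge0//.
  have [a00|an0] := eqVneq (a n) 0; first by rewrite a00 invr0 mul0r.
  by rewrite mulrC ler_pdivrMr ?mul1r// lt_neqAle eq_sym an0.
case: Hs => [[N NP]|[l [k [c [l0 c0 [ac sc]]]]]].
  apply: aeW => x; apply/cvg_ex; exists 0; apply: cvg_cesaro.
  apply/seq_cvgP => e e0; exists N => n /NP ->.
  by rewrite invr0 mul0r subrr normr0 ltW.
apply: filterS sc => x /cvg_ex[/= g /cvg_unweight gx].
apply/cvg_ex; exists (0 + c^-1 * g).
pose al n := l ^- n * a n / bw k n.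
have zE n : l ^- n * s n x / bw k n = ((a n)^-1 * s n x) * al n.
  rewrite /al; have [a00|an0] := eqVneq (a n) 0.
    have [_ /(_ x)] := ds n; rewrite a00 => /andP[h1 h2].
    have -> : s n x = 0 by apply/eqP; rewrite eq_le h1 h2.
    by rewrite !(mulr0, mul0r).
  move: (l ^- n) (bw k n) (bw_neq0 (R := R) k n) => L w w0.
  by field; rewrite an0 w0.
have -> : (fun n => psum (fun j => (a j)^-1 * s j x) n / n.+1%:R) =
  (fun n => psum (fun j => (1 - al j / c) * ((a j)^-1 * s j x)) n / n.+1%:R +
     c^-1 * (psum (fun j => l ^- j * s j x / bw k j) n / n.+1%:R)).
  apply/funext => n; rewrite [X in _ + X]mulrA -mulrDl; congr (_ / _).
  rewrite /psum mulr_sumr -big_split/=; apply: eq_bigr => j _.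
  rewrite zE; move: ((a j)^-1 * s j x) (al j) => t w.
  by field; rewrite gt_eqF.
apply: cvgD; last exact: cvg_scale.
apply: cvg_cesaro; apply: (@cvg0_mul_bounded _ _ _ 1) => //.
rewrite -(subrr 1); apply: cvgB; first exact: cvg_cst.
rewrite -(divff (_ : c != 0)) ?gt_eqF//.
by apply: cvgM => //; exact: cvg_cst.
Qed.

End Tame.

Section DoubleSums.
Context {R : realType}.

Lemma psum_psum (f : nat -> nat -> R) n :
  psum (fun j => psum (fun m => f m (j - m)%N) j) n = psum (fun m => psum (f m) (n - m)) n.
Proof.
elim: n => [|n IH]; first by rewrite !psum0.
rewrite psumS IH !psumS subnn psum0 addrA; congr (_ + _).
rewrite /psum -big_split/=; apply: eq_bigr => i _.
have i_le : (i <= n)%N by rewrite -ltnS.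
by rewrite subSn// [RHS]big_ord_recr.
Qed.

Lemma psum_ge_term (u : nat -> R) j n : (forall i, 0 <= u i) -> (j <= n)%N -> u j <= psum u n.
Proof.
move=> u0 jn; rewrite (le_trans _ (psum_nondecreasing u0 jn))//.
by case: j jn => [|j] _; rewrite ?psum0// psumS lerDr; apply: sumr_ge0 => i _.
Qed.

End DoubleSums.

(** * Convolution with an ergodic operator sequence preserves tameness *)

Section TameConvolution.
Context {d : measure_display} {X : measurableType d} {R : realType}.
Variable nu : probability X R.
Variables (D : nat -> (X -> R) -> X -> R) (dm : nat -> R) (delta L : R).
Hypothesis kD : forall n, kop nu (dm n) (D n).
Hypothesis dm_cvg : dm @ \oo --> delta.
Hypothesis delta_gt0 : 0 < delta.
Hypothesis L_gt0 : 0 < L.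
Hypothesis D_ergodic : forall f, bmeas f ->
  {ae nu, forall x, cvgn (fun n => psum (fun m => D m f x) n / n.+1%:R)}.
Implicit Types (a : nat -> R) (s : nat -> X -> R).

Let conva a n : R := psum (fun m => L ^+ m * (dm m * a (n - m)%N)) n.
Let convs s n x : R := psum (fun m => L ^+ m * D m (s (n - m)%N) x) n.

Let convs_cst a n x : convs (fun n _ => a n) n x = conva a n.
Proof. by apply: eq_bigr => m _; rewrite (kop_cst (kD m)). Qed.

Let convs_scaled (l : R) s n x : 0 < l -> l ^- n * convs s n x =
  psum (fun m => (L / l) ^+ m * D m (fun z => l ^- (n - m) * s (n - m)%N z) x) n.
Proof.
move=> l0; rewrite /convs /psum mulr_sumr; apply: eq_bigr => m _.
rewrite (kopZ (kD m)) expr_div_n.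
have mn : (m <= n)%N by rewrite -ltnS.
have {1}-> : n = (n - m + m)%N by rewrite subnK.
rewrite exprD; move: (D m _ x) => t.
have h1 : l ^+ m != 0 by rewrite expf_neq0// gt_eqF.
have h2 : l ^+ (n - m) != 0 by rewrite expf_neq0// gt_eqF.
by field; rewrite h1 h2.
Qed.

(** The scaled s need not converge, only their normalised partial sums do. Hence the partial sums
    are moved inside the convolution, where they can play the part of [y] in
    [operator_convolution]. *)
Let psum_convs (l : R) s n x : 0 < l -> psum (fun j => l ^- j * convs s j x) n =
  psum (fun m => (L / l) ^+ m * D m (fun z => psum (fun j => l ^- j * s j z) (n - m)) x) n.
Proof.
move=> l0.
pose f m i := (L / l) ^+ m * D m (fun z => l ^- i * s i z) x.
transitivity (psum (fun j => psum (fun m => f m (j - m)%N) j) n).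
  by apply: eq_bigr => j _; exact: convs_scaled.
rewrite psum_psum; apply: eq_bigr => m _.
by rewrite (kop_psum (fun j z => l ^- j * s j z) _ _ (kD m)) /psum mulr_sumr.
Qed.

Let conv_dominated a s : dominated a s -> dominated (conva a) (convs s).
Proof.
move=> ds n; have kds m := kop_dominated (kD m) ds; split.
  apply: measurable_sum => m; apply: measurable_funM; first exact: measurable_cst.
  by have [mm _] := ds (n - m)%N; exact: (kop_meas (kD m)).
move=> x; have Lm m : 0 <= L ^+ m by rewrite exprn_ge0// ltW.
apply/andP; split.
  by apply: sumr_ge0 => m _; rewrite mulr_ge0//; have [_ /(_ x)/andP[]] := kds m (n - m)%N.
by apply: ler_psum => m _; rewrite ler_wpM2l//; have [_ /(_ x)/andP[]] := kds m (n - m)%N.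
Qed.

Let measurable_wsum (l : R) s n : (forall j, measurable_fun setT (s j)) ->
  measurable_fun setT (fun x => psum (fun j => l ^- j * s j x) n).
Proof.
by move=> ms; apply: measurable_sum => j; apply: measurable_funM => //; exact: measurable_cst.
Qed.

Let wsum_bound (l : R) a s n x : 0 < l -> dominated a s ->
  `|psum (fun j => l ^- j * s j x) n| <= psum (fun j => l ^- j * a j) n.
Proof.
move=> l0 ds; have l0' j : 0 <= l ^- j by rewrite invr_ge0 exprn_ge0// ltW.
rewrite ger0_norm ?ler_psum// => [j _|].
  by rewrite ler_wpM2l//; have [_ /(_ x)/andP[]] := ds j.
by apply: sumr_ge0 => j _; rewrite mulr_ge0//; have [_ /(_ x)/andP[]] := ds j.
Qed.

Let dlim_cst c x : dlim D (fun=> c) x = delta * c.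
Proof.
apply: limn_sup_cvg.
have -> : (fun n => davg D (fun=> c) n x) = (fun n => psum (fun m => c * dm m) n / n.+1%:R).
  by apply/funext => n; congr (_ / _); apply: eq_bigr => m _; rewrite (kop_cst (kD m)) mulrC.
by apply: cvg_cesaro; rewrite mulrC; exact: cvg_scale.
Qed.

(* The input is negligible with respect to the growth rate L of D. *)
Let conv_summable a s (C : R) : dominated a s -> (forall n, psum (fun j => L ^- j * a j) n <= C) ->
  tame nu (conva a) (convs s).
Proof.
move=> ds aC; split; first exact: conv_dominated.
have [[j0 aj0]|/forallNP aN] := pselect (exists j, 0 < a j); last first.
  have a0 n : a n = 0.
    by apply/eqP; rewrite eq_le (dominated_ge0 nu n ds) andbT leNgt; apply/negP; exact: aN.
  by left; exists 0%N => n _; apply: big1 => m _; rewrite a0 !mulr0.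
have L0 j : 0 < L ^- j by rewrite invr_gt0 exprn_gt0.
have b0 j : 0 <= L ^- j * a j.
  by apply: mulr_ge0; [exact: ltW|exact: (dominated_ge0 nu j ds)].
have [C' C'0 dC'] := cvgn_bounded dm_cvg.
(* Here the inputs [L ^- j * a j] supply the summable factor, while [dm (n - j)] converges to
   delta. *)
have [] := @tannery R (fun n j => L ^- j * a j * dm (n - j)%N) (fun j => L ^- j * a j * delta)
  (fun j => L ^- j * a j * C') (C * C').
- by move=> n; rewrite /psum -mulr_suml ler_wpM2r// ?aC// ltW.
- by move=> n m mn; rewrite normrM (ger0_norm (b0 m)) ler_wpM2l.
- by move=> m; apply: cvg_scale; rewrite (cvg_centern m).
move=> /cvg_ex[c cc]; rewrite (cvg_lim _ cc)// => ac.
(* The growth is purely L^n; c is positive because the increasing partial sums eventually contain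
   the positive term at j0. *)
right; exists L, 0%N, c; split => //.
  rewrite (lt_le_trans (_ : 0 < L ^- j0 * a j0 * delta))// ?mulr_gt0//.
  apply: (ler_cvg_to (cvg_cst _) cc).
  exists j0 => // n jn; apply: (psum_ge_term (u := fun j => L ^- j * a j * delta)) jn => i.
  by rewrite mulr_ge0// ltW.
split.
  have -> // : (fun n => L ^- n * conva a n / bw 0 n) =
    (fun n => psum (fun j => L ^- j * a j * dm (n - j)%N) n).
  apply/funext => n; rewrite bw0 divr1 -psum_rev /conva /psum mulr_sumr.
  apply: eq_bigr => m _; have mn : (m <= n)%N by rewrite -ltnS.
  rewrite subKn// (_ : L ^+ n = L ^+ (n - m) * L ^+ m); last by rewrite -exprD subnK.
  have h1 : L ^+ m != 0 by rewrite expf_neq0// gt_eqF.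
  have h2 : L ^+ (n - m) != 0 by rewrite expf_neq0// gt_eqF.
  by field; rewrite h1 h2.
pose y n x := psum (fun j => L ^- j * s j x) n.
have yC n x : `|y n x| <= C by rewrite (le_trans (wsum_bound _ _ _ ds)).
have my n : measurable_fun setT (y n).
  by apply: measurable_wsum => j; case: (ds j).
have yl x : (fun n => y n x / bw 0 n) @ \oo --> limn_sup (y ^~ x).
  have -> : (fun n => y n x / bw 0 n) = y ^~ x by apply/funext => n; rewrite bw0 divr1.
  have /cvg_ex[/= l yl] : cvgn (y ^~ x).
    apply: psum_bounded_cvg aC => j; have [_ /(_ x)/andP[s0 sa]] := ds j.
    by rewrite normrM (ger0_norm (ltW (L0 j))) (ger0_norm s0) ler_wpM2l// ltW.
  by rewrite (limn_sup_cvg yl).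
have bg : bmeas (fun x => limn_sup (y ^~ x)) by apply: (@bmeas_limn_sup _ _ _ _ C).
have := @operator_convolution _ _ _ nu D dm delta kD dm_cvg D_ergodic 0 y C
  (fun x => limn_sup (y ^~ x)) my.
have yC' n x : `|y n x| <= C * bw 0 n by rewrite bw0 mulr1.
move=> /(_ yC' bg (aeW _ yl)); apply: filterS => x H; apply/cvg_ex; eexists.
have -> : (fun n => psum (fun j => L ^- j * convs s j x) n / bw 1 n) =
  (fun n => psum (fun m => D m (y (n - m)%N) x) n / bw 1 n); last exact: H.
apply/funext => n; rewrite psum_convs// divff ?gt_eqF//; congr (_ / _).
by apply: eq_bigr => m _; rewrite expr1n mul1r.
Qed.

(** The larger rate wins. If L exceeds l, or the input vanishes eventually, the scaled input is
    summable and the output grows like L^n; if L < l, the rate l and the degree k persist with a new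
    constant given by a series; a tie raises the degree. *)
Lemma tame_convolution a s : tame nu a s ->
  tame nu (fun n => psum (fun m => L ^+ m * (dm m * a (n - m)%N)) n)
    (fun n x => psum (fun m => L ^+ m * D m (s (n - m)%N) x) n).
Proof.
move=> [ds Hs]; rewrite -/(conva a) -[X in tame _ _ X]/(convs s).
case: Hs => [[N NP]|[l [k [c [l0 c0 [ac sc]]]]]].
  apply: (conv_summable (C := psum (fun j => L ^- j * a j) N) ds) => n.
  have b0 j : 0 <= L ^- j * a j.
    apply: mulr_ge0; last exact: (dominated_ge0 nu j ds).
    by rewrite invr_ge0 exprn_ge0// ltW.
  case: (leqP n N) => nN; first exact: psum_nondecreasing.
  rewrite -subr_le0.
  have := @psum_tail R (fun j => L ^- j * a j) (fun=> 0) N n (ltnW nN).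
  have z m : psum (fun=> 0 : R) m = 0 by rewrite /psum big1.
  rewrite !z subrr => H.
  rewrite (le_trans (ler_norm _))// H// => j /andP[Nj _].
  by rewrite NP ?mulr0 ?normr0// ltnW.
have [K K0 aK] := cvgn_bounded ac.
have aK' n : `|l ^- n * a n| <= K * bw k n.
  by have := aK n; rewrite normrM normfV (ger0_norm (bw_ge0 _ _)) ler_pdivrMr ?bw_gt0.
pose g x := limn_sup (fun n => psum (fun j => l ^- j * s j x) n / bw k.+1 n).
have ybound n x : `|psum (fun j => l ^- j * s j x) n| <= K * bw k.+1 n.
  rewrite (le_trans (wsum_bound _ _ _ ds))// -psum_bw /psum mulr_sumr.
  by apply: ler_sum => j _; rewrite (le_trans (ler_norm _)).
have my n : measurable_fun setT (fun x => psum (fun j => l ^- j * s j x) n).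
  by apply: measurable_wsum => j; case: (ds j).
have bg : bmeas g.
  apply: (@bmeas_limn_sup _ _ _ (fun n x => psum (fun j => l ^- j * s j x) n / bw k.+1 n) K).
    by move=> n; apply: measurable_funM => //; exact: measurable_cst.
  move=> n x; rewrite normrM normfV (ger0_norm (bw_ge0 k.+1 n)) ler_pdivrMr ?bw_gt0//.
have sg : {ae nu, forall x,
    (fun n => psum (fun j => l ^- j * s j x) n / bw k.+1 n) @ \oo --> g x}.
  by apply: filterS sc => x /cvg_ex[/= t gt]; rewrite /g (limn_sup_cvg gt).
have convaE n x : l ^- n * conva a n =
    psum (fun m => (L / l) ^+ m * D m (fun=> l ^- (n - m) * a (n - m)%N) x) n.
  by rewrite -(convs_cst a n x) convs_scaled.
case: (ltgtP L l) => lL; last first.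
- (* equal growth rates: the polynomial degree increases by one *)
  subst l; split; first exact: conv_dominated.
  right; exists L, k.+1, (delta * c); split => //; first exact: mulr_gt0.
  split.
    have /ae_inhabited[x H] := @operator_convolution _ _ _ nu D dm delta kD dm_cvg D_ergodic k
      (fun n _ => L ^- n * a n) K (fun=> c) (fun n => measurable_cst _) (fun n _ => aK' n)
      (bmeas_cst c) (aeW _ (fun _ => ac)).
    rewrite dlim_cst in H.
    have -> // : (fun n => L ^- n * conva a n / bw k.+1 n) =
      (fun n => psum (fun m => D m (fun=> L ^- (n - m) * a (n - m)%N) x) n / bw k.+1 n).
    apply/funext => n; rewrite (convaE n x) divff ?gt_eqF//; congr (_ / _).
    by apply: eq_bigr => m _; rewrite expr1n mul1r.
  have := @operator_convolution _ _ _ nu D dm delta kD dm_cvg D_ergodic k.+1 _ K g my ybound bg sg.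
  apply: filterS => x H; apply/cvg_ex; eexists.
  have -> : (fun n => psum (fun j => L ^- j * convs s j x) n / bw k.+2 n) =
    (fun n => psum (fun m => D m (fun z => psum (fun j => L ^- j * s j z) (n - m)) x) n / bw k.+2 n);
    last exact: H.
  apply/funext => n; rewrite psum_convs// divff ?gt_eqF//; congr (_ / _).
  by apply: eq_bigr => m _; rewrite expr1n mul1r.
- have q01 : 0 <= l / L < 1.
    by rewrite divr_ge0 ?(ltW l0) ?(ltW L_gt0)//= ltr_pdivrMr// mul1r.
  apply: (conv_summable (C := K * (1 - l / L)^-1 ^+ k.+1) ds) => n.
  have /le_trans : psum (fun j => L ^- j * a j) n <= K * psum (fun j => (l / L) ^+ j * bw k j) n.
    rewrite /psum mulr_sumr; apply: ler_sum => j _.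
    have -> : L ^- j * a j = (l / L) ^+ j * (l ^- j * a j).
      rewrite expr_div_n; have h1 : L ^+ j != 0 by rewrite expf_neq0// gt_eqF.
      have h2 : l ^+ j != 0 by rewrite expf_neq0// gt_eqF.
      by field; rewrite h1 h2.
    rewrite [leRHS]mulrCA ler_wpM2l ?exprn_ge0//; first by case/andP: q01.
    by rewrite (le_trans (ler_norm _)).
  by apply; rewrite ler_wpM2l ?geo_bw_summable// ltW.
- have q01 : 0 <= L / l < 1.
    by rewrite divr_ge0 ?(ltW l0) ?(ltW L_gt0)//= ltr_pdivrMr// mul1r.
  split; first exact: conv_dominated.
  pose u m := (L / l) ^+ m * (dm m * c).
  have [C C0 dC] := cvgn_bounded dm_cvg.
  have q0 m : 0 <= (L / l) ^+ m by rewrite exprn_ge0//; case/andP: q01.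
  have u0 m : 0 <= u m by rewrite mulr_ge0// mulr_ge0 ?(ltW c0)//; exact: dm_ge0 kD m.
  have cu : cvgn (psum u).
    apply: (@psum_bounded_cvg _ _ (fun m => (C * c) * ((L / l) ^+ m * bw 0 m)) ((C * c) * (1 - L / l)^-1 ^+ 1)).
      move=> m; rewrite ger0_norm// /u bw0 mulr1 mulrC ler_wpM2r// ler_wpM2r ?(ltW c0)//.
      by rewrite (le_trans (ler_norm _)).
    move=> n; rewrite /psum -mulr_sumr ler_wpM2l ?mulr_ge0 ?(ltW c0) ?(ltW C0)//.
    exact: geo_bw_summable.
  right; exists l, k, (limn (psum u)); split => //.
    have [m0 dm0] : exists m, 0 < dm m.
      have /seq_cvgP/(_ _ (divr_gt0 delta_gt0 (ltr0n R 2)))[N NP] := dm_cvg.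
      exists N; have := NP N (leqnn N); rewrite ler_norml => /andP[h1 h2].
      by move: delta_gt0; lra.
    rewrite (lt_le_trans (_ : 0 < u m0))//.
      rewrite /u !mulr_gt0// lt_neqAle q0 andbT eq_sym expf_neq0//.
      by rewrite mulf_neq0 ?invr_neq0// gt_eqF.
    apply: (ler_cvg_to (cvg_cst (u m0)) cu).
    by exists m0 => // n mn; exact: psum_ge_term.
  split.
    have /ae_inhabited[x H] := @operator_convolution_lt _ _ _ nu D dm delta kD dm_cvg k
      (fun n _ => l ^- n * a n) K (L / l) (fun=> c) q01 (fun n _ => aK' n) (aeW _ (fun _ => ac)).
    have -> : (fun n => l ^- n * conva a n / bw k n) =
      (fun n => psum (fun m => (L / l) ^+ m * D m (fun=> l ^- (n - m) * a (n - m)%N) x) n / bw k n).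
      by apply/funext => n; rewrite (convaE n x).
    have -> : u = (fun m => (L / l) ^+ m * D m (fun=> c) x).
      by apply/funext => m; rewrite (kop_cst (kD m)).
    exact: H.
  have := @operator_convolution_lt _ _ _ nu D dm delta kD dm_cvg k.+1
    (fun n x => psum (fun j => l ^- j * s j x) n) K (L / l) g q01 ybound sg.
  apply: filterS => x H; apply/cvg_ex; eexists.
  have -> : (fun n => psum (fun j => l ^- j * convs s j x) n / bw k.+1 n) =
    (fun n => psum (fun m => (L / l) ^+ m * D m (fun z => psum (fun j => l ^- j * s j z) (n - m)) x) n
       / bw k.+1 n); last exact: H.
  by apply/funext => n; rewrite psum_convs.
Qed.

End TameConvolution.

(** * Perron-Frobenius theory *)

Section MatrixPowers.
Context {R : realType} {W : finType}.
Implicit Types (A p : W -> W -> R) (h : W -> R).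

Fixpoint mpow A n v w : R :=
  if n is m.+1 then \sum_z A v z * mpow A m z w else (v == w)%:R.

Lemma sum_delta (f : W -> R) v : \sum_z (v == z)%:R * f z = f v.
Proof.
rewrite (bigD1 v)//= eqxx mul1r big1 ?addr0// => z zv.
by rewrite eq_sym (negbTE zv) mul0r.
Qed.

Lemma sum_deltar (f : W -> R) v : \sum_z f z * (z == v)%:R = f v.
Proof. by under eq_bigr do rewrite mulrC eq_sym; exact: sum_delta. Qed.

Lemma mpowD A m n v w : mpow A (m + n) v w = \sum_z mpow A m v z * mpow A n z w.
Proof.
elim: m v => [|m IH] v /=; first by rewrite sum_delta.
under eq_bigr do rewrite IH mulr_sumr.
rewrite exchange_big/=; apply: eq_bigr => z _.
by rewrite mulr_suml; apply: eq_bigr => y _; rewrite mulrA.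
Qed.

Lemma mpow1 A v w : mpow A 1 v w = A v w.
Proof. by rewrite /= sum_deltar. Qed.

Lemma mpowSr A n v w : mpow A n.+1 v w = \sum_z mpow A n v z * A z w.
Proof. by rewrite -addn1 mpowD; under eq_bigr do rewrite mpow1. Qed.

Lemma mpow_ge0 A n : (forall v w, 0 <= A v w) -> forall v w, 0 <= mpow A n v w.
Proof.
move=> A0; elim: n => [|n IH] v w /=; first exact: ler0n.
by apply: sumr_ge0 => z _; rewrite mulr_ge0.
Qed.

Lemma mpowD_gt0 A m n v z w : (forall v w, 0 <= A v w) ->
  0 < mpow A m v z -> 0 < mpow A n z w -> 0 < mpow A (m + n) v w.
Proof.
move=> A0 h1 h2; rewrite mpowD (bigD1 z)//= ltr_pwDl ?mulr_gt0//.
by apply: sumr_ge0 => y _; rewrite mulr_ge0 ?mpow_ge0.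
Qed.

Lemma mpow_stochastic p n : (forall v, \sum_w p v w = 1) ->
  forall v, \sum_w mpow p n v w = 1.
Proof.
move=> p1; elim: n => [|n IH] v /=.
  by rewrite -[RHS](sum_delta (fun=> 1) v); apply: eq_bigr => w _; rewrite mulr1.
rewrite exchange_big/= -[RHS](p1 v); apply: eq_bigr => z _.
by rewrite -mulr_sumr IH mulr1.
Qed.

(** The witness is the reciprocal of a sum of reciprocals instead of a minimum; the summand 1 covers
    an empty type. *)
Lemma pos_lower_bound (f : W -> R) : (forall v, 0 < f v) ->
  exists2 e, 0 < e & forall v, e <= f v.
Proof.
move=> f0; exists (1 + \sum_v (f v)^-1)^-1.
  by rewrite invr_gt0 ltr_pwDl// sumr_ge0// => v _; rewrite invr_ge0 ltW.
move=> v; rewrite -[leRHS]invrK lef_pV2 ?posrE ?invr_gt0//; last first.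
  by rewrite ltr_pwDl// sumr_ge0// => w _; rewrite invr_ge0 ltW.
rewrite (bigD1 v)//= addrCA lerDl addr_ge0// sumr_ge0// => w _.
by rewrite invr_ge0 ltW.
Qed.

End MatrixPowers.

Lemma closed_eigen_constraints (R : realType) (W : finType) (A : W -> W -> R)
    (T : topologicalType) (t : T -> R) (x : W -> T -> R) :
  continuous t -> (forall w, continuous (x w)) ->
  closed [set f | \sum_w x w f = 1 /\ forall v, t f * x v f <= \sum_w A v w * x w f].
Proof.
move=> ct cx.
have csum (c : W -> R) : continuous (fun f => \sum_w c w * x w f).
  move=> f; apply: cvg_big => [|w _]; first exact: add_continuous.
  by apply: cvgM; [exact: cvg_cst|exact: cx].
have -> : [set f | \sum_w x w f = 1 /\ forall v, t f * x v f <= \sum_w A v w * x w f] =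
    ((fun f => \sum_w 1 * x w f) @^-1` [set y | y = 1]) `&`
    \bigcap_(v in [set: W]) ((fun f => \sum_w A v w * x w f - t f * x v f) @^-1` [set y | 0 <= y]).
  have s1 f : \sum_w 1 * x w f = \sum_w x w f by apply: eq_bigr => w _; rewrite mul1r.
  apply/seteqP; split => f /= [h1 h2]; split; rewrite ?s1// in h1 *.
    by move=> v _ /=; rewrite subr_ge0.
  by move=> v; have := h2 v I; rewrite /= subr_ge0.
apply: closedI.
  by have /continuous_closedP := csum (fun=> 1); apply; exact: closed_eq.
apply: closed_bigI => v _.
suff /continuous_closedP : continuous (fun f => \sum_w A v w * x w f - t f * x v f).
  by apply; exact: closed_ge.
move=> f; apply: cvgB; first exact: csum.
by apply: cvgM; [exact: ct|exact: cx].
Qed.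

Section PerronVector.
Context {R : realType} {W : finType}.
Variable A : W -> W -> R.
Hypothesis A0 : forall v w, 0 <= A v w.

Let feasible (t : R) (x : W -> R) := [/\ forall v, 0 <= x v, \sum_v x v = 1 &
  forall v, t * x v <= \sum_w A v w * x w].

Let feasible_le t x : feasible t x -> t <= \sum_v \sum_w A v w.
Proof.
move=> [x0 x1 tx]; rewrite -[t]mulr1 -x1 mulr_sumr ler_sum// => v _.
rewrite (le_trans (tx v))// ler_sum// => w _; rewrite ler_piMr//.
by rewrite -x1 (bigD1 w)//= lerDl sumr_ge0.
Qed.

(* The Collatz-Wielandt maximum is attained, by compactness of the simplex. *)
Lemma collatz_wielandt (v0 : W) : exists (t : R) (x : W -> R), [/\ 0 <= t, feasible t x &
  forall t' x', 0 <= t' -> feasible t' x' -> t' <= t].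
Proof.
pose M := 1 + \sum_v \sum_w A v w.
have sA0 : 0 <= \sum_v \sum_w A v w by apply: sumr_ge0 => v _; apply: sumr_ge0.
(* One compact product holds the whole candidate: the coordinate [None] is t, the coordinates
   [Some v] are the vector. *)
pose T := prod_topology (fun _ : option W => R : topologicalType).
pose box := [set f : T | forall i, `[0, M]%classic (f i)].
have cbox : compact box.
  by apply: (@tychonoff (option W) (fun _ => R : topologicalType) (fun _ => `[0, M]%classic)) => i; exact: segment_compact.
have ci i : continuous (fun f : T => f i : R).
  by exact: (@proj_continuous (option W) (fun _ => R : topologicalType) i).
pose K := box `&` [set f | \sum_w f (Some w) = 1 /\
  forall v, f None * f (Some v) <= \sum_w A v w * f (Some w)].
have cK : compact K.
  apply: compact_closedI => //.
  exact: (@closed_eigen_constraints R W A T (fun f => f None) (fun w f => f (Some w))).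
have KP (t : R) x : 0 <= t -> feasible t x -> K (fun i => if i is Some v then x v else t).
  move=> t0 /[dup] ft [x0 x1 tx]; split => //.
    have tM : t <= M by rewrite (le_trans (feasible_le ft))// lerDr.
    move=> [v|] /=; rewrite in_itv/= ?t0 ?tM// x0 /=.
    have : x v <= \sum_v x v by rewrite (bigD1 v)//= lerDl sumr_ge0.
    by rewrite x1 => /le_trans; apply; rewrite lerDl.
have K0 : K !=set0.
  exists (fun i => if i is Some v then (v == v0)%:R else 0); apply: KP => //; split.
  - by move=> v; exact: ler0n.
  - by rewrite -[RHS](sum_deltar (fun=> 1 : R) v0); apply: eq_bigr => w _; rewrite mul1r.
  - by move=> v; rewrite mul0r sumr_ge0// => w _; rewrite mulr_ge0.
have [f fK fmax] := compact_EVT_max K0 cK (continuous_subspaceT (ci None)).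
have [fb [f1 fg]] : K f by rewrite inE in fK.
exists (f None), (fun v => f (Some v)); split.
- by have := fb None; rewrite /= in_itv/= => /andP[].
- split => //.
    by move=> v; have := fb (Some v); rewrite /= in_itv/= => /andP[].
- by move=> t' x' t'0 /(KP _ _ t'0) Kt'; have := fmax _ (mem_set Kt').
Qed.

(** If the maximal pair were no eigenpair, the nonnegative defect A x - t x would become positive
    everywhere under A^m, leaving room for a larger t at the normalised vector A^m x. Then A^m x =
    t^m x forces x > 0, and the loop at v0 gives t > 0. *)
Lemma perron_vector m v0 : (forall v w, 0 < mpow A m v w) -> 0 < A v0 v0 ->
  exists (l : R) (h : W -> R), [/\ 0 < l, forall v, 0 < h v & forall v, \sum_w A v w * h w = l * h v].
Proof.
move=> Am A00; have [t [x [t0 [x0 x1 tx] tmax]]] := collatz_wielandt v0.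
pose z v := \sum_w mpow A m v w * x w.
have [w1 xw1] : exists w, 0 < x w.
  apply: contrapT => /forallNP H; have : \sum_v x v = 0.
    by apply: big1 => v _; apply/eqP; rewrite eq_le x0 andbT leNgt; apply/negP/H.
  by rewrite x1 => /eqP; rewrite oner_eq0.
have z0 v : 0 < z v.
  rewrite /z (bigD1 w1)//= ltr_pwDl ?mulr_gt0// sumr_ge0// => w _.
  by rewrite mulr_ge0// ltW.
have eigen v : \sum_w A v w * x w = t * x v.
  apply/eqP; rewrite eq_le tx andbT leNgt; apply/negP => lt_v.
  pose y u := \sum_w A u w * x w - t * x u.
  have y0 u : 0 <= y u by rewrite subr_ge0.
  have yv : 0 < y v by rewrite subr_gt0.
  have zy u : \sum_w A u w * z w - t * z u = \sum_w mpow A m u w * y w.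
    rewrite /y /z; under [RHS]eq_bigr do rewrite mulrBr.
    rewrite sumrB mulr_sumr; congr (_ - _); last by apply: eq_bigr => w _; rewrite mulrCA.
    transitivity (\sum_w mpow A m.+1 u w * x w).
      under [RHS]eq_bigr do rewrite /= mulr_suml.
      rewrite exchange_big/=; apply: eq_bigr => w _; rewrite mulr_sumr.
      by apply: eq_bigr => b _; rewrite mulrA.
    under eq_bigr do rewrite mpowSr mulr_suml.
    rewrite exchange_big/=; apply: eq_bigr => w _; rewrite mulr_sumr.
    by apply: eq_bigr => b _; rewrite mulrA.
  have pos u : 0 < (\sum_w A u w * z w - t * z u) / z u.
    rewrite divr_gt0// zy (bigD1 v)//= ltr_pwDl ?mulr_gt0// sumr_ge0// => w _.
    by rewrite mulr_ge0// ltW.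
  have [e e0 eP] := pos_lower_bound pos.
  have S0 : 0 < \sum_v z v by rewrite (bigD1 v)//= ltr_pwDl// sumr_ge0// => w _; exact: ltW.
  have : t + e <= t; last by rewrite gerDl leNgt e0.
  apply: (tmax _ (fun v => z v / \sum_v z v)); first by rewrite addr_ge0// ltW.
  split.
  - by move=> u; rewrite divr_ge0// ltW.
  - by rewrite -mulr_suml divff// gt_eqF.
  - move=> u; have := eP u; rewrite ler_pdivlMr// => h.
    rewrite mulrA; have -> : \sum_w A u w * (z w / \sum_v z v) = (\sum_w A u w * z w) / \sum_v z v.
      by rewrite mulr_suml; apply: eq_bigr => w _; rewrite mulrA.
    by rewrite ler_wpM2r ?invr_ge0 ?(ltW S0)// mulrDl -lerBrDl.
have zE n v : \sum_w mpow A n v w * x w = t ^+ n * x v.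
  elim: n v => [|n IH] v; first by rewrite /= sum_delta expr0 mul1r.
  rewrite /=; under eq_bigr do rewrite mulr_suml.
  rewrite exchange_big/= exprS.
  transitivity (\sum_w A v w * (t ^+ n * x w)).
    apply: eq_bigr => w _; rewrite -IH mulr_sumr.
    by apply: eq_bigr => b _; rewrite mulrA.
  under eq_bigr do rewrite mulrCA.
  by rewrite -mulr_sumr eigen mulrCA mulrA.
have xpos v : 0 < x v.
  rewrite lt_neqAle x0 andbT eq_sym; apply/eqP => xv.
  by have := z0 v; rewrite /z zE xv mulr0 ltxx.
exists t, x; split => //.
rewrite -(pmulr_lgt0 _ (xpos v0)) -eigen (bigD1 v0)//= ltr_pwDl ?mulr_gt0//.
by apply: sumr_ge0 => w _; rewrite mulr_ge0// ltW.
Qed.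

End PerronVector.

(** * Powers of a primitive stochastic matrix *)

Section StochasticLimit.
Context {R : realType} {W : finType}.
Variable p : W -> W -> R.
Hypothesis p_ge0 : forall v w, 0 <= p v w.
Hypothesis p1 : forall v, \sum_w p v w = 1.

Let avg n (f : W -> R) v : R := \sum_w mpow p n v w * f w.

Let osc_le (f : W -> R) (r : R) := forall v v', f v - f v' <= r.

Let pw_ge0 n v w : 0 <= mpow p n v w. Proof. exact: mpow_ge0. Qed.

(** Doeblin's contraction: compared with the value f w', the mass at least e that each row puts on
    w' contributes nothing, so at most the fraction 1 - e of the oscillation survives. *)
Let osc_avg n f r (e : R) : 0 <= r -> 0 <= e -> (forall v w, e <= mpow p n v w) ->
  osc_le f r -> osc_le (avg n f) ((1 - e) * r).
Proof.
move=> r0 e0 pe fr.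
have step v w' : avg n f v - f w' <= (1 - e) * r.
  have -> : avg n f v - f w' = \sum_w mpow p n v w * (f w - f w').
    under [RHS]eq_bigr do rewrite mulrBr.
    by rewrite sumrB -mulr_suml mpow_stochastic// mul1r.
  rewrite (bigD1 w')//= subrr mulr0 add0r.
  have /le_trans : \sum_(w | w != w') mpow p n v w * (f w - f w') <=
      \sum_(w | w != w') mpow p n v w * r.
    by apply: ler_sum => w _; rewrite ler_wpM2l.
  apply; rewrite -mulr_suml ler_wpM2r//.
  have := mpow_stochastic n p1 v; rewrite (bigD1 w')//= => H.
  by have := pe v w'; lra.
move=> v v'.
have -> : avg n f v - avg n f v' = \sum_w' mpow p n v' w' * (avg n f v - f w').
  under [RHS]eq_bigr do rewrite mulrBr.
  by rewrite sumrB -mulr_suml mpow_stochastic// mul1r.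
have /le_trans : \sum_w' mpow p n v' w' * (avg n f v - f w') <=
    \sum_w' mpow p n v' w' * ((1 - e) * r).
  by apply: ler_sum => w _; rewrite ler_wpM2l.
by apply; rewrite -mulr_suml mpow_stochastic// mul1r.
Qed.

Let avg_near n f r v : osc_le f r -> `|avg n f v - f v| <= r.
Proof.
move=> fr.
have -> : avg n f v - f v = \sum_w mpow p n v w * (f w - f v).
  under [RHS]eq_bigr do rewrite mulrBr.
  by rewrite sumrB -mulr_suml mpow_stochastic// mul1r.
rewrite (le_trans (ler_norm_sum _ _ _))//.
have /le_trans : \sum_w `|mpow p n v w * (f w - f v)| <= \sum_w mpow p n v w * r.
  apply: ler_sum => w _; rewrite normrM ger0_norm// ler_wpM2l// ler_norml fr andbT.
  by rewrite lerNl opprB fr.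
by apply; rewrite -mulr_suml mpow_stochastic// mul1r.
Qed.

(** Every m further steps contract the oscillation of a column by 1 - e, so the columns approach
    constants. The lower bound e persists for all later powers and makes the limit positive. *)
Lemma stochastic_limit (v0 : W) m : (forall v w, 0 < mpow p m v w) -> exists pi : W -> R,
  [/\ forall w, 0 < pi w, forall v w, (fun n => mpow p n v w) @ \oo --> pi w &
      forall w, \sum_v pi v * p v w = pi w].
Proof.
move=> pm.
have [e e0 eP] : exists2 e, 0 < e & forall v w, e <= mpow p m v w.
  have [e e0 eP] := @pos_lower_bound R (W * W)%type (fun u => mpow p m u.1 u.2) (fun u => pm u.1 u.2).
  by exists e => // v w; exact: (eP (v, w)).
have mono n w v : e <= mpow p (n + m) v w.
  rewrite mpowD -[leLHS]mul1r -(mpow_stochastic n p1 v) mulr_suml.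
  by apply: ler_sum => z _; rewrite ler_wpM2l.
have avgE n k w v : mpow p (n + k) v w = avg n (fun u => mpow p k u w) v by exact: mpowD.
have pw_le1 n v w : `|mpow p n v w| <= 1.
  by rewrite ger0_norm// -(mpow_stochastic n p1 v) (bigD1 w)//= lerDl sumr_ge0.
have e1 : 0 <= 1 - e.
  by have := eP v0 v0; have := pw_le1 m v0 v0; rewrite ger0_norm//; lra.
have osc j w : osc_le (fun v => mpow p (j * m) v w) ((1 - e) ^+ j).
  elim: j => [|j IH] v v'.
    rewrite expr0; have := pw_le1 0%N v w; have := pw_le1 0%N v' w.
    by rewrite !ger0_norm// => h1 h2; have := pw_ge0 0 v' w; lra.
  rewrite exprS mulSn !avgE.
  by apply: (osc_avg (e := e)) => //; [exact: exprn_ge0|exact: ltW].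
pose pi w := limn_sup (fun n => mpow p n v0 w).
(* With r = (1 - e)^j, every later entry lies within 2 r of the reference entry at time j m: r for
   averaging and r for changing the row. The limit does too, whence the factor 4. *)
have near_pi w j k v : (j * m <= k)%N -> `|pi w - mpow p k v w| <= 4 * (1 - e) ^+ j.
  move=> jk; set r := (1 - e) ^+ j; set N := (j * m)%N in jk.
  have r0 : 0 <= r by rewrite exprn_ge0.
  have H k' v' : (N <= k')%N -> `|mpow p k' v' w - mpow p N v0 w| <= 2 * r.
    move=> Nk; have h1 := avg_near (k' - N) v' (osc j w).
    rewrite -avgE subnK// in h1.
    have h2 := osc j w v' v0; have h3 := osc j w v0 v'.
    move: h1; rewrite !ler_norml => /andP[h4 h5].
    by rewrite -/r -/N in h2 h3 h4 h5; apply/andP; split; lra.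
  have h1 : pi w <= mpow p N v0 w + 2 * r.
    apply: (limn_sup_le (N := N) (fun n => pw_le1 n v0 w)) => n Nn.
    by have := H n v0 Nn; rewrite ler_norml => /andP[]; lra.
  have h2 : mpow p N v0 w - 2 * r <= pi w.
    apply/ler_addgt0Pr => e' e'0.
    have [K KP] := limn_sup_eventually (fun n => pw_le1 n v0 w) e'0.
    have := KP (maxn K N) (leq_maxl _ _); rewrite -/(pi w) => h2.
    have := H (maxn K N) v0 (leq_maxr _ _); rewrite ler_norml => /andP[h3 h4].
    lra.
  have := H k v jk; rewrite !ler_norml => /andP[h3 h4].
  by apply/andP; split; lra.
have cpi v w : (fun n => mpow p n v w) @ \oo --> pi w.
  apply/seq_cvgP => e' e'0.
  have q01 : 0 <= 1 - e < 1 by rewrite e1 /= ltrBlDr ltrDl.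
  have /seq_cvgP/(_ _ (divr_gt0 e'0 (ltr0n R 4)))[j jP] := cvg_geo_bw 0 q01.
  exists (j * m)%N => k jk; rewrite (le_trans (near_pi w j k v jk))//.
  have := jP j (leqnn j); rewrite sub0r normrN bw0 mulr1 ger0_norm ?exprn_ge0// => h.
  by lra.
exists pi; split => //.
  move=> w; rewrite (lt_le_trans e0)//.
  apply: (ler_cvg_to (cvg_cst e) (cpi v0 w)).
  by exists m => // n mn /=; rewrite -(subnK mn).
move=> w; have h1 : (fun n => mpow p n.+1 v0 w) @ \oo --> pi w.
  by have := cpi v0 w; rewrite -cvg_shiftS.
have h2 : (fun n => mpow p n.+1 v0 w) @ \oo --> \sum_v pi v * p v w.
  have -> : (fun n => mpow p n.+1 v0 w) = (fun n => \sum_z mpow p n v0 z * p z w).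
    by apply/funext => n; rewrite mpowSr.
  apply: cvg_big => [|z _]; first exact: add_continuous.
  by apply: cvgM; [exact: cpi|exact: cvg_cst].
exact: (cvg_unique _ h2 h1).
Qed.

End StochasticLimit.

(** * Linear systems of positive operators *)

Section OperatorSystems.
Context {d : measure_display} {X : measurableType d} {R : realType}.
Variable nu : probability X R.
Variables (W : finType) (A : W -> W -> R) (Q : W -> W -> (X -> R) -> X -> R).
Hypothesis kQ : forall v w, kop nu (A v w) (Q v w).

Fixpoint opow n v w : (X -> R) -> X -> R :=
  if n is m.+1 then fun f x => \sum_z Q v z (opow m z w f) x
  else fun f x => (v == w)%:R * f x.

Lemma kop_opow n v w : kop nu (mpow A n v w) (opow n v w).
Proof.
elim: n v w => [|n IH] v w /=.
  by have := kop_scale (ler0n R (v == w)) (kop_id nu); rewrite mulr1.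
by apply: kop_sum => z; apply: kop_comp.
Qed.

Lemma sys_mat_ge0 v w : 0 <= A v w.
Proof. exact: kop_ge0 (kQ v w). Qed.

Lemma opow_Sr n v w f x : opow n.+1 v w f x = \sum_z opow n v z (Q z w f) x.
Proof.
elim: n v x => [|n IH] v x.
  rewrite /= (sum_delta (fun z => Q z w f x)).
  rewrite -(sum_deltar (fun z => Q v z f x)); apply: eq_bigr => z _.
  by rewrite (kopZ (kQ v z)) mulrC.
rewrite /=; transitivity (\sum_z \sum_u Q v z (opow n z u (Q u w f)) x).
  apply: eq_bigr => z _.
  have -> : (fun x0 => \sum_z0 Q z z0 (opow n z0 w f) x0) =
      (fun y => \sum_u opow n z u (Q u w f) y) by apply/funext => y; exact: IH.
  by rewrite (kop_sumr _ _ (kQ v z)).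
by rewrite exchange_big.
Qed.

Lemma opow_iter (S : nat -> W -> X -> R) :
  (forall n v x, S n.+1 v x = \sum_w Q v w (S n w) x) ->
  forall k n v x, S (n + k)%N v x = \sum_w opow k v w (S n w) x.
Proof.
move=> SS k n; elim: k => [|k IH] v x; first by rewrite addn0 /= sum_delta.
rewrite addnS SS /=.
transitivity (\sum_w \sum_u Q v w (opow k w u (S n u)) x); last by rewrite exchange_big.
apply: eq_bigr => w _.
have -> : S (n + k)%N w = (fun y => \sum_u opow k w u (S n u) y).
  by apply/funext => y; exact: IH.
by rewrite (kop_sumr _ _ (kQ v w)).
Qed.

(** What the source injects at time n - m is transported by m further steps; [r 0] doubles as the
    initial value. *)
Lemma duhamel (S r : nat -> W -> X -> R) :
  (forall v x, S 0%N v x = r 0%N v x) ->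
  (forall n v x, S n.+1 v x = \sum_w Q v w (S n w) x + r n.+1 v x) ->
  forall n v x, S n v x = \sum_w psum (fun m => opow m v w (r (n - m)%N w) x) n.
Proof.
move=> S0 SS; elim=> [|n IH] v x.
  by rewrite S0; under eq_bigr do rewrite psum0 /=; rewrite sum_delta.
rewrite SS addrC.
under [RHS]eq_bigr => w _.
  rewrite /psum big_ord_recl/= subn0.
  over.
rewrite big_split/= sum_delta; congr (_ + _).
transitivity (\sum_z \sum_w psum (fun m => Q v z (opow m z w (r (n - m)%N w)) x) n).
  apply: eq_bigr => z _.
  have -> : S n z = (fun y => \sum_w psum (fun m => opow m z w (r (n - m)%N w) y) n).
    by apply/funext => y; exact: IH.
  rewrite (kop_sumr _ _ (kQ v z)); apply: eq_bigr => w _.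
  exact: (kop_psum (fun m => opow m z w (r (n - m)%N w)) _ _ (kQ v z)).
rewrite exchange_big/=; apply: eq_bigr => w _.
by rewrite exchange_big/=.
Qed.

Section Primitive.
Variables (v0 : W) (m : nat).
Hypothesis Am : forall v w, 0 < mpow A m v w.
Hypothesis A00 : 0 < A v0 v0.

(* Conjugating by the Perron vector turns Q into a Markov operator. *)
Lemma primitive_ergodic : exists l, 0 < l /\ forall v w,
  (exists2 delta, 0 < delta & (fun n => l ^- n * mpow A n v w) @ \oo --> (delta : R)) /\
  (forall f, bmeas f -> {ae nu, forall x,
    cvgn (fun n => psum (fun j => l ^- j * opow j v w f x) n / n.+1%:R)}).
Proof.
have [l [h [l0 h0 Ah]]] := perron_vector sys_mat_ge0 Am A00.
exists l; split => //.
have ln0 : l != 0 by rewrite gt_eqF.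
have hn0 v : h v != 0 by rewrite gt_eqF.
have lpow n : l ^+ n != 0 by rewrite expf_neq0.
pose p v w := h w / (l * h v) * A v w.
have p_ge0 v w : 0 <= p v w.
  by rewrite mulr_ge0 ?sys_mat_ge0// divr_ge0 ?mulr_ge0 ?ltW.
have p1 v : \sum_w p v w = 1.
  transitivity ((l * h v)^-1 * \sum_w A v w * h w).
    by rewrite mulr_sumr; apply: eq_bigr => w _; rewrite /p mulrAC mulrC (mulrC (h w)).
  by rewrite Ah mulVf// mulf_neq0.
have mpowE n v w : mpow p n v w = l ^- n * mpow A n v w * (h w / h v).
  elim: n v => [|n IH] v /=.
    have [->|vw] := eqVneq v w; last by rewrite mulr0 mul0r.
    by rewrite expr0 invr1 !mul1r divff.
  rewrite mulr_sumr mulr_suml; apply: eq_bigr => z _.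
  rewrite IH /p exprS; field.
  by rewrite !hn0 ln0 lpow.
have pm v w : 0 < mpow p m v w.
  by rewrite mpowE mulr_gt0 ?divr_gt0// mulr_gt0// invr_gt0 exprn_gt0.
have [pi [pi0 cpi pip]] := stochastic_limit p_ge0 p1 v0 pm.
move=> v w; split.
  exists (pi w * (h v / h w)); first by rewrite mulr_gt0 ?divr_gt0.
  have -> : (fun n => l ^- n * mpow A n v w) = (fun n => mpow p n v w * (h v / h w)).
    by apply/funext => n; rewrite mpowE; field; rewrite !hn0 lpow.
  by apply: cvgM; [exact: cpi|exact: cvg_cst].
move=> f bf.
pose P u z g x := h z / (l * h u) * Q u z g x.
have kP u z : kop nu (p u z) (P u z).
  by apply: kop_scale => //; rewrite divr_ge0 ?mulr_ge0 ?ltW.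
(* Starting function carried by the single vertex w; the factor 1 / h w undoes the conjugation on
   that side, so that the iterates reproduce the entries (u, w) of the operator powers. *)
pose F u x := (u == w)%:R / h w * f x.
have iterE n u x : iter n (mstep P) F u x = l ^- n * (h u)^-1 * opow n u w f x.
  elim: n u x => [|n IH] u x /=.
    rewrite /F expr0 invr1 mul1r mulrA; congr (_ * _).
    by have [->|uw] := eqVneq u w; rewrite ?mul0r ?mulr0// mulr1 mul1r.
  rewrite /mstep mulr_sumr; apply: eq_bigr => z _.
  have -> : iter n (mstep P) F z = (fun y => (l ^- n * (h z)^-1) * opow n z w f y).
    by apply/funext => y; rewrite IH.
  rewrite /P (kopZ (kQ u z)) exprS; field.
  by rewrite !hn0 ln0 lpow.
have bF u : bmeas (F u) by exact: bmeasZ.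
apply: filterS (pointwise_ergodic kP p1 pi0 pip bF) => x /(_ v) H.
apply/cvg_ex; exists (h v * limn_sup (fun n => mavg P F n v x)).
have -> : (fun n => psum (fun j => l ^- j * opow j v w f x) n / n.+1%:R) =
  (fun n => h v * mavg P F n v x); last exact: cvg_scale.
apply/funext => n; rewrite /mavg mulrA; congr (_ / _).
rewrite /psum mulr_sumr; apply: eq_bigr => j _; rewrite iterE.
by field; rewrite hn0 lpow.
Qed.

Lemma primitive_tame (a : nat -> W -> R) (r : nat -> W -> X -> R) :
  (forall w, tame nu (a ^~ w) (r ^~ w)) -> forall v,
  tame nu (fun n => \sum_w psum (fun m => mpow A m v w * a (n - m)%N w) n)
    (fun n x => \sum_w psum (fun m => opow m v w (r (n - m)%N w) x) n).
Proof.
move=> ar v; apply: tame_sum => w.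
have [l [l0 /(_ v w)[[delta delta0 cd] erg]]] := primitive_ergodic.
have l0' n : 0 <= l ^- n by rewrite invr_ge0 exprn_ge0// ltW.
have kD n : kop nu (l ^- n * mpow A n v w) (fun f x => l ^- n * opow n v w f x).
  by apply: kop_scale => //; exact: kop_opow.
have := tame_convolution kD cd delta0 l0 erg (ar w).
have lnV n (t : R) : l ^+ n * (l ^- n * t) = t.
  by rewrite mulrA divff ?mul1r// expf_neq0// gt_eqF.
congr tame.
  by apply/funext => n; apply: eq_bigr => j _; rewrite -mulrA lnV.
by apply/funext => n; apply/funext => x; apply: eq_bigr => j _; rewrite lnV.
Qed.

End Primitive.
End OperatorSystems.

(** * Induction over the strongly connected components *)

Section GraphSystems.
Context {d : measure_display} {X : measurableType d} {R : realType}.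
Variable nu : probability X R.
Variables (V : finType) (A : V -> V -> R) (Q : V -> V -> (X -> R) -> X -> R).
Hypothesis kQ : forall v w, kop nu (A v w) (Q v w).
Variables (a : nat -> V -> R) (S : nat -> V -> X -> R).
Hypothesis S0 : forall v, measurable_fun setT (S 0%N v) /\ forall x, 0 <= S 0%N v x <= a 0%N v.
Hypothesis aS : forall n v, a n.+1 v = \sum_w A v w * a n w.
Hypothesis SS : forall n v x, S n.+1 v x = \sum_w Q v w (S n w) x.

Let A_ge0 v w : 0 <= A v w. Proof. exact: sys_mat_ge0 kQ v w. Qed.

Lemma system_dominated v : dominated (a ^~ v) (S ^~ v).
Proof.
move=> n; elim: n v => [|n IH] v; first exact: S0.
split.
  have -> : S n.+1 v = (fun x => \sum_w Q v w (S n w) x) by apply/funext => x; exact: SS.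
  by apply: measurable_sum => w; apply: (kop_meas (kQ v w)); case: (IH w).
move=> x; rewrite SS aS; have H w : 0 <= Q v w (S n w) x <= A v w * a n w.
  have [_] := kop_dominated (a := fun=> a n w) (s := fun=> S n w) (kQ v w) (fun=> IH w) n.
  exact.
by apply/andP; split; [apply: sumr_ge0|apply: ler_sum] => w _; have /andP[] := H w.
Qed.

Let edge : rel V := fun v w => 0 < A v w.

(* If a vertex with an outgoing edge on a cycle carries a loop, every strongly
   connected component is primitive or trivial. *)
Hypothesis loops : forall v w, edge v w -> connect edge w v -> edge v v.

(** Without an edge the coefficient is 0 and the term vanishes whatever happens at w, so the
    induction only has to speak of actual successors. *)
Let tame_edge v w : (edge v w -> tame nu (a ^~ w) (S ^~ w)) ->
  tame nu (fun n => A v w * a n w) (fun n => Q v w (S n w)).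
Proof.
move=> H; have [/H/(tame_kop (kQ v w))//|] := boolP (edge v w).
rewrite /edge -leNgt => Avw; have Avw0 : A v w = 0 by apply/eqP; rewrite eq_le Avw A_ge0.
apply: tame0; first exact: (kop_dominated (kQ v w) (system_dominated w)).
by exists 0%N => n _; rewrite Avw0 mul0r.
Qed.

Let tame_step v (C : {pred V}) : (forall w, w \in C -> edge v w -> tame nu (a ^~ w) (S ^~ w)) ->
  tame nu (prepend (a 0%N v) (fun n => \sum_(w in C) A v w * a n w))
    (prepend (S 0%N v) (fun n x => \sum_(w in C) Q v w (S n w) x)).
Proof.
move=> H; apply: tame_prepend; [|by case: (S0 v)..].
have -> : (fun n => \sum_(w in C) A v w * a n w) =
    (fun n => \sum_(w : {w | w \in C}) A v (val w) * a n (val w)).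
  by apply/funext => n; rewrite big_sub.
have -> : (fun n x => \sum_(w in C) Q v w (S n w) x) =
    (fun n x => \sum_(w : {w | w \in C}) Q v (val w) (S n (val w)) x).
  by apply/funext => n; apply/funext => x; rewrite big_sub.
by apply: tame_sum => w; apply: tame_edge; apply: H; exact: (valP w).
Qed.

(** Induction on the number of vertices reachable from v: a vertex reachable from v but not leading
    back to it reaches strictly fewer, since v is lost. *)
Theorem system_tame v : tame nu (a ^~ v) (S ^~ v).
Proof.
have [N] := ubnP #|[pred w | connect edge v w]|; elim: N v => // N IH v.
rewrite ltnS => anc.
have IH' w : connect edge v w -> ~~ connect edge w v -> tame nu (a ^~ w) (S ^~ w).
  move=> vw wv; apply: IH; apply: leq_trans anc; apply: proper_card.
  apply/properP; split.
    by apply/fintype.subsetP => z; rewrite !inE; exact: connect_trans.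
  by exists v; rewrite !inE ?connect0.
have [vv|vv] := boolP (edge v v); last first.
  (* Without a loop at v, [loops] forbids any successor to lead back to v, so the recursion itself
     expresses the sequence at v by smaller cases. *)
  have H w : w \in [pred w : V | true] -> edge v w -> tame nu (a ^~ w) (S ^~ w).
    move=> _ vw; apply: IH'; first exact: connect1.
    by apply: contra vv; exact: loops.
  have := tame_step H; congr tame.
    by apply/funext; case=> [|n] //=; rewrite aS.
  by apply/funext; case=> [|n] //=; apply/funext => x; rewrite SS.
pose C := [pred w | connect edge v w && connect edge w v].
pose W : finType := {w : V | w \in C}.
have WC (w : W) : connect edge v (val w) /\ connect edge (val w) v.
  by apply/andP; have := valP w.
have vC : v \in C by rewrite inE !connect0.
pose v0 : W := Sub v vC.
pose AW (w z : W) := A (val w) (val z).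
pose QW (w z : W) := Q (val w) (val z).
have kQW w z : kop nu (AW w z) (QW w z) by exact: kQ.
(* For w other than v, the path from w back to v begins with an edge whose head leads back to w
   through v; [loops] applies to this edge. *)
have loopW (w : W) : 0 < AW w w.
  have [vw wv] := WC w; have [wv0|wnv] := eqVneq (val w) v.
    by rewrite /AW wv0.
  have /connectP[[|z p] /=] := wv; first by move=> _ vEw; case/eqP: wnv; exact: esym vEw.
  move=> /andP[wz zp] lp; apply: (loops wz).
  apply: connect_trans vw; apply/connectP; exists p => //.
have conn (w z : W) : exists n, 0 < mpow AW n w z.
  have : connect edge (val w) (val z).
    by apply: connect_trans (WC w).2 (WC z).1.
  move=> /connectP[p]; elim: p w => [|y p IHp] w /=.
    move=> _ zw; exists 0%N => /=; have -> : w = z by apply/val_inj.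
    by rewrite eqxx ltr01.
  move=> /andP[wy yp] lp.
  have yC : y \in C.
    rewrite inE; apply/andP; split.
      exact: connect_trans (WC w).1 (connect1 wy).
    apply: connect_trans (WC z).2; apply/connectP; exists p => //.
  have [n nP] := IHp (Sub y yC) yp lp.
  exists (1 + n)%N; apply: (mpowD_gt0 (z := Sub y yC)) nP => //.
    by move=> *; exact: A_ge0.
  by rewrite mpow1.
have AW0 w z : 0 <= AW w z by exact: A_ge0.
have loopn n (w : W) : 0 < mpow AW n w w.
  elim: n => [|n IHn]; first by rewrite /= eqxx ltr01.
  by rewrite -add1n; apply: (mpowD_gt0 (z := w)) => //; rewrite mpow1.
have [m mP] : exists m, forall w z, 0 < mpow AW m w z.
  have /choice[f fP] : forall u : W * W, exists n, 0 < mpow AW n u.1 u.2.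
    by move=> u; exact: conn.
  (* The loops allow every connecting walk to be padded to one common length. *)
  exists (\max_u f u) => w z.
  have := leq_bigmax (F := f) (w, z) => /subnK <-; rewrite addnC.
  by apply: (mpowD_gt0 (z := z)) => //; exact: (fP (w, z)).
pose C' : {pred V} := [predC C].
(* The source at w collects what enters from outside the component; the vertices it comes from are
   covered by the induction hypothesis. *)
pose ra (n : nat) (w : W) := prepend (a 0%N (val w)) (fun n => \sum_(z in C') A (val w) z * a n z) n.
pose rS (n : nat) (w : W) := prepend (S 0%N (val w)) (fun n x => \sum_(z in C') Q (val w) z (S n z) x) n.
have tr w : tame nu (ra ^~ w) (rS ^~ w).
  apply: tame_step => z zC wz; have vz := connect_trans (WC w).1 (connect1 wz).
  apply: IH' => //; apply/negP => zv.
  by move: zC; rewrite !inE vz zv.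
have SE n (w : W) x : S n (val w) x =
    \sum_(z : W) psum (fun m => opow QW m w z (rS (n - m)%N z) x) n.
  apply: (duhamel kQW (S := fun n w => S n (val w)) (r := rS)) => // k u y.
  rewrite SS (bigID (mem C))/=; congr (_ + _).
  by rewrite (big_sub C (fun z => Q (val u) z (S k z) y)).
have aE n (w : W) : a n (val w) =
    \sum_(z : W) psum (fun m => mpow AW m w z * ra (n - m)%N z) n.
  have [x _] : exists x : X, True by apply: (@ae_inhabited _ _ _ nu); exact: aeW.
  (* The scalar recursion is written as an operator recursion on constant functions, so that
     [duhamel] applies to it as well. *)
  have step k (u : W) (y : X) : a k.+1 (val u) = \sum_z QW u z (fun=> a k (val z)) y + ra k.+1 u.
    rewrite aS (bigID (mem C))/=; congr (_ + _).
    rewrite (big_sub C (fun z => A (val u) z * a k z)); apply: eq_bigr => z _.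
    by rewrite (kop_cst (kQW u z)).
  rewrite (duhamel (S := fun n (u : W) _ => a n (val u)) (r := fun n u _ => ra n u) kQW
    (fun _ _ => erefl) step n w x).
  apply: eq_bigr => z _; apply: eq_bigr => j _.
  by rewrite (kop_cst (kop_opow kQW j w z)).
have := primitive_tame kQW mP (loopW v0) tr v0; congr tame.
  by apply/funext => n; rewrite -(aE n v0).
by apply/funext => n; apply/funext => x; rewrite -(SE n v0 x).
Qed.

End GraphSystems.

(** * Removal of periodicity *)

Section PeriodicSystems.
Context {d : measure_display} {X : measurableType d} {R : realType}.
Variable nu : probability X R.
Variables (V : finType) (A : V -> V -> R) (Q : V -> V -> (X -> R) -> X -> R).
Hypothesis kQ : forall v w, kop nu (A v w) (Q v w).
Variables (a : nat -> V -> R) (S : nat -> V -> X -> R).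
Hypothesis S0 : forall v, measurable_fun setT (S 0%N v) /\ forall x, 0 <= S 0%N v x <= a 0%N v.
Hypothesis aS : forall n v, a n.+1 v = \sum_w A v w * a n w.
Hypothesis SS : forall n v x, S n.+1 v x = \sum_w Q v w (S n w) x.

Let A_ge0 v w : 0 <= A v w. Proof. exact: sys_mat_ge0 kQ v w. Qed.

Lemma mpow_loopM n k v : 0 < mpow A n v v -> 0 < mpow A (n * k) v v.
Proof.
move=> nP; elim: k => [|k IH]; first by rewrite muln0 /= eqxx ltr01.
by rewrite mulnS; apply: (mpowD_gt0 (z := v)).
Qed.

(* Passing to the q-th power of the system removes all periodicities. *)
Lemma system_tame_period : exists2 q, (0 < q)%N &
  forall r v, tame nu (fun n => a (q * n + r)%N v) (fun n => S (q * n + r)%N v).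
Proof.
(* f v is some positive return time of v if there is one, and 1 otherwise; the product q is a
   multiple of them all. *)
have /choice[f fP] : forall v, exists n, (0 < n)%N /\
    ((exists2 k, (0 < k)%N & 0 < mpow A k v v) -> 0 < mpow A n v v).
  move=> v; have [[k k0 kP]|H] := pselect (exists2 k, (0 < k)%N & 0 < mpow A k v v).
    by exists k.
  by exists 1%N.
pose q := (\prod_v f v)%N.
have q0 : (0 < q)%N by apply: prodn_gt0 => v; case: (fP v).
exists q => // r v.
pose B := mpow A q; pose QB := opow Q q.
have kQB u w : kop nu (B u w) (QB u w) by exact: kop_opow.
have opowE := opow_iter kQ SS.
have aE k n u : a (n + k)%N u = \sum_w mpow A k u w * a n w.
  elim: k u => [|k IH] u; first by rewrite addn0 /= sum_delta.
  rewrite addnS aS; under eq_bigr do rewrite IH mulr_sumr.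
  rewrite exchange_big/=; apply: eq_bigr => w _; rewrite mulr_suml.
  by apply: eq_bigr => z _; rewrite mulrA.
apply: (@system_tame _ _ _ nu V B QB kQB (fun n => a (q * n + r)%N) (fun n => S (q * n + r)%N)).
- by move=> u; exact: (system_dominated kQ S0 aS SS u (q * 0 + r)%N).
- by move=> n u; rewrite mulnS -addnA addnC aE.
- by move=> n u x; rewrite mulnS -addnA addnC opowE.
(* Edges of the q-th power are walks of length q. An edge from u to w with a way back gives a closed
   walk at u of positive length q + k, so f u is a return time of u, and so is its multiple q. *)
move=> u w uw /connectP[p]; rewrite /B.
have path_pow : forall p z, path (fun v w => 0 < B v w) z p ->
    exists k, 0 < mpow A k z (last z p).
  elim=> [|y p' IHp] z /=; first by exists 0%N; rewrite /= eqxx ltr01.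
  move=> /andP[zy /IHp[k kP]]; exists (q + k)%N.
  by apply: (mpowD_gt0 (z := y)).
move=> /path_pow[k kP] lp; rewrite -lp in kP.
have [_ fu] := fP u.
have : 0 < mpow A (f u) u u.
  apply: fu; exists (q + k)%N; first by rewrite addn_gt0 q0.
  by apply: (mpowD_gt0 (z := w)).
by rewrite /q (bigD1 u)//=; exact: mpow_loopM.
Qed.

(** The list s is a single vertex for a prescribed end of the paths and all vertices for a free end.
    Sums are formed at the level of [tame], before dividing. *)
Theorem system_cesaro (s : seq V) : {ae nu, forall x, cvgn (fun N => N%:R^-1 *
  \sum_(n < N) (\sum_(v <- s) a n v)^-1 * \sum_(v <- s) S n v x)}.
Proof.
have [q q0 qP] := system_tame_period.
have H : {ae nu, forall x, forall r, cvgn (fun m => psum (fun j =>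
    (\sum_(v <- s) a (q * j + r)%N v)^-1 * \sum_(v <- s) S (q * j + r)%N v x) m / m.+1%:R)}.
  by apply: ae_foralln => r; apply: tame_cesaro; apply: tame_sum => v; exact: qP.
apply: filterS H => x Hx.
apply: (cesaro_residues (u := fun n => (\sum_(v <- s) a n v)^-1 * \sum_(v <- s) S n v x) q0).
  move=> n; have dS v : 0 <= S n v x <= a n v.
    by have [_ /(_ x)] := system_dominated kQ S0 aS SS v n.
  have s0 : 0 <= \sum_(v <- s) S n v x by apply: sumr_ge0 => v _; case/andP: (dS v).
  have sa : \sum_(v <- s) S n v x <= \sum_(v <- s) a n v.
    by apply: ler_sum => v _; case/andP: (dS v).
  have a0 := le_trans s0 sa.
  rewrite ger0_norm ?mulr_ge0 ?invr_ge0//.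
  have [a00|an0] := eqVneq (\sum_(v <- s) a n v) 0; first by rewrite a00 invr0 mul0r.
  by rewrite mulrC ler_pdivrMr ?mul1r// lt_neqAle eq_sym an0.
by move=> r _; exact: Hx.
Qed.

End PeriodicSystems.

(** * Averages over paths *)

Section PathAverages.
Context {d : measure_display} {X : measurableType d} {R : realType}.
Variable nu : probability X R.
Variables (V E : finType) (src tgt : E -> V) (T : E -> X -> X).
Hypothesis hT : forall e, measure_preserving nu (T e).

(** The first index is the head and the second the tail: paths are extended at their last arc, which
    is the innermost map in T_l and hence the outermost operator. *)
Definition arc_op (v w : V) (f : X -> R) (x : X) : R :=
  \sum_(e : E) ((tgt e == v) && (src e == w))%:R * f (T e x).

Definition arc_mat (v w : V) : R :=
  \sum_(e : E) ((tgt e == v) && (src e == w))%:R * 1.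

Lemma kop_arc_op v w : kop nu (arc_mat v w) (arc_op v w).
Proof. by apply: kop_sum => e; apply: kop_scale; [exact: ler0n|exact: kop_map]. Qed.

Lemma sum_paths0 u v (F : seq E -> R) :
  \sum_(l in paths_uv src tgt u v 0) F l = (v == u)%:R * F [::].
Proof.
rewrite (eq_bigl (fun l : 0.-tuple E => (v == u) && (l == [tuple]))); last first.
  by move=> l; rewrite inE (tuple0 l) /= eqxx andbT eq_sym.
case: (v == u); last by rewrite big_pred0_eq mul0r.
by rewrite big_pred1_eq mul1r.
Qed.

Lemma sum_pathsS u v n (F : seq E -> R) :
  \sum_(l in paths_uv src tgt u v n.+1) F l =
  \sum_(e : E) (src e == u)%:R * \sum_(l in paths_uv src tgt (tgt e) v n) F (e :: l).
Proof.
rewrite (reindex (fun p : E * n.-tuple E => [tuple of p.1 :: p.2])); last first.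
  exists (fun l : n.+1.-tuple E => (thead l, [tuple of behead l])).
    by move=> [e l] _; congr pair; apply/val_inj.
  by move=> l _; rewrite -tuple_eta.
rewrite (eq_bigl (fun p : E * n.-tuple E => (src p.1 == u) && (p.2 \in paths_uv src tgt (tgt p.1) v n))); last first.
  by move=> [e l]; rewrite !inE.
rewrite -(pair_big_dep (fun e => src e == u) (fun e (l : n.-tuple E) => l \in paths_uv src tgt (tgt e) v n)
  (fun e (l : n.-tuple E) => F (e :: l))) /=.
rewrite big_mkcond; apply: eq_bigr => e _.
by case: (src e == u); rewrite ?mul1r ?mul0r.
Qed.

(** [is_path] peels off the first arc, whose operator is the first to act on f; the induction
    therefore uses [opow_Sr] and must let f vary. *)
Lemma sum_paths_opow u v n (f : X -> R) x :
  \sum_(l in paths_uv src tgt u v n) f (Tpath T l x) = opow arc_op n v u f x.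
Proof.
elim: n u f x => [|n IH] u f x.
  by rewrite (sum_paths0 u v (fun l => f (Tpath T l x))).
rewrite (sum_pathsS u v n (fun l => f (Tpath T l x))) (opow_Sr kop_arc_op).
have H z : opow arc_op n v z (arc_op z u f) x =
    \sum_(e : E) ((tgt e == z) && (src e == u))%:R * opow arc_op n v z (fun y => f (T e y)) x.
  have kz := kop_opow kop_arc_op n v z.
  rewrite /arc_op (kop_sumr _ _ kz); apply: eq_bigr => e _.
  by rewrite (kopZ kz).
under [RHS]eq_bigr do rewrite H.
rewrite exchange_big/=; apply: eq_bigr => e _.
rewrite (IH (tgt e) (fun y => f (T e y))).
rewrite (bigD1 (tgt e))//= eqxx/= big1 ?addr0// => z zt.
by rewrite eq_sym (negbTE zt) mul0r.
Qed.

Lemma card_paths_mpow u v n : #|paths_uv src tgt u v n|%:R = mpow arc_mat n v u.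
Proof.
have [x _] : exists x : X, True by apply: (@ae_inhabited _ _ _ nu); exact: aeW.
have := sum_paths_opow u v n (fun=> 1) x.
by rewrite sumr_const (kop_cst (kop_opow kop_arc_op n v u)) mulr1.
Qed.

Lemma is_path_functional u v v' l : is_path src tgt u v l -> is_path src tgt u v' l -> v = v'.
Proof.
elim: l u => [|e l IH] u /=; first by move=> /eqP <- /eqP <-.
by move=> /andP[_ h] /andP[_ h']; exact: IH h h'.
Qed.

Lemma sum_paths_u u n (F : n.-tuple E -> R) :
  \sum_(l in paths_u src tgt u n) F l = \sum_v \sum_(l in paths_uv src tgt u v n) F l.
Proof.
apply: partition_disjoint_bigcup => v v' vv'; rewrite -setI_eq0; apply/eqP/setP => l.
rewrite !inE; apply/negP => /andP[h h']; case/eqP: vv'.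
exact: is_path_functional h h'.
Qed.

Lemma savgE n (L : {set n.-tuple E}) (f : X -> R) x :
  savg T L f x = #|L|%:R^-1 * \sum_(l in L) f (Tpath T l x).
Proof. by rewrite /savg; case: ifP => // /eqP ->; rewrite invr0 mul0r. Qed.

Lemma cesaro_paths_ae u (s : seq V) (L : forall n, {set n.-tuple E}) :
  (forall n (F : n.-tuple E -> R),
    \sum_(l in L n) F l = \sum_(v <- s) \sum_(l in paths_uv src tgt u v n) F l) ->
  forall f : X -> R, measurable_fun setT f -> (forall x, 0 <= f x <= 1) ->
  ae_converges nu (fun N => cesaro_avg T L N f).
Proof.
move=> LE f mf f01.
pose a n v := mpow arc_mat n v u.
pose S n v x := opow arc_op n v u f x.
have S0 v : measurable_fun setT (S 0%N v) /\ forall x, 0 <= S 0%N v x <= a 0%N v.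
  split; first by apply: measurable_funM => //; exact: measurable_cst.
  move=> x; have /andP[f0 f1] := f01 x.
  by rewrite /S /a /= mulr_ge0 ?ler0n//= ler_piMr ?ler0n.
have := system_cesaro kop_arc_op S0 (fun _ _ => erefl) (fun _ _ _ => erefl) s.
apply: filterS => x H.
have -> // : (fun N => cesaro_avg T L N f x) =
  (fun N => N%:R^-1 * \sum_(n < N) (\sum_(v <- s) a n v)^-1 * \sum_(v <- s) S n v x).
apply/funext => N.
congr (_ * _); apply: eq_bigr => n _; rewrite savgE LE.
have -> : #|L n|%:R = \sum_(v <- s) a n v :> R.
  have := LE n (fun=> 1 : R); rewrite sumr_const => ->.
  by apply: eq_bigr => v _; rewrite sumr_const card_paths_mpow.
by congr (_ * _); apply: eq_bigr => v _; rewrite sum_paths_opow.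
Qed.

(** The weight may drop below 1, because empty sets of paths and the case N = 0 contribute 0. *)
Lemma kop_cesaro_avg (L : forall n, {set n.-tuple E}) N :
  exists2 c, c <= 1 & kop nu c (cesaro_avg T L N).
Proof.
have kl l : kop nu 1 (fun f x => f (Tpath T l x)).
  elim: l => [|e l IH]; first exact: kop_id.
  by have := kop_comp IH (kop_map (hT e)); rewrite mulr1.
have ks n : exists2 c, c <= 1 & kop nu c (savg T (L n)).
  exists (#|L n|%:R^-1 * \sum_(l <- enum (L n)) 1).
    rewrite big_enum/= sumr_const.
    have [->|L0] := eqVneq #|L n| 0%N; first by rewrite invr0 mul0r.
    by rewrite mulVf ?pnatr_eq0.
  have -> : savg T (L n) = (fun f x => #|L n|%:R^-1 * \sum_(l <- enum (L n)) f (Tpath T l x) :> R).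
    by apply/funext => f; apply/funext => x; rewrite savgE big_enum.
  apply: kop_scale; first by rewrite invr_ge0.
  by apply: kop_sum => l.
have /choice[c cP] : forall n, exists c, c <= 1 /\ kop nu c (savg T (L n)).
  by move=> n; have [c c1 kc] := ks n; exists c.
exists (N%:R^-1 * \sum_(n < N) c n).
  have [->|N0] := eqVneq N 0%N; first by rewrite big_ord0 mulr0.
  rewrite mulrC ler_pdivrMr ?ltr0n ?lt0n// mul1r.
  have /le_trans : \sum_(n < N) c n <= \sum_(n < N) 1 by apply: ler_sum => n _; case: (cP n).
  by apply; rewrite sumr_const card_ord.
apply: kop_scale; first by rewrite invr_ge0.
by apply: kop_sum => n; case: (cP n).
Qed.

End PathAverages.

(** * Convergence in L^p *)

Section LpNorm.
Context {d : measure_display} {X : measurableType d} {R : realType}.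
Variable nu : probability X R.
Variable p : R.
Hypothesis p1 : 1 <= p.
Implicit Types (f g : X -> R) (e c : R).

Let p0 : 0 < p. Proof. exact: lt_le_trans p1. Qed.

Let pn0 : p != 0. Proof. by rewrite gt_eqF. Qed.
Definition lpnorm f : \bar R := Lnorm nu p%:E (EFin \o f).
Definition lpint f : \bar R := (\int[nu]_x (`|f x| `^ p)%:E)%E.

Lemma measurable_powp f : measurable_fun setT f -> measurable_fun setT (fun x => (`|f x| `^ p)%:E).
Proof.
move=> mf; apply/measurable_EFinP.
apply: (@measurableT_comp _ _ _ _ _ _ (@powR R ^~ p)) => //.
exact: measurableT_comp.
Qed.

Lemma lpint_ge0 f : (0 <= lpint f)%E.
Proof. by apply: integral_ge0 => x _; rewrite lee_fin powR_ge0. Qed.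

Lemma lpnormE f : lpnorm f = (lpint f `^ p^-1)%E.
Proof. by rewrite /lpnorm unlock. Qed.

Lemma lpint_lpnorm f : lpint f = (lpnorm f `^ p)%E.
Proof. by rewrite /lpnorm powR_Lnorm. Qed.

Lemma lpnorm_ge0 f : (0 <= lpnorm f)%E.
Proof. exact: Lnorm_ge0. Qed.

Lemma lpint_lty f : (lpnorm f < +oo)%E -> (lpint f < +oo)%E.
Proof. by rewrite lpint_lpnorm; exact: poweR_lty. Qed.

Lemma lpnorm_lty f : (lpint f < +oo)%E -> (lpnorm f < +oo)%E.
Proof. by rewrite lpnormE; exact: poweR_lty. Qed.

Lemma lpint_le_lpnorm f e : 0 <= e -> (lpint f <= (e `^ p)%:E)%E -> (lpnorm f <= e%:E)%E.
Proof.
move=> e0 fe; rewrite lpnormE.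
have -> : e%:E = ((e `^ p)%:E `^ p^-1)%E by rewrite poweR_EFin -powRrM divff// powRr1.
apply: gt0_ler_poweR => //; first by rewrite invr_ge0 ltW.
  by rewrite in_itv/= lpint_ge0 leey.
by rewrite in_itv/= lee_fin powR_ge0 leey.
Qed.

Lemma lpint_ae_le f g : measurable_fun setT f -> measurable_fun setT g ->
  {ae nu, forall x, `|f x| <= `|g x|} -> (lpint f <= lpint g)%E.
Proof.
move=> mf mg fg; apply: (@ae_ge0_le_integral _ _ _ nu setT measurableT).
- by move=> x _; rewrite lee_fin powR_ge0.
- exact: measurable_powp.
- by move=> x _; rewrite lee_fin powR_ge0.
- exact: measurable_powp.
apply: filterS fg => x fgx _; rewrite lee_fin ge0_ler_powR ?nnegrE//.
exact: ltW.
Qed.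

Lemma lpnorm_ae_le f g : measurable_fun setT f -> measurable_fun setT g ->
  {ae nu, forall x, `|f x| <= `|g x|} -> (lpnorm f <= lpnorm g)%E.
Proof.
move=> mf mg fg; rewrite !lpnormE; apply: gt0_ler_poweR.
- by rewrite invr_ge0 ltW.
- by rewrite in_itv/= lpint_ge0 leey.
- by rewrite in_itv/= lpint_ge0 leey.
- exact: lpint_ae_le.
Qed.

Lemma lpnormD f g : measurable_fun setT f -> measurable_fun setT g ->
  (lpnorm (fun x => f x + g x)%R <= lpnorm f + lpnorm g)%E.
Proof. by move=> mf mg; exact: minkowski_EFin. Qed.

Lemma lpnormN f : lpnorm (fun x => - f x) = lpnorm f.
Proof.
have H : lpint (fun x => - f x) = lpint f.
  by rewrite /lpint; under eq_integral do rewrite normrN.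
by rewrite lpnormE H -lpnormE.
Qed.

Lemma lpnormB f g : measurable_fun setT f -> measurable_fun setT g ->
  (lpnorm (fun x => f x - g x)%R <= lpnorm f + lpnorm g)%E.
Proof.
move=> mf mg; rewrite -(lpnormN g); apply: lpnormD => //.
exact: measurableT_comp.
Qed.

(** Induction on [kop]: invariance of [nu] for the maps, Minkowski's inequality for sums,
    homogeneity for scalings. *)
Lemma kop_lpnorm c K f : kop nu c K -> measurable_fun setT f ->
  (lpnorm (K f) <= c%:E * lpnorm f)%E.
Proof.
move=> kK; elim: kK f => [|T [mT pT]|a a' {}K L kK IK kL IL|a' a {}K a0 kK IK|a a' {}K L kK IK kL IL] f mf.
- rewrite mul0e lpnormE (_ : lpint _ = 0%E) ?poweR0r ?invr_neq0//.
  by rewrite /lpint; under eq_integral do rewrite normr0 powR0//; rewrite integral0.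
- have H : lpint (fun x => f (T x)) = lpint f; last by rewrite lpnormE H -lpnormE mul1e.
  rewrite /lpint -[LHS](@ge0_integral_pushforward _ _ _ _ _ T mT nu setT (fun x => (`|f x| `^ p)%:E))//.
  + by apply: eq_measure_integral => A mA _; exact: pT.
  + exact: measurable_powp.
- apply: (le_trans (lpnormD (kop_meas kK mf) (kop_meas kL mf))).
  rewrite EFinD ge0_muleDl ?lee_fin ?(kop_ge0 kK) ?(kop_ge0 kL)//.
  by apply: leeD; [exact: IK|exact: IL].
- have -> : lpnorm (fun x => a' * K f x) = (a'%:E * lpnorm (K f))%E.
    have H : lpint (fun x => a' * K f x) = ((a' `^ p)%:E * lpint (K f))%E.
      transitivity (\int[nu]_x ((a' `^ p)%:E * (`|K f x| `^ p)%:E))%E.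
        by apply: eq_integral => x _; rewrite normrM (ger0_norm a0) powRM// EFinM.
      apply: ge0_integralZl_EFin => //; last exact: powR_ge0.
      exact: measurable_powp (kop_meas kK mf).
    rewrite lpnormE H [in RHS]lpnormE poweRM ?lpint_ge0 ?lee_fin ?powR_ge0//.
    by rewrite poweR_EFin -powRrM divff// powRr1.
  by rewrite EFinM -muleA lee_wpmul2l ?lee_fin ?IK.
- apply: (le_trans (IK _ (kop_meas kL mf))); rewrite EFinM -muleA lee_wpmul2l ?IL//.
  by rewrite lee_fin (kop_ge0 kK).
Qed.

Lemma kop_lpnorm_le c K f : kop nu c K -> c <= 1 -> measurable_fun setT f ->
  (lpnorm (K f) <= lpnorm f)%E.
Proof.
move=> kK c1 mf; apply: (le_trans (kop_lpnorm kK mf)); rewrite -[leRHS]mul1e.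
by rewrite lee_wpmul2r ?lpnorm_ge0 ?lee_fin.
Qed.

Lemma cvge0P (u : nat -> \bar R) : (forall n, 0 <= u n)%E ->
  (u @ \oo --> 0%E <-> forall e, 0 < e -> exists N, forall n, (N <= n)%N -> (u n <= e%:E)%E).
Proof.
move=> u0; split=> [/fine_cvgP[[N1 _ fin] /seq_cvgP c0] e e0|H].
  have [N NP] := c0 e e0; exists (maxn N1 N) => n; rewrite geq_max => /andP[h1 h2].
  rewrite -(fineK (fin n h1)) lee_fin; have := NP n h2.
  by rewrite sub0r normrN; exact: le_trans (ler_norm _).
apply/fine_cvgP; split.
  have [N NP] := H 1 ltr01; exists N => // n Nn.
  by rewrite ge0_fin_numE// (le_lt_trans (NP n Nn))// ltry.
apply/seq_cvgP => e e0; have [N NP] := H e e0; exists N => n Nn.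
have fn : u n \is a fin_num by rewrite ge0_fin_numE// (le_lt_trans (NP n Nn))// ltry.
rewrite sub0r normrN /= ger0_norm ?fine_ge0//.
by rewrite -lee_fin fineK// NP.
Qed.

Lemma lpnorm_dominated (u : nat -> X -> R) w : (forall n, measurable_fun setT (u n)) ->
  measurable_fun setT w -> (lpint w < +oo)%E ->
  {ae nu, forall x, forall n, `|u n x| <= `|w x|} ->
  {ae nu, forall x, (u ^~ x) @ \oo --> (0 : R)} ->
  (fun n => lpnorm (u n)) @ \oo --> 0%E.
Proof.
move=> mu mw wfin uw u0.
have powp0 (v : nat -> R) : v @ \oo --> (0 : R) -> (fun n => `|v n| `^ p) @ \oo --> (0 : R).
  move=> /seq_cvgP v0; apply/seq_cvgP => e e0.
  (* The bound by 1 gives |v|^p <= |v|, as p >= 1. *)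
  have [N NP] := v0 (Num.min e 1) (ltac:(by rewrite lt_min e0 ltr01)).
  exists N => n Nn; have := NP n Nn; rewrite !sub0r !normrN le_min => /andP[ve v1].
  rewrite ger0_norm ?powR_ge0// (le_trans _ ve)//.
  have [->|vn0] := eqVneq (v n) 0; first by rewrite normr0 powR0.
  by apply: ge1r_powR => //; rewrite normr_gt0 vn0.
have := @dominated_convergence _ _ _ nu setT measurableT
  (fun n x => (`|u n x| `^ p)%:E) (cst 0%E) (fun x => (`|w x| `^ p)%:E).
case.
- by move=> n; exact: measurable_powp.
- exact: measurable_cst.
- by apply: filterS u0 => x ux _; apply: cvg_EFin; [exact: nearW|exact: powp0].
- apply/integrableP; split; first exact: measurable_powp.
  by under eq_integral do rewrite gee0_abs ?lee_fin ?powR_ge0//.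
- apply: filterS uw => x uwx n _; rewrite lee_fin ger0_norm ?powR_ge0//.
  by rewrite ge0_ler_powR ?nnegrE// ltW.
move=> _ _; rewrite integral0 => /(cvge0P (fun n => lpint_ge0 (u n))) H.
apply/(cvge0P (fun n => lpnorm_ge0 (u n))) => e e0.
have [N NP] := H (e `^ p) (powR_gt0 p e0); exists N => n Nn.
by apply: lpint_le_lpnorm; [exact: ltW|exact: NP].
Qed.

End LpNorm.

(** * From functions with values in [0, 1] to the spaces L^oo and L^p *)

Section Averages.
Context {d : measure_display} {X : measurableType d} {R : realType}.
Variable nu : probability X R.
Variable C : nat -> (X -> R) -> X -> R.
Hypothesis kC : forall N, exists2 c, c <= 1 & kop nu c (C N).
Hypothesis aeC : forall f : X -> R, measurable_fun setT f -> (forall x, 0 <= f x <= 1) ->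
  ae_converges nu (fun N => C N f).
Implicit Types (f g phi : X -> R).

Lemma averages_ae_bmeas f : bmeas f -> ae_converges nu (fun N => C N f).
Proof.
move=> [mf [M0 fM0]]; pose M := Num.max 1 M0.
have M1 : 0 < M by rewrite lt_max ltr01.
have fM x : `|f x| <= M by rewrite le_max fM0 orbT.
pose h x := (2 * M)^-1 * f x + 2^-1 * 1.
have mh : measurable_fun setT h.
  by apply: measurable_funD => //; apply: measurable_funM => //; exact: measurable_cst.
have h01 x : 0 <= h x <= 1.
  have := fM x; rewrite ler_norml => /andP[f1 f2].
  have -> : h x = (f x + M) / (2 * M) by rewrite /h; field; rewrite gt_eqF.
  rewrite divr_ge0 ?mulr_ge0 ?(ltW M1)//=; last by rewrite -lerBlDr sub0r.
  by rewrite ler_pdivrMr ?mulr_gt0// mul1r; lra.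
(* Since f = 2 M h - M, the averages of the constant 1 occur too; they need not equal 1 when sets of
   paths are empty, but they converge. *)
have H1 := aeC (measurable_cst (1 : R)) (fun x => ltac:(by rewrite ler01 lexx)).
apply: filterS2 (aeC mh h01) H1 => x /cvg_ex[/= l hl] /cvg_ex[/= l1 hl1].
apply/cvg_ex; exists (2 * M * l + (- M) * l1).
have -> : (fun N => C N f x) = (fun N => 2 * M * C N h x + (- M) * C N (fun=> 1) x).
  apply/funext => N; have [c _ kc] := kC N.
  rewrite -[RHS]/((fun x => 2 * M * C N h x + (- M) * C N (fun=> 1) x) x) -(kop_lin kc).
  by congr (C N _ x); apply/funext => y; rewrite /h; field; rewrite gt_eqF.
by apply: cvgD; apply: cvg_scale.
Qed.

Lemma averages_ae phi : in_Lp nu +oo%E phi -> ae_converges nu (fun N => C N phi).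
Proof.
move=> [mphi]; rewrite /finite_norm unlock.
have -> : (nu : {measure set X -> \bar R}) setT = 1%E := probability_setT nu.
rewrite lte01 => fin.
have [M phiM] : exists M : R, {ae nu, forall x, `|phi x| <= M}.
  have H := ess_sup_ge nu (abse \o (EFin \o phi)).
  case: (ess_sup nu (abse \o (EFin \o phi))) fin H => [r _|//|_] H.
    by exists r; apply: filterS H => x; rewrite /= lee_fin.
  by exists 0; apply: filterS H => x; rewrite /= leeNy_eq.
pose f x := Num.max (- M) (Num.min (phi x) M).
have bf : bmeas f.
  split.
    apply: measurable_maxr; first exact: measurable_cst.
    by apply: measurable_minr => //; exact: measurable_cst.
  exists `|M| => x; rewrite /f ler_norml ge_max ge_min le_max ler_norm -normrN ler_norm orbT/=.
  by rewrite andbT lerNl -normrN ler_norm.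
have phif : {ae nu, forall x, phi x = f x}.
  apply: filterS phiM => x; rewrite ler_norml => /andP[h1 h2].
  by rewrite /f min_l// max_r.
have H : {ae nu, forall x, forall N, C N phi x = C N f x}.
  apply: ae_foralln => N; have [c _ kc] := kC N.
  (* [kop_ae_cvg] applied to a constant sequence shows that a.e. equal functions have a.e. equal
     images. *)
  have Hc : {ae nu, forall x, (fun _ : nat => phi x) @ \oo --> f x}.
    by apply: filterS phif => x ->; exact: cvg_cst.
  apply: filterS (kop_ae_cvg kc (F := fun _ : nat => phi) Hc) => x Hx.
  exact: (cvg_unique _ (cvg_cst (C N phi x)) Hx).
apply: filterS2 H (averages_ae_bmeas bf) => x Hx.
by have -> : (fun N => C N phi x) = (fun N => C N f x) by apply/funext => N; exact: Hx.
Qed.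

Section Lp.
Variable p : R.
Hypothesis p1 : 1 <= p.
Local Notation lpn := (lpnorm nu p).
Local Notation lpi := (lpint nu p).

Let p0 : 0 < p. Proof. exact: lt_le_trans p1. Qed.

Let mC N f : measurable_fun setT f -> measurable_fun setT (C N f).
Proof. by have [c _ kc] := kC N; exact: (kop_meas kc). Qed.

(* The limits [g k] for the truncations at level [k] increase with [k] and have
   bounded norms, which yields the limit without using completeness of L^p. *)
Lemma averages_Lp_ge0 phi : measurable_fun setT phi -> (forall x, 0 <= phi x) ->
  (lpi phi < +oo)%E -> exists g, [/\ measurable_fun setT g, (lpi g < +oo)%E &
    (fun N => lpn (fun x => C N phi x - g x)) @ \oo --> 0%E].
Proof.
move=> mphi phi0 phifin.
pose f k x := Num.min (phi x) k%:R.
have mf k : measurable_fun setT (f k).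
  by apply: measurable_minr => //; exact: measurable_cst.
have f0 k x : 0 <= f k x by rewrite le_min phi0 ler0n.
have fk k x : f k x <= k%:R by rewrite ge_min lexx orbT.
have fphi k x : f k x <= phi x by rewrite ge_min lexx.
have bf k : bmeas (f k) by split => //; exists k%:R => x; rewrite ger0_norm.
have Cf0 N k x : 0 <= C N (f k) x.
  by have [c _ kc] := kC N; exact: (kop_pos kc).
have Cfk N k x : `|C N (f k) x| <= k%:R.
  have [c c1 kc] := kC N.
  rewrite (le_trans (kop_bound kc (f := f k) (M := k%:R) _ x))//.
    by move=> y; rewrite ger0_norm.
  by rewrite ler_piMl.
pose g k x := limn_sup (fun N => C N (f k) x).
have gk k x : `|g k x| <= k%:R by apply: limn_sup_bound.
have bg k : bmeas (g k).
  by apply: (@bmeas_limn_sup _ _ _ (fun N => C N (f k)) k%:R) => // N; exact: mC.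
have mg k : measurable_fun setT (g k) by case: (bg k).
have g0 k x : 0 <= g k x.
  apply/ler_addgt0Pr => e e0.
  have [N NP] := limn_sup_eventually (fun N => Cfk N k x) e0.
  exact: le_trans (Cf0 N k x) (NP N (leqnn N)).
have gmono x : {homo g ^~ x : m n / (m <= n)%N >-> m <= n}.
  move=> m n mn; apply/ler_addgt0Pr => e e0.
  have [N NP] := limn_sup_eventually (fun N => Cfk N n x) e0.
  apply: (limn_sup_le (N := N) (fun N => Cfk N m x)) => j Nj.
  rewrite (le_trans _ (NP j Nj))//; have [c _ kc] := kC j.
  apply: (kop_le kc) => y; rewrite /f le_min !ge_min lexx/=.
  by rewrite ler_nat mn orbT.
have Cg k : (fun N => lpn (fun x => C N (f k) x - g k x)) @ \oo --> 0%E.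
  apply: (lpnorm_dominated p1 (w := fun=> k%:R + k%:R)).
  - by move=> N; apply: measurable_funB => //; exact: mC.
  - exact: measurable_cst.
  - rewrite /lpint integral_cst// (_ : (nu : {measure set X -> \bar R}) setT = 1%E) ?mule1 ?ltry//.
    exact: probability_setT.
  - apply: aeW => x N; rewrite [leRHS]ger0_norm ?addr_ge0//.
    by rewrite (le_trans (ler_normB _ _))// lerD.
  - apply: filterS (averages_ae_bmeas (bf k)) => x /cvg_ex[/= l hl].
    rewrite -(subrr (g k x)); apply: cvgB; last exact: cvg_cst.
    by rewrite /g (limn_sup_cvg hl).
(* [C N] does not increase the norm, and [C N (f k)] tends to [g k] in norm, so the bound passes to
   the limit. *)
have gphi k : (lpi (g k) <= lpi phi)%E.
  rewrite !(lpint_lpnorm nu p1); apply: gt0_ler_poweR; first exact: ltW.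
  - by rewrite in_itv/= lpnorm_ge0 leey.
  - by rewrite in_itv/= lpnorm_ge0 leey.
  apply/lee_addgt0Pr => e e0.
  have /(cvge0P (fun N => lpnorm_ge0 nu p _))/(_ e e0)[N NP] := Cg k.
  have -> : g k = (fun x => C N (f k) x - (C N (f k) x - g k x)).
    by apply/funext => x; rewrite subKr.
  apply: (le_trans (lpnormB nu p1 (mC N (mf k)) _)).
    by apply: measurable_funB => //; exact: mC.
  apply: leeD; last exact: NP.
  have [c c1 kc] := kC N; apply: (le_trans (kop_lpnorm_le p1 kc c1 (mf k))).
  by apply: lpnorm_ae_le => //; apply: aeW => x; rewrite !ger0_norm.
pose G k x := (`|g k x| `^ p)%:E.
have mG k : measurable_fun setT (G k) by exact: measurable_powp.
have G0 k x : (0 <= G k x)%E by rewrite lee_fin powR_ge0.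
have Gmono x : nondecreasing_seq (G ^~ x).
  by move=> m n mn; rewrite lee_fin ge0_ler_powR ?nnegrE ?(ltW p0)// !ger0_norm// gmono.
(* Taken in the extended reals. Monotone convergence bounds its integral by that of the p-th power
   of phi, so h is finite a.e., and h^(1/p) then bounds all [g k] at the point. *)
pose h x := limn (G ^~ x).
have cG x : G ^~ x @ \oo --> h x by exact: ereal_nondecreasing_is_cvgn.
have Gh k x : (G k x <= h x)%E.
  apply: (lime_ge (f := G ^~ x) (cG x)).
  by exists k; [exact: I|move=> n kn; exact: Gmono].
have mh : measurable_fun setT h by apply: (emeasurable_fun_cvg _ _ mG) => x _; exact: cG.
have h0 x : (0 <= h x)%E by exact: le_trans (Gh 0%N x).
have hphi : (\int[nu]_x h x <= lpi phi)%E.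
  rewrite (monotone_convergence nu measurableT mG)//.
  apply: lime_le; last by apply: nearW => k; exact: gphi.
  apply: ereal_nondecreasing_is_cvgn => m n mn.
  apply: (ge0_le_integral nu measurableT _ (mG m) (mG n)) => x _; [exact: G0|exact: Gmono].
have hint : nu.-integrable setT h.
  apply/integrableP; split => //.
  by under eq_integral do rewrite gee0_abs//; exact: le_lt_trans hphi phifin.
(* [fine] turns the value +oo into 0, which happens only on the null set where h is infinite. *)
pose gl x := fine (limn (fun k => (g k x)%:E)).
have cge x : (fun k => (g k x)%:E) @ \oo --> limn (fun k => (g k x)%:E).
  by apply: ereal_nondecreasing_is_cvgn => m n mn; rewrite lee_fin gmono.
have mgl : measurable_fun setT gl.
  apply: measurableT_comp => //; apply: (emeasurable_fun_cvg (fun k x => (g k x)%:E)) => //.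
  by move=> k; apply/measurable_EFinP.
have H : {ae nu, forall x, [/\ (fun k => g k x) @ \oo --> gl x,
    forall k, g k x <= gl x & ((`|gl x| `^ p)%:E <= h x)%E]}.
  apply: filterS (integrable_ae measurableT hint) => x /(_ I) hx.
  pose r := fine (h x) `^ p^-1.
  have gr k : g k x <= r.
    have -> : g k x = (`|g k x| `^ p) `^ p^-1.
      by rewrite -powRrM divff ?gt_eqF// powRr1// ger0_norm.
    apply: ge0_ler_powR; rewrite ?nnegrE ?powR_ge0 ?invr_ge0 ?(ltW p0) ?fine_ge0//.
    by rewrite -lee_fin fineK//; exact: Gh.
  have lr : (limn (fun k => (g k x)%:E) <= r%:E)%E.
    by apply: lime_le; [exact: cge|apply: nearW => k; rewrite lee_fin].
  have l0 : (0 <= limn (fun k => (g k x)%:E))%E.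
    by apply: lime_ge; [exact: cge|apply: nearW => k; rewrite lee_fin].
  have lfin : limn (fun k => (g k x)%:E) \is a fin_num.
    by rewrite ge0_fin_numE// (le_lt_trans lr)// ltry.
  have cgl : (fun k => g k x) @ \oo --> gl x.
    have := cge x; rewrite -(fineK lfin) => /fine_cvgP[_]; exact.
  split => //.
    by move=> k; apply: (ler_cvg_to (cvg_cst (g k x)) cgl); exists k => // n; exact: gmono.
  rewrite -(fineK hx) lee_fin.
  have -> : fine (h x) = r `^ p by rewrite /r -powRrM mulVf ?gt_eqF// powRr1// fine_ge0.
  apply: ge0_ler_powR; rewrite ?nnegrE ?(ltW p0) ?powR_ge0//.
  by rewrite ger0_norm ?fine_ge0// -lee_fin fineK.
exists gl; have glfin : (lpi gl < +oo)%E.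
  apply: le_lt_trans phifin; apply: le_trans hphi.
  apply: (@ae_ge0_le_integral _ _ _ nu setT measurableT) => //.
    exact: measurable_powp.
  by apply: filterS H => x [].
split => //.
have c1 : (fun k => lpn (fun x => phi x - f k x)) @ \oo --> 0%E.
  apply: (lpnorm_dominated p1 (w := phi)) => //.
  - by move=> k; apply: measurable_funB.
  - apply: aeW => x k; rewrite !ger0_norm ?subr_ge0//.
    by rewrite gerBl.
  - apply: aeW => x; apply/seq_cvgP => e e0; exists (Num.truncn (phi x)).+1 => k xk.
    have phik : phi x <= k%:R.
      by rewrite (le_trans (ltW (Num.Theory.truncnS_gt _)))// ler_nat.
    by rewrite /f min_l// subrr subrr normr0 (ltW e0).
have c3 : (fun k => lpn (fun x => g k x - gl x)) @ \oo --> 0%E.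
  apply: (lpnorm_dominated p1 (w := gl)) => //.
  - by move=> k; apply: measurable_funB.
  - apply: filterS H => x [_ ggl _] k; have gl0 := le_trans (g0 k x) (ggl k).
    by rewrite distrC !ger0_norm ?subr_ge0// gerBl.
  - apply: filterS H => x [cx _ _]; rewrite -(subrr (gl x)).
    by apply: cvgB => //; exact: cvg_cst.
apply/(cvge0P (fun N => lpnorm_ge0 nu p _)) => e e0.
have e3 : 0 < e / 3 by rewrite divr_gt0.
have [k1 k1P] := (cvge0P (fun k => lpnorm_ge0 nu p _)).1 c1 _ e3.
have [k3 k3P] := (cvge0P (fun k => lpnorm_ge0 nu p _)).1 c3 _ e3.
pose k := maxn k1 k3.
have [N NP] := (cvge0P (fun N => lpnorm_ge0 nu p _)).1 (Cg k) _ e3.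
exists N => n Nn; have [c cc kc] := kC n.
(* Three errors: the truncation error, not enlarged by [C n]; convergence at the fixed level k; and
   the distance from [g k] to [gl]. *)
have -> : (fun x => C n phi x - gl x) = (fun x => C n (fun y => phi y - f k y) x +
    ((C n (f k) x - g k x) + (g k x - gl x))).
  by apply/funext => x; rewrite (kopB kc); ring.
have -> : e%:E = ((e / 3)%:E + ((e / 3)%:E + (e / 3)%:E))%E.
  by rewrite -!EFinD; congr EFin; field.
have mphif : measurable_fun setT (fun y => phi y - f k y) by exact: measurable_funB.
have m2 : measurable_fun setT (fun x => C n (f k) x - g k x).
  by apply: measurable_funB => //; exact: mC.
have m3 : measurable_fun setT (fun x => g k x - gl x) by exact: measurable_funB.
apply: (le_trans (lpnormD nu p1 (mC n mphif) (measurable_funD m2 m3))).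
apply: leeD.
  apply: (le_trans (kop_lpnorm_le p1 kc cc mphif)).
  by apply: k1P; exact: leq_maxl.
apply: (le_trans (lpnormD nu p1 m2 m3)).
by apply: leeD; [exact: NP|apply: k3P; exact: leq_maxr].
Qed.

Lemma averages_Lp phi : in_Lp nu p%:E phi -> Lp_converges nu p (fun N => C N phi).
Proof.
move=> [mphi /(lpint_lty p1) phifin].
pose pos x := Num.max (phi x) 0; pose neg x := Num.max (- phi x) 0.
have mpos : measurable_fun setT pos.
  by apply: measurable_maxr => //; exact: measurable_cst.
have mneg : measurable_fun setT neg.
  apply: measurable_maxr; last exact: measurable_cst.
  exact: measurableT_comp.
have fin (f : X -> R) : measurable_fun setT f -> (forall x, `|f x| <= `|phi x|) -> (lpi f < +oo)%E.
  by move=> mf fphi; apply: le_lt_trans phifin; apply: lpint_ae_le => //; exact: aeW.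
have pos0 x : 0 <= pos x by rewrite le_max lexx orbT.
have neg0 x : 0 <= neg x by rewrite le_max lexx orbT.
have posphi x : `|pos x| <= `|phi x|.
  by rewrite (ger0_norm (pos0 x)) ge_max ler_norm normr_ge0.
have negphi x : `|neg x| <= `|phi x|.
  by rewrite (ger0_norm (neg0 x)) ge_max -normrN ler_norm normr_ge0.
have [g1 [mg1 g1fin c1]] := averages_Lp_ge0 mpos pos0 (fin _ mpos posphi).
have [g2 [mg2 g2fin c2]] := averages_Lp_ge0 mneg neg0 (fin _ mneg negphi).
exists (fun x => g1 x - g2 x); split.
  split; first exact: measurable_funB.
  apply: (le_lt_trans (lpnormB nu p1 mg1 mg2)).
  by apply: lte_add_pinfty; exact: lpnorm_lty.
apply/(cvge0P (fun N => lpnorm_ge0 nu p _)) => e e0.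
have e2 : 0 < e / 2 by rewrite divr_gt0.
have [N1 N1P] := (cvge0P (fun k => lpnorm_ge0 nu p _)).1 c1 _ e2.
have [N2 N2P] := (cvge0P (fun k => lpnorm_ge0 nu p _)).1 c2 _ e2.
exists (maxn N1 N2) => n; rewrite geq_max => /andP[n1 n2].
have [c cc kc] := kC n.
have E : C n phi \- (fun x => g1 x - g2 x) =
    (fun x => (C n pos x - g1 x) - (C n neg x - g2 x)).
  apply/funext => x.
  have -> : phi = (fun y => pos y - neg y).
    apply/funext => y; rewrite /pos /neg; case: (leP 0 (phi y)) => h.
      by rewrite max_r ?oppr_le0// subr0.
    by rewrite max_l ?oppr_ge0 ?(ltW h)// sub0r opprK.
  by rewrite (kopB kc) /=; ring.
rewrite -[X in (X <= _)%E]/(lpn (C n phi \- (fun x => g1 x - g2 x))) E.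
have -> : e%:E = ((e / 2)%:E + (e / 2)%:E)%E by rewrite -EFinD; congr EFin; field.
apply: (le_trans (lpnormB nu p1 (measurable_funB (mC n mpos) mg1) (measurable_funB (mC n mneg) mg2))).
by apply: leeD; [exact: N1P|exact: N2P].
Qed.

End Lp.
End Averages.

Theorem theorem2 (V E : finType) (src tgt : E -> V)
  (d : measure_display) (X : measurableType d) (R : realType)
  (nu : probability X R) (T : E -> X -> X)
  (hT : forall e, measure_preserving nu (T e)) (u v v0 : V) :
  (forall (p : R), 1 <= p -> forall phi : X -> R, in_Lp nu p%:E phi ->
     Lp_converges nu p (fun N => cesaro_avg T (paths_uv src tgt u v) N phi)) /\
  (forall phi : X -> R, in_Lp nu +oo%E phi ->
     ae_converges nu (fun N => cesaro_avg T (paths_uv src tgt u v) N phi)) /\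
  (forall (p : R), 1 <= p -> forall phi : X -> R, in_Lp nu p%:E phi ->
     Lp_converges nu p (fun N => cesaro_avg T (paths_u src tgt v0) N phi)) /\
  (forall phi : X -> R, in_Lp nu +oo%E phi ->
     ae_converges nu (fun N => cesaro_avg T (paths_u src tgt v0) N phi)).
Proof.
have Huv n (F : n.-tuple E -> R) : \sum_(l in paths_uv src tgt u v n) F l =
    \sum_(w <- [:: v]) \sum_(l in paths_uv src tgt u w n) F l by rewrite big_seq1.
have Hu n (F : n.-tuple E -> R) : \sum_(l in paths_u src tgt v0 n) F l =
    \sum_(w <- index_enum V) \sum_(l in paths_uv src tgt v0 w n) F l by rewrite sum_paths_u.
have Auv := cesaro_paths_ae hT Huv; have Au := cesaro_paths_ae hT Hu.
have Kuv := kop_cesaro_avg hT (paths_uv src tgt u v).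
have Ku := kop_cesaro_avg hT (paths_u src tgt v0).
split; first by move=> p p1 phi; exact: averages_Lp.
split; first by move=> phi; exact: averages_ae.
split; first by move=> p p1 phi; exact: averages_Lp.
by move=> phi; exact: averages_ae.
Qed.
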